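(* Let $M$ be a smooth compact strictly pseudoconvex CR manifold of dimension $2n+1$ that forms the boundary of a complex manifold $X$ of complex dimension $n+1$, and let $g_+$ be Fefferman's approximately Einstein metric on $X$ near $M$. For a pseudohermitian structure $\theta$ on $M$ with special defining function $\phi$, let $L$ be the coefficient of $\log(-\epsilon)$ in the asymptotic expansion, as $\epsilon\to0^-$, $$\mathrm{Vol}_+(\{\phi<\epsilon\})=c_0\epsilon^{-n-1}+c_1\epsilon^{-n}+\cdots+c_n\epsilon^{-1}+L\log(-\epsilon)+V+o(1).$$ The number $L$ is independent of the choice of pseudohermitian structure $\theta$ on $M$.
   Context: $M$ has the CR structure $T_{1,0}X\cap\mathbb CTM$. A defining function $\phi$ satisfies $\phi<0$ in $X$, $\phi=0$ and $d\phi\neq0$ on $M$. A pseudohermitian structure is a real one-form $\theta$ on $M$ annihilating the holomorphic tangent bundle and its conjugate, with positive definite Levi form (equivalently $\theta=\frac i2(\bar\partial\phi-\partial\phi)|_M$ for a defining function $\phi$). Fefferman's approximately Einstein metric $g_+$ is the K\''ahler metric on $X$ near $M$ whose K\''ahler form, locally near each boundary point, is $\omega=-\partial\bar\partial\log(-\rho)$, with $\rho$ a smooth local defining function solving in local holomorphic coordinates $\det\begin{pmatrix}\rho&\rho_{\bar k}\\ \rho_j&\rho_{j\bar k}\end{pmatrix}=-1+O(\rho^{n+2})$ (unique modulo $O(\rho^{n+3})$). Convention: $g_{j\bar k}\vartheta^j\vartheta^{\bar k}$ has K\''ahler form $g_{j\bar k}\vartheta^j\wedge\vartheta^{\bar k}$;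 volume element near $M$: $dv_+=(\frac i2)^{n+1}\frac1{(n+1)!}\omega^{n+1}$. Away from $M$ the volume is measured with any fixed Hermitian metric on $X$ whose asymptotic expansion near $M$ agrees with that of $g_+$. The special defining function of $\theta$ is the unique defining function $\phi$ near $M$ with $\frac i2(\bar\partial\phi-\partial\phi)|_M=\theta$ and $|\partial\log(-\phi)|^2_{g_+}=1$. *)

(* Defs.v *)
From HB Require Import structures.
From mathcomp Require Import all_boot all_order all_algebra.
From mathcomp Require Import complex.
From mathcomp Require Import all_classical all_reals all_analysis.

Set Implicit Arguments.
Unset Strict Implicit.
Unset Printing Implicit Defensive.
Import Order.TTheory GRing.Theory Num.Theory numFieldNormedType.Exports.
Import complex.ComplexField.
Local Open Scope classical_set_scope.
Local Open Scope ring_scope.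

Definition partial (R : realType) (k : nat) (i : 'I_k) (f : 'rV[R]_k -> R)
  : 'rV[R]_k -> R := fun x => 'D_(delta_mx 0 i) f x.

Definition iter_partial (R : realType) (k : nat) (s : seq 'I_k)
  (f : 'rV[R]_k -> R) : 'rV[R]_k -> R := foldr (@partial R k) f s.

(* C^oo on some neighbourhood of x: iterated partial derivatives of all orders
   exist and are continuous there. *)
Definition smooth_at (R : realType) (k : nat) (f : 'rV[R]_k -> R)
  (x : 'rV[R]_k) : Prop :=
  \forall y \near x, forall s : seq 'I_k,
    {for y, continuous (iter_partial s f)} /\
    forall i : 'I_k, derivable (iter_partial s f) y (delta_mx 0 i).

(* C^m is modelled on R^(m+m): the first m entries are the real parts x_j, the
   last m entries the imaginary parts y_j. *)
Notation model R m := ('rV[R]_(m + m)).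

Definition zcoord (R : realType) (m : nat) (v : model R m) (j : 'I_m) : R[i] :=
  (v 0 (lshift m j) +i* v 0 (rshift m j))%C.

Definition mulJ (R : realType) (m : nat) (v : model R m) : model R m :=
  row_mx (- rsubmx v) (lsubmx v).

Definition cpartial (R : realType) (k : nat) (i : 'I_k) (F : 'rV[R]_k -> R[i])
  (x : 'rV[R]_k) : R[i] :=
  (partial i (fun y => complex.Re (F y)) x
   +i* partial i (fun y => complex.Im (F y)) x)%C.

(* Wirtinger derivatives d/dz_j and d/d(conj z_j). *)
Definition dz (R : realType) (m : nat) (j : 'I_m) (F : model R m -> R[i])
  (x : model R m) : R[i] :=
  (cpartial (lshift m j) F x - 'i%C * cpartial (rshift m j) F x) / 2.

Definition dzbar (R : realType) (m : nat) (j : 'I_m) (F : model R m -> R[i])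
  (x : model R m) : R[i] :=
  (cpartial (lshift m j) F x + 'i%C * cpartial (rshift m j) F x) / 2.

Definition cfun (R : realType) (m : nat) (f : model R m -> R)
  : model R m -> R[i] := fun x => (f x)%:C%C.

(* G is a smooth function on a full neighbourhood of c p in R^k that represents
   F near p in the coordinates c. At a boundary point this is smoothness up to
   the boundary, and the derivatives of G at c p along the image of c do not
   depend on the choice of G. *)
Definition smooth_rep (R : realType) (k : nat) (T : topologicalType)
  (c : T -> 'rV[R]_k) (p : T) (F : T -> R) (G : 'rV[R]_k -> R) : Prop :=
  smooth_at G (c p) /\ \forall q \near p, F q = G (c q).

Definition transition_rep (R : realType) (k : nat) (T : topologicalType)
  (c d : T -> 'rV[R]_k) (p : T) (tau : 'rV[R]_k -> 'rV[R]_k) : Prop :=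
  forall i : 'I_k, smooth_rep c p (fun q => d q 0 i) (fun z => tau z 0 i).

(* A complex manifold with smooth boundary, of complex dimension m, whose
   underlying space (interior together with boundary) is T. A chart identifies
   an open set of T with {z in W | r z <= 0}, where W is open in C^m and r is a
   smooth function with dr <> 0 on {r = 0}; the latter set is the boundary.
   (A chart with r = -1 is an interior chart.) Coordinate changes are smooth up
   to the boundary and holomorphic. *)
Record complex_manifold (R : realType) (m : nat) (T : topologicalType) := {
  bdry : set T;
  chart : Type;
  dom : chart -> set T;
  coord : chart -> T -> model R m;
  coordV : chart -> model R m -> T;
  chartW : chart -> set (model R m);
  chartr : chart -> model R m -> R;
  dom_open : forall e, open (dom e);
  dom_cover : forall p, exists e, dom e p;
  chartW_open : forall e, open (chartW e);
  chartr_smooth : forall e z, chartW e z -> smooth_at (chartr e) z;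
  chartr_regular : forall e z, chartW e z -> chartr e z = 0 ->
    exists i, partial i (chartr e) z <> 0;
  coord_image : forall e,
    coord e @` dom e = [set z | chartW e z /\ chartr e z <= 0];
  coordK : forall e p, dom e p -> coordV e (coord e p) = p;
  coord_continuous : forall e, {within dom e, continuous (coord e)};
  coordV_continuous : forall e,
    {within coord e @` dom e, continuous (coordV e)};
  bdryE : forall e p, dom e p -> (bdry p <-> chartr e (coord e p) = 0);
  transition_holomorphic : forall e f p, dom e p -> dom f p ->
    exists tau, transition_rep (coord e) (coord f) p tau /\
      \forall q \near p, forall a k : 'I_m,
        dzbar k (fun z => zcoord (tau z) a) (coord e q) = 0
}.

Definition inside (R : realType) (m : nat) (T : topologicalType)
  (X : complex_manifold R m T) : set T := ~` bdry X.

(* Tangent vectors to the boundary, and those among them that are of the form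
   Z + conj Z with Z = sum_j zeta_j d/dz_j in T_{1,0}X tangent to the boundary
   (zeta_j = zcoord v j), i.e. the real form of the CR structure. *)
Definition tangent (R : realType) (m : nat) (T : topologicalType)
  (X : complex_manifold R m T) (e : chart X) (z v : model R m) : Prop :=
  \sum_i partial i (chartr e) z * v 0 i = 0.

Definition holo_tangent (R : realType) (m : nat) (T : topologicalType)
  (X : complex_manifold R m T) (e : chart X) (z v : model R m) : Prop :=
  \sum_j dz j (cfun (chartr e)) z * zcoord v j = 0.

Definition strictly_pseudoconvex (R : realType) (m : nat)
  (T : topologicalType) (X : complex_manifold R m T) : Prop :=
  forall (e : chart X) (p : T), bdry X p -> dom e p ->
  forall v : model R m, v <> 0 -> holo_tangent e (coord e p) v ->
    0 < \sum_j \sum_k dz j (dzbar k (cfun (chartr e))) (coord e p)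
          * zcoord v j * ((zcoord v k)^*)%C.

(* Real one-forms on the boundary: theta e z v is the value, in the chart e, on
   the vector v at z. It is only meaningful for v tangent to the boundary. *)
Definition boundary_form (R : realType) (m : nat) (T : topologicalType)
  (X : complex_manifold R m T) := chart X -> model R m -> model R m -> R.

(* sum_i (a i) dx_i restricts to theta on the boundary near p. *)
Definition form_rep (R : realType) (m : nat) (T : topologicalType)
  (X : complex_manifold R m T) (theta : boundary_form X) (e : chart X) (p : T)
  (a : 'I_(m + m) -> model R m -> R) : Prop :=
  (forall i, smooth_at (a i) (coord e p)) /\
  \forall q \near p, bdry X q ->
    forall v, tangent e (coord e q) v ->
      theta e (coord e q) v = \sum_i a i (coord e q) * v 0 i.

Definition is_boundary_form (R : realType) (m : nat) (T : topologicalType)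
  (X : complex_manifold R m T) (theta : boundary_form X) : Prop :=
  (forall (e : chart X) (p : T), bdry X p -> dom e p ->
     exists a, form_rep theta e p a) /\
  (forall (e f : chart X) (p : T) (tau : model R m -> model R m),
     bdry X p -> dom e p -> dom f p ->
     transition_rep (coord e) (coord f) p tau ->
     forall v, tangent e (coord e p) v ->
       theta e (coord e p) v =
       theta f (coord f p)
         (\row_i \sum_k partial k (fun z => tau z 0 i) (coord e p) * v 0 k)).

(* theta annihilates T_{1,0} and its conjugate, and its Levi form
   v |-> dtheta(v, Jv) is positive definite on the holomorphic tangent space. *)
Definition pseudohermitian (R : realType) (m : nat) (T : topologicalType)
  (X : complex_manifold R m T) (theta : boundary_form X) : Prop :=
  [/\ is_boundary_form theta,
      forall (e : chart X) (p : T), bdry X p -> dom e p ->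
        forall v, holo_tangent e (coord e p) v -> theta e (coord e p) v = 0 &
      forall (e : chart X) (p : T) a, bdry X p -> dom e p ->
        form_rep theta e p a ->
        forall v, v <> 0 -> holo_tangent e (coord e p) v ->
          0 < \sum_i \sum_j partial i (a j) (coord e p)
                * (v 0 i * mulJ v 0 j - mulJ v 0 i * v 0 j)].

Definition defining_function (R : realType) (m : nat) (T : topologicalType)
  (X : complex_manifold R m T) (phi : T -> R) : Prop :=
  [/\ forall (e : chart X) (p : T), dom e p ->
        exists G, smooth_rep (coord e) p phi G,
      forall p, inside X p -> phi p < 0,
      forall p, bdry X p -> phi p = 0 &
      forall (e : chart X) (p : T) G, bdry X p -> dom e p ->
        smooth_rep (coord e) p phi G -> exists i, partial i G (coord e p) <> 0].

(* g e z is the matrix (g_{j kbar}) of the metric in the chart e. *)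
Definition herm_field (R : realType) (m : nat) (T : topologicalType)
  (X : complex_manifold R m T) := chart X -> model R m -> 'M[R[i]]_m.

(* For S an open subset of the interior. *)
Definition hermitian_metric (R : realType) (m : nat) (T : topologicalType)
  (X : complex_manifold R m T) (S : set T) (g : herm_field X) : Prop :=
  (forall (e : chart X) (p : T), dom e p -> S p ->
    [/\ forall j k, smooth_at (fun z => complex.Re (g e z j k)) (coord e p) /\
                    smooth_at (fun z => complex.Im (g e z j k)) (coord e p),
        forall j k, g e (coord e p) k j = ((g e (coord e p) j k)^*)%C &
        forall v : 'rV[R[i]]_m, v <> 0 ->
          0 < \sum_j \sum_k g e (coord e p) j k * v 0 j * ((v 0 k)^*)%C]) /\
  (forall (e f : chart X) (p : T), dom e p -> dom f p -> S p ->
    let jac j a :=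
      dz j (fun z => zcoord (coord f (coordV e z)) a) (coord e p) in
    forall j k, g e (coord e p) j k =
      \sum_a \sum_b jac j a * g f (coord f p) a b * ((jac k b)^*)%C).

Definition local_defining_function (R : realType) (m : nat)
  (T : topologicalType) (X : complex_manifold R m T) (e : chart X) (p : T)
  (rho : model R m -> R) : Prop :=
  [/\ smooth_at rho (coord e p),
      \forall q \near p, (inside X q -> rho (coord e q) < 0) /\
                         (bdry X q -> rho (coord e q) = 0) &
      exists i, partial i rho (coord e p) <> 0].

(* The matrix (rho, rho_{kbar}; rho_j, rho_{j kbar}). *)
Definition fefferman_matrix (R : realType) (m : nat) (rho : model R m -> R)
  (z : model R m) : 'M[R[i]]_(1 + m) :=
  block_mx (cfun rho z)%:M (\row_k dzbar k (cfun rho) z)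
           (\col_j dz j (cfun rho) z)
           (\matrix_(j, k) dz j (dzbar k (cfun rho)) z).

(* Here g_{j kbar} = - d_j d_{kbar} log(- rho) are the components of the form
   omega = - d dbar log(- rho) = g_{j kbar} dz^j /\ dzbar^k. *)
Definition fefferman_metric (R : realType) (n : nat) (T : topologicalType)
  (X : complex_manifold R n.+1 T) (g : herm_field X) : Prop :=
  (exists U : set T, [/\ open U, bdry X `<=` U &
    hermitian_metric (U `&` inside X) g]) /\
  forall (e : chart X) (p : T), bdry X p -> dom e p ->
  exists rho : model R n.+1 -> R,
  [/\ local_defining_function e p rho,
      exists K : R, \forall q \near p,
        `|\det (fefferman_matrix rho (coord e q)) - (- 1)|
          <= (K * `|rho (coord e q)| ^+ n.+2)%:C%C &
      \forall q \near p, inside X q -> forall j k,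
        g e (coord e q) j k =
        - dz j (dzbar k (cfun (fun z => ln (- rho z)))) (coord e q)].

(* The difference vanishes to infinite order along the boundary. *)
Definition same_boundary_expansion (R : realType) (m : nat)
  (T : topologicalType) (X : complex_manifold R m T) (g h : herm_field X)
  : Prop :=
  forall (e : chart X) (p : T) (N : nat), bdry X p -> dom e p ->
  exists K : R, \forall q \near p, inside X q -> forall j k,
    `|g e (coord e q) j k - h e (coord e q) j k|
      <= (K * `|chartr e (coord e q)| ^+ N)%:C%C.

(* |u|^2 = g^{j kbar} u_j conj(u_k), where sum_k g^{j kbar} g_{l kbar} is the
   Kronecker delta, so that g^{j kbar} is the (k, j) entry of the inverse. *)
Definition covector_norm2 (R : realType) (m : nat) (g : 'M[R[i]]_m)
  (u : 'I_m -> R[i]) : R[i] :=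
  \sum_j \sum_k invmx g k j * u j * ((u k)^*)%C.

Definition special_defining_function (R : realType) (m : nat)
  (T : topologicalType) (X : complex_manifold R m T) (gplus : herm_field X)
  (theta : boundary_form X) (phi : T -> R) : Prop :=
  [/\ defining_function X phi,
      forall (e : chart X) (p : T) G, bdry X p -> dom e p ->
        smooth_rep (coord e) p phi G ->
        forall v, tangent e (coord e p) v ->
          (theta e (coord e p) v)%:C%C =
          'i%C / 2 *
            (\sum_k dzbar k (cfun G) (coord e p) * ((zcoord v k)^*)%C
             - \sum_j dz j (cfun G) (coord e p) * zcoord v j) &
      exists U : set T, [/\ open U, bdry X `<=` U &
        forall (e : chart X) (p : T), dom e p -> U p -> inside X p ->
          covector_norm2 (gplus e (coord e p))
            (fun j => dz j (cfun (fun z => ln (- phi (coordV e z))))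
                        (coord e p)) = 1]].

(* Lebesgue integral of a nonnegative Borel function on R^k, as an iterated
   integral (Tonelli). *)
Fixpoint lebesgue_integral_rV (R : realType) (k : nat)
  : ('rV[R]_k -> \bar R) -> \bar R :=
  match k return ('rV[R]_k -> \bar R) -> \bar R with
  | 0%N => fun f => f 0
  | k'.+1 => fun f =>
      (\int[@lebesgue_measure R]_x
        lebesgue_integral_rV (fun v : 'rV[R]_k' =>
          f (row_mx (x%:M : 'M[R]_1) v : 'rV[R]_(1 + k'))))%E
  end.

Notation borel T := (g_sigma_algebraType (@open T)).

(* With omega = g_{j kbar} dz^j /\ dzbar^k, in dimension m one has
   (i/2)^m / m! omega^m = det(g_{j kbar}) dx_1 dy_1 ... dx_m dy_m. *)
Definition volume_measure (R : realType) (m : nat) (T : ptopologicalType)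
  (X : complex_manifold R m T) (g : herm_field X)
  (mu : {measure set (borel T) -> \bar R}) : Prop :=
  forall (e : chart X) (A : set (borel T)), measurable A ->
    A `<=` dom e `&` inside X ->
    mu A = lebesgue_integral_rV (fun z =>
      (complex.Re (\det (g e z)) * \1_(coord e @` A) z)%:E).

(* The asymptotic expansion of mu {phi < epsilon} as epsilon -> 0^- holds, with
   L the coefficient of log(- epsilon). *)
Definition log_coefficient (R : realType) (n : nat) (T : ptopologicalType)
  (mu : {measure set (borel T) -> \bar R}) (phi : T -> R) (L : R) : Prop :=
  (\forall eps \near (0 : R)^'-,
     mu ([set x | phi x < eps] : set (borel T)) \is a fin_num) /\
  exists (c : 'I_n.+1 -> R) (V : R),
    (fun eps : R => fine (mu ([set x | phi x < eps] : set (borel T)))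
       - (\sum_(j < n.+1) c j * eps ^- (n.+1 - j) + L * ln (- eps) + V))
      @ (0 : R)^'- --> (0 : R).

(* Main.v *)
(* Only the difference of the two volumes matters, and only modulo O(1).
   Fefferman's equation gives det g = (- rho)^(-n-2) + O(1) near the boundary, so
   on lines transversal to the boundary at z, parametrised by u > 0, the volume
   density is b(z,u) / u^(n+2) + O(1) with b smooth. Integrating it over the part
   of the line where - phi > eps gives
     sum_(j <= n) d_j(z) eps^(-j-1) - b_(n+1)(z) log eps + O(1),
   where b_(n+1) is a Taylor coefficient of b in u: the logarithmic term does not
   depend on phi. Now deform phi1 into phi2 by finitely many steps, each of which
   replaces phi1 + chi (phi2 - phi1) by phi1 + chi' (phi2 - phi1) with chi = chi'
   outside of a box in one boundary chart. By Tonelli the change of volume is an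
   integral over such lines. The powers of eps are not integrated in z but killed
   by the operator v |-> sum_l q_l v(2^l eps), where sum_l q_l X^l is the product
   of the X - 2^(-j-1), j <= n. It sends L log eps to L q(1) log eps + const with
   q(1) > 0. As the image of Vol(phi1) - Vol(phi2) is bounded, L1 = L2. *)

Require Import Defs.
From HB Require Import structures.
From mathcomp Require Import all_boot all_order all_algebra.
From mathcomp Require Import perm complex.
From mathcomp Require Import all_classical all_reals all_analysis.
From mathcomp Require Import measurable_realfun.
From mathcomp Require Import zify ring lra.
(* Imported again, because [coord] is shadowed by the previous lines. *)
Require Import Defs.

Set Implicit Arguments.
Unset Strict Implicit.
Unset Printing Implicit Defensive.
Import Order.TTheory GRing.Theory Num.Theory Num.Def numFieldNormedType.Exports.
Import complex.ComplexField.
Local Open Scope classical_set_scope.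
Local Open Scope ring_scope.

(** * Expansions in powers of u *)

(** The measure is given by a density only inside a chart. Hence only sets lying in one chart can be
    integrated, and the lines are coordinate lines z - s u e_i with s = 1 or -1 instead of the
    fibres of a collar: they preserve Lebesgue measure, so Tonelli needs no change of variables. The
    interpolated functions have only finite regularity, so the argument runs in the class
    [admissible]: a finite expansion along every transversal line and - phi comparable to u. Both
    conditions concern germs at boundary points, pass to convex combinations, and become uniform
    over compact sets. The coefficients of these expansions are obtained line by line from existence
    statements. They come with bounds but without measurability in z, so they must disappear before
    the integration over z. The slice integrals themselves are measurable by Tonelli, and their
    dyadic combination is bounded on each line; only that bound is integrated. *)

Definition small (R : realType) (Z : Type) (F : set_system Z)
  : set_system (Z * R) := filter_prod F (0 : R)^'+.

Arguments small R {Z} F.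

#[global] Instance small_filter (R : realType) (Z : Type) (F : set_system Z)
  {FF : Filter F} : Filter (small R F).
Proof. exact: filter_prod_filter. Qed.

#[global] Instance nbhs_small_filter (R : realType) (Z : Type) (F : set_system Z)
  {FF : Filter F} : Filter (nbhs (small R F)) | 0.
Proof. exact: small_filter. Qed.

(* f (z, u) = c_0(z) + c_1(z) u + ... + c_(N-1)(z) u^(N-1) + O(u^N) as
   u -> 0+, with c_0, ..., c_(N-1) and the O bounded along the filter F in z. *)
Fixpoint expands (R : realType) (Z : Type) (F : set_system Z) (N : nat)
  (f : Z * R -> R) : Prop :=
  match N with
  | 0%N => exists C : R, \forall x \near small R F, `|f x| <= C
  | N'.+1 => exists (a : Z -> R) (g : Z * R -> R),
      [/\ exists C : R, \forall z \near F, `|a z| <= C,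
          expands F N' g &
          \forall x \near small R F, f x = a x.1 + x.2 * g x]
  end.

Section Expansions.
Context (R : realType) (Z : Type) (F : set_system Z) {FF : Filter F}.
Implicit Types (f g h : Z * R -> R) (a b : Z -> R).

Lemma small_fst (P : Z -> Prop) :
  (\forall z \near F, P z) -> \forall x \near small R F, P x.1.
Proof. by move=> FP; exact: (@cvg_fst _ _ F (0 : R)^'+ _ P FP). Qed.

Lemma small_snd (P : R -> Prop) :
  (\forall u \near (0 : R)^'+, P u) -> \forall x \near small R F, P x.2.
Proof. by move=> FP; exact: (@cvg_snd _ _ F (0 : R)^'+ _ P FP). Qed.

Lemma small_gt0 : \forall x \near small R F, 0 < x.2.
Proof. by apply: (@small_snd (fun u => 0 < u)); exact: nbhs_right_gt. Qed.

Lemma small_lt (d : R) : 0 < d -> \forall x \near small R F, x.2 < d.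
Proof. by move=> d0; apply: (@small_snd (fun u => u < d)); exact: nbhs_right_lt. Qed.

Lemma smallP (P : Z * R -> Prop) :
  (\forall x \near small R F, P x) <->
  exists2 d : R, 0 < d & \forall z \near F, forall u, 0 < u < d -> P (z, u).
Proof.
split.
  case=> -[A B] /= [FA [d /= d0 dB]] AB; exists d => //.
  near=> z => u /andP[u0 ud]; apply: (AB (z, u)); split => /=.
    by near: z.
  apply: dB => //=; by rewrite sub0r normrN gtr0_norm.
case=> d d0 H.
near=> x; rewrite [x]surjective_pairing.
have : forall u, 0 < u < d -> P (x.1, u) by near: x; exact: (small_fst H).
apply; apply/andP; split; near: x; [exact: small_gt0|exact: small_lt].
Unshelve. all: by end_near. Qed.

Lemma eq_expands N f g : (\forall x \near small R F, f x = g x) ->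
  expands F N f -> expands F N g.
Proof.
case: N => [|N] fg /=.
  by case=> C fC; exists C; near=> x; rewrite -(near fg x)//; near: x.
case=> a [h [ha hh fE]]; exists a, h; split => //.
by near=> x; rewrite -(near fg x)//; near: x.
Unshelve. all: by end_near. Qed.

Lemma expandsS N f : expands F N.+1 f -> expands F N f.
Proof.
elim: N f => [|N IH] f.
  case=> a [g [[C aC] [D gD] fE]]; exists (C + D).
  near=> x; rewrite (near fE x)//.
  have ? : `|a x.1| <= C by near: x; exact: (small_fst aC).
  have ? : `|g x| <= D by near: x.
  have x0 : 0 < x.2 by near: x; exact: small_gt0.
  have x1 : x.2 < 1 by near: x; exact: small_lt.
  rewrite (le_trans (ler_normD _ _))// lerD// normrM gtr0_norm//.
  by rewrite (le_trans _ (_ : `|g x| <= _))// ler_piMl// ltW.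
by case=> a [g [aC gN fE]]; exists a, g; split => //; exact: IH.
Unshelve. all: by end_near. Qed.

Lemma expands_le N M f : (M <= N)%N -> expands F N f -> expands F M f.
Proof.
move=> /subnK <-; elim: (N - M)%N => // k IH; rewrite addSn => /expandsS; exact: IH.
Qed.

Lemma expandsD N f g :
  expands F N f -> expands F N g -> expands F N (fun x => f x + g x).
Proof.
elim: N f g => [|N IH] f g.
  case=> C fC [D gD]; exists (C + D); near=> x.
  rewrite (le_trans (ler_normD _ _))// lerD//; by near: x.
case=> a [h [[C aC] hN fE]] [b [k [[D bD] kN gE]]].
exists (fun z => a z + b z), (fun x => h x + k x); split.
- exists (C + D); near=> x.
  rewrite (le_trans (ler_normD _ _))// lerD//; by near: x.
- exact: IH.
- by near=> x; rewrite (near fE x)// (near gE x)// mulrDr; ring.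
Unshelve. all: by end_near. Qed.

Lemma expands_cst N a : (exists C : R, \forall z \near F, `|a z| <= C) ->
  expands F N (fun x => a x.1).
Proof.
move=> aC; elim: N a aC => [|N IH] a [C aC] /=.
  by exists C; exact: (small_fst aC).
exists a, (fun=> 0); split; first by exists C.
  by apply: (IH (fun=> 0)); exists 0; near=> z; rewrite normr0.
by near=> x; rewrite mulr0 addr0.
Unshelve. all: by end_near. Qed.

Lemma expands_real N (c : R) : expands F N (fun=> c).
Proof.
by apply: (@expands_cst N (fun=> c)); exists `|c|; near=> z.
Unshelve. all: by end_near. Qed.

Lemma expandsX N f : expands F N f -> expands F N.+1 (fun x => x.2 * f x).
Proof.
move=> fN; exists (fun=> 0), f; split => //.
  by exists 0; near=> z; rewrite normr0.
by near=> x; rewrite add0r.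
Unshelve. all: by end_near. Qed.

Lemma expandsM N f g :
  expands F N f -> expands F N g -> expands F N (fun x => f x * g x).
Proof.
elim: N f g => [|N IH] f g.
  case=> C fC [D gD]; exists (C * D); near=> x.
  by rewrite normrM ler_pM//; near: x.
move=> fN gN; move: (fN) (gN).
case=> a [h [[C aC] hN fE]] [b [k [[D bD] kN gE]]].
(* f g = a b + u (a k + h g). Keeping g whole in the last product leaves only products of order N
   for the induction. *)
exists (fun z => a z * b z), (fun x => a x.1 * k x + h x * g x); split.
- exists (C * D); near=> x.
  by rewrite normrM ler_pM//; near: x.
- apply: expandsD; last by apply: IH => //; exact: expandsS.
  by apply: IH => //; apply: expands_cst; exists C.
- near=> x; rewrite (near fE x)// [in LHS](near gE x)//.
  by rewrite (near gE x)//; ring.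
Unshelve. all: by end_near. Qed.

Lemma expandsXn N f k : expands F N f -> expands F N (fun x => f x ^+ k).
Proof.
move=> fN; elim: k => [|k IH]; first exact: expands_real.
apply: (@eq_expands N (fun x => f x * f x ^+ k)).
  by near=> x; rewrite exprS.
exact: expandsM.
Unshelve. all: by end_near. Qed.

Lemma expandsN N f : expands F N f -> expands F N (fun x => - f x).
Proof.
move=> fN; apply: (@eq_expands N (fun x => -1 * f x)).
  by near=> x; rewrite mulN1r.
by apply: expandsM => //; exact: expands_real.
Unshelve. all: by end_near. Qed.

Lemma expandsB N f g :
  expands F N f -> expands F N g -> expands F N (fun x => f x - g x).
Proof. by move=> fN /expandsN; exact: expandsD. Qed.

Lemma expands_small N f (C : R) :
  (\forall x \near small R F, `|f x| <= C * x.2 ^+ N) -> expands F N f.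
Proof.
elim: N f => [|N IH] f fC /=.
  by exists C; near=> x; rewrite (le_trans (near fC x _))// expr0 mulr1.
exists (fun=> 0), (fun x => f x / x.2); split.
- by exists 0; near=> z; rewrite normr0.
- apply: IH; near=> x.
  have x0 : 0 < x.2 by near: x; exact: small_gt0.
  rewrite normrM normfV [X in _ / X]gtr0_norm// ler_pdivrMr//.
  by rewrite -mulrA -exprSr; near: x.
- near=> x; have x0 : 0 < x.2 by near: x; exact: small_gt0.
  by rewrite add0r mulrC divfK// gt_eqF.
Unshelve. all: by end_near. Qed.

(** For f = a + u g one has 1/f = 1/a - u g / (a f), where 1/f on the right is needed to one order
    less. *)
Lemma expandsV N f (c : R) : 0 < c -> expands F N f ->
  (\forall x \near small R F, c <= f x) -> expands F N (fun x => (f x)^-1).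
Proof.
move=> c0; elim: N f => [|N IH] f fN cf.
  exists c^-1; near=> x.
  have cfx : c <= f x by near: x.
  by rewrite normfV lef_pV2 ?posrE ?normr_gt0 ?gt_eqF ?(lt_le_trans c0)// gtr0_norm// (lt_le_trans c0).
have [a [g [[C aC] gN fE]]] := fN.
(* [a z] is the limit of f (z, u) as u -> 0, so it inherits the lower bound; u is chosen below d
   with u (|D| + 1) <= e. *)
have ca : \forall z \near F, c <= a z.
  have [D gD] : exists D : R, \forall x \near small R F, `|g x| <= D.
    exact: (@expands_le N 0 g).
  have /smallP[d d0 H] : \forall x \near small R F,
      [/\ c <= f x, f x = a x.1 + x.2 * g x & `|g x| <= D].
    by near=> x; split; near: x.
  near=> z.
  have Hz : forall u, 0 < u < d ->
    [/\ c <= f (z, u), f (z, u) = a z + u * g (z, u) & `|g (z, u)| <= D].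
    by near: z.
  apply/ler_addgt0Pr => e e0.
  pose u := minr (d / 2) (e / (`|D| + 1)).
  have D1 : 0 < `|D| + 1 by rewrite ltr_wpDl.
  have u0 : 0 < u by rewrite lt_min !divr_gt0.
  have ud : u < d by rewrite gt_min ltr_pdivrMr// mulr2n mulrDr mulr1 ltrDl d0.
  have [|H1 H2 H3] := Hz u; first by rewrite u0.
  rewrite (le_trans H1)// H2 lerD2l (le_trans (ler_norm _))// normrM gtr0_norm//.
  apply: (@le_trans _ _ (u * (`|D| + 1))).
    by rewrite ler_pM2l// (le_trans H3)// (le_trans (ler_norm _))// lerDl.
  by rewrite -ler_pdivlMr// ge_min lexx orbT.
exists (fun z => (a z)^-1), (fun x => - (g x * (a x.1)^-1 * (f x)^-1)).
have aV : expands F N (fun x => (a x.1)^-1).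
  apply: (@expands_cst N (fun z => (a z)^-1)); exists c^-1; near=> z.
  have cfx : c <= a z by near: z.
  by rewrite normfV lef_pV2 ?posrE ?normr_gt0 ?gt_eqF ?(lt_le_trans c0)// gtr0_norm// (lt_le_trans c0).
split.
- exists c^-1; near=> z.
  have cfx : c <= a z by near: z.
  by rewrite normfV lef_pV2 ?posrE ?normr_gt0 ?gt_eqF ?(lt_le_trans c0)// gtr0_norm// (lt_le_trans c0).
- apply: expandsN; apply: expandsM; first exact: expandsM.
  by apply: IH => //; exact: expandsS.
- near=> x.
  have fx : c <= f x by near: x.
  have ax : c <= a x.1 by near: x; exact: (small_fst ca).
  have f0 : f x != 0 by rewrite gt_eqF// (lt_le_trans c0).
  have a0 : a x.1 != 0 by rewrite gt_eqF// (lt_le_trans c0).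
  have fEx : f x = a x.1 + x.2 * g x by near: x.
  apply: (mulfI f0); rewrite divff// mulrDr.
  have -> : f x * (x.2 * - (g x / a x.1 / f x)) = - (x.2 * g x / a x.1).
    by field; rewrite ?a0 ?f0.
  by rewrite fEx; field; rewrite ?a0.
Unshelve. all: by end_near. Qed.

End Expansions.

(** An expansion for a single function of u. One constant C bounds the coefficients and the
    remainder and, through u C < 1, the range of u; the condition is therefore monotone in C, as
    compactness arguments require. *)
Definition taylor_bound (R : realType) (N : nat) (C : R) (f : R -> R) :=
  exists c : nat -> R, (forall k, `|c k| <= C) /\
    forall u, 0 < u -> u * C < 1 ->
      `|f u - \sum_(k < N) c k * u ^+ k| <= C * u ^+ N.

Section TaylorBound.
Context (R : realType).

Lemma taylor_bound_mono N (C D : R) (f : R -> R) : C <= D ->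
  taylor_bound N C f -> taylor_bound N D f.
Proof.
move=> CD [c [cC fC]]; exists c; split; first by move=> k; rewrite (le_trans (cC k)).
move=> u u0 uD; rewrite (le_trans (fC u u0 _))//.
  by rewrite (le_lt_trans _ uD)// ler_wpM2l// ltW.
by rewrite ler_wpM2r// exprn_ge0// ltW.
Qed.

Lemma expands_snd (Z : Type) (F : set_system Z) {FF : Filter F} N :
  expands F N (fun x : Z * R => x.2).
Proof.
apply: (@eq_expands _ _ _ _ _ (fun x : Z * R => x.2 * 1)).
  by near=> x; rewrite mulr1.
by apply: expandsS; apply: expandsX; exact: expands_real.
Unshelve. all: by end_near. Qed.

Lemma lt_of_mul_lt1 (d C u : R) : 0 < d -> d^-1 <= C -> 0 < u -> u * C < 1 -> u < d.
Proof.
move=> d0 dC u0 uC; rewrite -[ltRHS]mul1r -ltr_pdivrMr// (le_lt_trans _ uC)//.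
by rewrite ler_pM2l.
Qed.

(** Trades coefficient functions of z for coefficients found separately at each z. Forwards, the
    width d of the range of u enters the constant as 1/d; backwards, [xget] chooses the
    coefficients, its default serving only where no bound is claimed. *)
Lemma expandsP (Z : Type) (F : set_system Z) {FF : Filter F} N (f : Z * R -> R) :
  expands F N f <->
  exists C : R, \forall z \near F, taylor_bound N C (fun u => f (z, u)).
Proof.
split.
  elim: N f => [|N IH] f.
    case=> C /smallP[d d0 fC]; exists (maxr `|C| d^-1).
    near=> z; have fz : forall u, 0 < u < d -> `|f (z, u)| <= C by near: z.
    exists (fun=> 0); split; first by move=> k; rewrite normr0 le_max normr_ge0.
    move=> u u0 uC; rewrite big_ord0 subr0 expr0 mulr1 (le_trans (fz u _))//.
      by rewrite u0 (lt_of_mul_lt1 d0 _ u0 uC)// le_max lexx orbT.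
    by rewrite le_max ler_norm.
  case=> a [g [[A aA] /IH[C gC] /smallP[d d0 fE]]].
  exists (maxr (maxr A C) d^-1); near=> z.
  have [c [cC gz]] : taylor_bound N C (fun u => g (z, u)) by near: z.
  have az : `|a z| <= A by near: z.
  have fz : forall u, 0 < u < d -> f (z, u) = a z + u * g (z, u) by near: z.
  exists (fun k => if k is k'.+1 then c k' else a z); split.
    by case=> [|k]; rewrite !le_max ?az// (cC k) orbT.
  move=> u u0 uC.
  have ud : u < d by rewrite (lt_of_mul_lt1 d0 _ u0 uC)// le_max lexx orbT.
  rewrite fz ?u0// big_ord_recl/= expr0 mulr1 addrAC opprD addrA subrr add0r.
  have -> : \sum_(i < N) c i * u ^+ bump 0 i = u * \sum_(i < N) c i * u ^+ i.
    by rewrite mulr_sumr; apply: eq_bigr => i _; rewrite exprS mulrCA.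
  rewrite addrC -mulrBr normrM gtr0_norm// exprS mulrCA ler_pM2l//.
  rewrite (le_trans (gz u u0 _))//.
    by rewrite (le_lt_trans _ uC)// ler_pM2l// !le_max lexx orbT.
  by rewrite ler_wpM2r ?exprn_ge0 ?(ltW u0)// !le_max lexx orbT.
case=> C fC.
pose Q z (c : nat -> R) := (forall k, `|c k| <= C) /\ forall u, 0 < u -> u * C < 1 ->
      `|f (z, u) - \sum_(k < N) c k * u ^+ k| <= C * u ^+ N.
pose c z := xget (fun=> 0) [set c : nat -> R | Q z c].
have cQ : \forall z \near F, Q z (c z).
  near=> z; rewrite /c; apply: (@xgetPex _ _ [set c : nat -> R | Q z c]).
  have fz : taylor_bound N C (fun u => f (z, u)) by near: z.
  by have [c0 [h1 h2]] := fz; exists c0; split.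
have sumN m : expands F N (fun x => \sum_(k < m) c x.1 k * x.2 ^+ k).
  elim: m => [|m IH].
    apply: (@eq_expands _ _ _ _ _ (fun=> 0)); last exact: expands_real.
    by near=> x; rewrite big_ord0.
  apply: (@eq_expands _ _ _ _ _
     (fun x => \sum_(k < m) c x.1 k * x.2 ^+ k + c x.1 m * x.2 ^+ m)).
    by near=> x; rewrite big_ord_recr.
  apply: expandsD => //; apply: expandsM; last by apply: expandsXn; exact: expands_snd.
  apply: (@expands_cst _ _ _ _ _ (fun z => c z m)); exists C.
  near=> z; have [cz _] : Q z (c z) by near: z.
  exact: cz.
apply: (@eq_expands _ _ _ _ _ (fun x => \sum_(k < N) c x.1 k * x.2 ^+ k
   + (f x - \sum_(k < N) c x.1 k * x.2 ^+ k))).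
  by near=> x; rewrite addrC subrK.
apply: expandsD => //; apply: (@expands_small _ _ _ _ _ _ C).
near=> x.
have [_] : Q x.1 (c x.1).
  near: x; exact: (@small_fst R Z F (fun z => Q z (c z)) cQ).
rewrite [x in f x]surjective_pairing.
apply; first by near: x; exact: small_gt0.
have C1 : 0 < `|C| + 1 by rewrite ltr_wpDl.
apply: (@le_lt_trans _ _ (x.2 * (`|C| + 1))).
  rewrite ler_wpM2l//; first by apply: ltW; near: x; exact: small_gt0.
  by rewrite (le_trans (ler_norm _))// lerDl.
by rewrite -ltr_pdivlMr//; near: x; apply: small_lt; rewrite divr_gt0.
Unshelve. all: by end_near. Qed.

(** With f = a + u g, freezing the sign of f at that of a costs only O(u^(N+1)): where f and a
    disagree in sign, |f| <= u |g|. A cutoff built from max (x, 0)^(N+1) thus keeps expansions of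
    order N + 1 although it is not smooth. *)
Lemma expands_pospow (Z : Type) (F : set_system Z) {FF : Filter F} N (f : Z * R -> R) :
  expands F N.+1 f -> expands F N.+1 (fun x => maxr (f x) 0 ^+ N.+1).
Proof.
move=> fN; have [a [g [_ gN fE]]] := fN.
have [D gD] : exists D : R, \forall x \near small R F, `|g x| <= D.
  exact: (@expands_le _ _ _ _ N 0 g).
pose b z : R := (0 <= a z)%R%:R.
apply: (@eq_expands _ _ _ _ _ (fun x => b x.1 * f x ^+ N.+1
   + (maxr (f x) 0 ^+ N.+1 - b x.1 * f x ^+ N.+1))).
  by near=> x; rewrite addrC subrK.
apply: expandsD.
  apply: expandsM; last exact: expandsXn.
  apply: (@expands_cst _ _ _ _ _ b); exists 1; near=> z.
  by rewrite /b; case: (0 <= a z); rewrite ?normr1 ?normr0.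
apply: (@expands_small _ _ _ _ _ _ (D ^+ N.+1)).
near=> x.
have fx : f x = a x.1 + x.2 * g x by near: x.
have gx : `|g x| <= D by near: x.
have x0 : 0 < x.2 by near: x; exact: small_gt0.
have D0 : 0 <= D by rewrite (le_trans _ gx).
have xg : `|x.2 * g x| <= D * x.2 by rewrite normrM gtr0_norm// mulrC ler_pM2r.
move: xg; rewrite ler_norml => /andP[xg1 xg2].
rewrite -exprMn /b.
have [a0|a0] := leP 0 (a x.1).
  have [f0|f0] := leP 0 (f x).
    by rewrite mul1r subrr normr0 exprn_ge0// mulr_ge0// ltW.
  rewrite expr0n/= mul1r sub0r normrN normrX lerXn2r ?nnegrE//.
    by rewrite mulr_ge0// ltW.
  by rewrite ltr0_norm// fx; lra.
have [f0|f0] := leP (f x) 0.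
  by rewrite expr0n/= mul0r subrr normr0 exprn_ge0// mulr_ge0// ltW.
rewrite mul0r subr0 normrX lerXn2r ?nnegrE//.
  by rewrite mulr_ge0// ltW.
by rewrite gtr0_norm// fx; lra.
Unshelve. all: by end_near. Qed.

(** The covering form of compactness, applied to the filter C -> +oo: by monotonicity a constant
    valid near z stays valid for all larger ones. *)
Lemma compact_near (Z : topologicalType) (K : set Z) (Q : R -> Z -> Prop) :
  (forall C D z, C <= D -> Q C z -> Q D z) -> compact K ->
  (forall z, K z -> exists C, \forall y \near within K (nbhs z), Q C y) ->
  exists C, forall z, K z -> Q C z.
Proof.
move=> Qmono /compact_near_coveringP/near_covering_withinP Kc KQ.
have /= := Kc _ (+oo : set_system R) (fun C z => Q C z) _ _.
case=> [z Kz|M [_ KM]].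
  have [C] := KQ z Kz; rewrite near_withinE => QC.
  exists ([set y | K y -> Q C y], [set D | C <= D]); first split => //.
    by apply: nbhs_pinfty_ge; rewrite num_real.
  by move=> [y D] [/= QCy CD] /QCy; exact: Qmono.
exists (M + 1) => z Kz; apply: KM => //.
by rewrite ltrDl.
Qed.

Lemma expands_compact (Z : topologicalType) (K : set Z) N (f : Z * R -> R) :
  compact K -> (forall z, K z -> expands (within K (nbhs z)) N f) ->
  expands (globally K) N f.
Proof.
move=> cK fK; apply/expandsP.
apply: (@compact_near _ K (fun C z => taylor_bound N C (fun u => f (z, u)))) => //.
  by move=> C D z; exact: taylor_bound_mono.
by move=> z Kz; apply/expandsP; exact: fK.
Qed.

Lemma small_compact (Z : topologicalType) (K : set Z) (P : R -> Z * R -> Prop) :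
  (forall C D x, C <= D -> P C x -> P D x) -> compact K ->
  (forall z, K z -> exists C, \forall x \near small R (within K (nbhs z)), P C x) ->
  exists C, \forall x \near small R (globally K), P C x.
Proof.
move=> Pmono cK PK.
(* The width of the range of u is encoded as 1/C, which leaves a single monotone parameter. *)
have [|z Kz|C CK] := @compact_near Z K (fun C z => 0 < C /\ forall u, 0 < u < C^-1 -> P C (z, u)) _ cK.
- move=> C D z CD [C0 H]; split; first exact: lt_le_trans CD.
  move=> u /andP[u0 uD]; apply: (Pmono _ _ _ CD); apply: H.
  rewrite u0 (lt_le_trans uD)// lef_pV2// posrE//.
  exact: lt_le_trans CD.
- have [C /smallP[d d0 H]] := PK z Kz.
  exists (maxr C d^-1); near=> y; split; first by rewrite lt_max invr_gt0 d0 orbT.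
  move=> u /andP[u0 ud]; apply: (Pmono C); first by rewrite le_max lexx.
  have : forall u, 0 < u < d -> P C (y, u) by near: y.
  apply; rewrite u0 (lt_le_trans ud)// invf_ple ?posrE// ?lt_max ?invr_gt0 ?d0 ?orbT//.
  by rewrite le_max lexx orbT.
- have [K0|K0] := pselect (K !=set0); last first.
    exists 0; exists (K, setT) => /=; first by split => //; exact: filterT.
    by move=> [z u] [/= Kz]; exfalso; apply: K0; exists z.
  have [z0 /CK[C0 _]] := K0.
  exists C; apply/smallP; exists C^-1; first by rewrite invr_gt0.
  by move=> z /CK[_ H].
Unshelve. all: by end_near. Qed.

End TaylorBound.

(** * Change of variable from u to f = u a in Laurent expansions *)

Section Laurent.
Context (R : realType) (Z : Type) (F : set_system Z) {FF : Filter F}.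

(* Induction on k: if g = g0 + u h, then, as u = f / a,
   g / f^(k+1) = g0 / f^(k+1) + (h / a) / f^k. *)
Lemma expands_laurent (a : Z * R -> R) (c : R) (m : nat) :
  0 < c -> (\forall x \near small R F, c <= a x) -> expands F m a ->
  forall (k : nat) (g : Z * R -> R), (k <= m)%N -> expands F k g ->
  exists (e : nat -> Z -> R) (C : R), \forall x \near small R F,
    `|g x / (x.2 * a x) ^+ k
      - \sum_(j < k) e j x.1 / (x.2 * a x) ^+ j.+1| <= C.
Proof.
move=> c0 ca am; elim=> [|k IH] g km gk.
  case: gk => C gC; exists (fun _ _ => 0), C; near=> x.
  by rewrite big_ord0 subr0 expr0 divr1; near: x.
case: gk => g0 [h [_ hk gE]].
have [|e [C eC]] := IH (fun x => h x * (a x)^-1) (ltnW km).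
  apply: expandsM => //; apply: (@expandsV _ _ _ _ _ _ c) => //.
  by apply: (@expands_le _ _ _ _ m) => //; exact: ltnW.
exists (fun j z => if j == k then g0 z else e j z), C; near=> x.
have cax : c <= a x by near: x.
have a0 : a x != 0 by rewrite gt_eqF// (lt_le_trans c0).
have x0 : 0 < x.2 by near: x; exact: small_gt0.
rewrite big_ord_recr/= eqxx opprD.
have -> : \sum_(i < k) (if i == k :> nat then g0 x.1 else e i x.1) / (x.2 * a x) ^+ i.+1
  = \sum_(i < k) e i x.1 / (x.2 * a x) ^+ i.+1.
  by apply: eq_bigr => i _; rewrite ltn_eqF.
have -> : g x / (x.2 * a x) ^+ k.+1 =
  h x * (a x)^-1 / (x.2 * a x) ^+ k + g0 x.1 / (x.2 * a x) ^+ k.+1.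
  have -> : g x = g0 x.1 + x.2 * h x by near: x.
  have x20 : x.2 != 0 by rewrite gt_eqF.
  have : (x.2 * a x) ^+ k != 0 by rewrite expf_neq0// mulf_neq0.
  rewrite exprS; move: (_ ^+ k) => P P0.
  by field; rewrite x20 a0 P0.
rewrite addrA addrAC addrK.
by near: x.
Unshelve. all: by end_near. Qed.

(* The antiderivative of sum_(k <= m) c_k u^(k-m-1). *)
Definition laurent_prim (m : nat) (c : nat -> R) (u : R) : R :=
  \sum_(k < m) - (c k / (m - k)%:R) * u^-1 ^+ (m - k) + c m * ln u.

Lemma laurent_primE (m : nat) (c : nat -> R) (u : R) : 0 < u ->
  laurent_prim m c u =
  - (\sum_(k < m) c k / (m - k)%:R * u ^+ k) / u ^+ m + c m * ln u.
Proof.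
move=> u0; congr (_ + _); rewrite -sumrN mulr_suml; apply: eq_bigr => k _.
have um j : u ^+ j != 0 by rewrite expf_neq0// gt_eqF.
have -> : u^-1 ^+ (m - k) = u ^+ k / u ^+ m.
  have -> : u ^+ m = u ^+ (m - k) * u ^+ k by rewrite -exprD subnK// ltnW.
  by rewrite exprVn invfM mulrCA divff// mulr1.
by rewrite !mulNr mulrA.
Qed.

(** Rewrites the antiderivative of the density in the variable f = u a. The coefficient of the
    logarithm does not change, because ln u - ln f = - ln a is bounded when c <= a <= D; the
    remaining terms are poles in f by [expands_laurent]. *)
Lemma laurent_prim_expands (a : Z * R -> R) (c : R) (m : nat)
    (b : Z -> nat -> R) (B : R) :
  0 < c -> (\forall x \near small R F, c <= a x) -> expands F m a ->
  (\forall z \near F, forall k, `|b z k| <= B) ->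
  exists (e : nat -> Z -> R) (C : R), \forall x \near small R F,
    `|laurent_prim m (b x.1) x.2
      - (\sum_(j < m) e j x.1 / (x.2 * a x) ^+ j.+1 + b x.1 m * ln (x.2 * a x))| <= C.
Proof.
move=> c0 ca am bB.
pose p (x : Z * R) := - \sum_(k < m) b x.1 k / (m - k)%:R * x.2 ^+ k.
have bexp k N : expands F N (fun x => b x.1 k).
  apply: (@expands_cst _ _ _ _ _ (fun z => b z k)); exists B; near=> z.
  have H : forall k, `|b z k| <= B by near: z.
  exact: H.
have pexp : expands F m p.
  apply: expandsN.
  suff: forall r, expands F m (fun x => \sum_(k < r) b x.1 k / (m - k)%:R * x.2 ^+ k).
    exact.
  elim=> [|r IHr].
    apply: (@eq_expands _ _ _ _ _ (fun=> 0)); last exact: expands_real.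
    by near=> x; rewrite big_ord0.
  apply: (@eq_expands _ _ _ _ _ (fun x => \sum_(k < r) b x.1 k / (m - k)%:R * x.2 ^+ k
      + b x.1 r * (m - r)%:R^-1 * x.2 ^+ r)).
    by near=> x; rewrite big_ord_recr.
  apply: expandsD => //; apply: expandsM; last by apply: expandsXn; exact: expands_snd.
  apply: expandsM => //; exact: expands_real.
have [|e [C eC]] := expands_laurent c0 ca am (leqnn m) (g := fun x => p x * a x ^+ m).
  by apply: expandsM => //; exact: expandsXn.
have [D aD] : exists D : R, \forall x \near small R F, `|a x| <= D.
  exact: (@expands_le _ _ _ _ m 0 a).
exists e, (C + B * maxr `|ln c| `|ln D|).
near=> x.
have cax : c <= a x by near: x.
have a0 : 0 < a x by rewrite (lt_le_trans c0).
have x0 : 0 < x.2 by near: x; exact: small_gt0.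
have bx : forall k, `|b x.1 k| <= B by near: x; exact: (@small_fst R Z F (fun z => forall k, `|b z k| <= B) bB).
have aDx : a x <= D.
  by rewrite (le_trans (ler_norm _))//; near: x.
rewrite laurent_primE// lnM ?posrE// -/(p x).
have -> : p x / x.2 ^+ m = p x * a x ^+ m / (x.2 * a x) ^+ m.
  have x20 : x.2 ^+ m != 0 by rewrite expf_neq0// gt_eqF.
  have am0 : a x ^+ m != 0 by rewrite expf_neq0// gt_eqF.
  rewrite exprMn; move: (_ ^+ m) (_ ^+ m) x20 am0 => P Q P0 Q0.
  by field; rewrite P0 Q0.
set S := \sum_(j < m) _; set P := p x * _ / _.
have -> : P + b x.1 m * ln x.2 - (S + b x.1 m * (ln x.2 + ln (a x)))
  = (P - S) - b x.1 m * ln (a x) by ring.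
rewrite (le_trans (ler_normB _ _))// lerD//.
  by rewrite /P /S; near: x.
rewrite normrM ler_pM//.
have l1 : ln c <= ln (a x) by rewrite ler_ln ?posrE.
have l2 : ln (a x) <= ln D by rewrite ler_ln ?posrE// (lt_le_trans a0).
rewrite le_max; have [l0|l0] := leP 0 (ln (a x)).
  by rewrite (ger0_norm l0) (le_trans l2 (ler_norm _)) orbT.
by rewrite (ltr0_norm l0) (@le_trans _ _ (- ln c)) ?lerN2// -normrN ler_norm.
Unshelve. all: by end_near. Qed.

Lemma is_derive_laurent_prim (m : nat) (c : nat -> R) (u : R) : 0 < u ->
  is_derive u 1 (laurent_prim m c) (\sum_(k < m.+1) c k * u ^+ k / u ^+ m.+1).
Proof.
move=> u0; have u1 : u != 0 by rewrite gt_eqF.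
pose G (k : 'I_m) : R -> R := - (c k / (m - k)%:R) \*: (fun t : R => t^-1) ^+ (m - k).
have -> : laurent_prim m c = (\sum_(k < m) G k) + (c m \*: (@ln R)).
  apply/funext => t; rewrite /laurent_prim/= fct_sumE; congr (_ + _).
  by apply: eq_bigr => k _; rewrite /G/= exprfctE.
rewrite big_ord_recr/=.
have -> : c m * u ^+ m / u ^+ m.+1 = c m *: u^-1.
  rewrite /GRing.scale/= exprS; have : u ^+ m != 0 by rewrite expf_neq0.
  by move: (u ^+ m) => y y0; field; rewrite y0 u1.
apply: is_deriveD; last by apply: is_deriveZ; exact: is_derive1_ln.
apply: is_derive_sum => k.
have D1 : is_derive u 1 (fun t : R => t^-1) (- u ^- 2 *: (1 : R)).
  exact: (@is_deriveV _ id).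
apply: (@is_derive_eq _ _ _ _ _ _ _ _ (is_deriveZ _ (is_deriveX (m - k) D1))).
rewrite /GRing.scale/= mulr1.
have km := ltn_ord k.
have um j : u ^+ j != 0 by rewrite expf_neq0.
have j0 : (m - k)%:R != 0 :> R by rewrite pnatr_eq0 subn_eq0 -ltnNge.
rewrite exprVn.
have -> : u ^+ m.+1 = u ^+ k * u ^+ (m - k).-1 * u ^+ 2.
  by rewrite -!exprD; congr (_ ^+ _); lia.
move: (u ^+ k) (u ^+ (m - k).-1) (u ^+ 2) (um k) (um (m - k).-1) (um 2%N) => x y z x0 y0 z0.
by field; rewrite x0 y0 z0 j0.
Qed.

End Laurent.

(** * Superlevel integrals on a line *)

Section Superlevel.
Context (R : realType).
Notation mu := (@lebesgue_measure R).

(** f need not be monotone, so {f > eps} need not be an interval. It lies between the half-lines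
    that start at the first and at the last solution of f = eps. *)
Lemma superlevel_sandwich (dl C eps : R) (f : R -> R) : 0 < C ->
  0 < eps -> eps < dl / (2 * C) ->
  (forall u, 0 < u < dl -> {for u, continuous f}) ->
  (forall u, 0 < u < dl -> u / C <= f u <= C * u) ->
  exists v w : R, [/\ 0 < v < dl, 0 < w < dl, f v = eps, f w = eps &
    forall u, 0 < u < dl -> (eps < f u -> v <= u) /\ (w < u -> eps < f u)].
Proof.
move=> C0 e0 edl cf fC.
(* The comparison of f with u gives f < eps to the left of a and f > eps to the right of b, so all
   solutions lie in the compact interval [a, b]; eps < dl / (2 C) puts b below dl. *)
pose a := eps / (2 * C); pose b := 3 / 2 * C * eps.
have a0 : 0 < a by rewrite divr_gt0// mulr_gt0.
have b0 : 0 < b by rewrite !mulr_gt0// divr_gt0.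
have e2 : eps * (2 * C) < dl by rewrite -ltr_pdivlMr// mulr_gt0.
have bdl : b < dl by rewrite /b; nra.
have Ca : C * a = eps / 2 by rewrite /a; field; rewrite gt_eqF.
have bC : b / C = 3 / 2 * eps by rewrite /b; field; rewrite gt_eqF.
have pos x y : 0 < x -> x <= y * C -> y <= 0 -> False by move=> ? ? ?; nra.
have adl : a < dl.
  rewrite ltNge; apply/negP => dla.
  have h : 0 < dl / 2 < dl by apply/andP; split; nra.
  have /andP[h1 h2] := fC _ h.
  have : dl / 2 / C <= C * (dl / 2) by exact: le_trans h2.
  rewrite ler_pdivrMr// => h3.
  have : 1 <= C * C by nra.
  nra.
have fa : f a <= eps / 2 by rewrite -Ca; have /andP[] := fC a (introT andP (conj a0 adl)).
have fb : 3 / 2 * eps <= f b by rewrite -bC; have /andP[] := fC b (introT andP (conj b0 bdl)).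
have ab : a <= b.
  have /andP[h1 h2] := fC a (introT andP (conj a0 adl)).
  have : a / C <= C * a by exact: le_trans h2.
  rewrite ler_pdivrMr// => h3; rewrite /b.
  have : 1 <= C * C by nra.
  have : eps = 2 * (C * a) by rewrite Ca; field.
  nra.
have cfw x y : 0 < x -> y < dl -> {within `[x, y], continuous f}.
  move=> x0 ydl; apply: continuous_in_subspaceT => u.
  rewrite inE/= in_itv/= => /andP[xu uy]; apply: cf.
  by rewrite (lt_le_trans x0)// (le_lt_trans uy).
pose S := `[a, b] `&` [set u | f u = eps].
have S0 : S !=set0.
  have [||c cab fc] := @IVT _ f a b eps ab.
  - exact: cfw.
  - rewrite ge_min le_max (le_trans fa)/=; last by lra.
    by rewrite (_ : eps <= f b)%R ?orbT//; lra.
  - by exists c; split; [exact: cab|exact: fc].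
have cS : compact S.
  apply: (@subclosed_compact _ _ `[a, b]); [|exact: segment_compact|by move=> ? []].
  move=> x clx.
  have xab : `[a, b]%classic x.
    have : closed `[a, b]%classic by exact: itv_closed.
    apply => B /clx[y [[yab _] By]].
    by exists y.
  split => //=; apply/eqP; apply: contrapT => /negP fx.
  have x0 : 0 < x < dl.
    move: xab; rewrite /= in_itv/= => /andP[ax xb].
    by rewrite (lt_le_trans a0)// (le_lt_trans xb).
  have : \forall y \near x, f y != eps.
    have := cf x x0.
    move: fx; rewrite neq_lt => /orP[fx|fx] cx.
      by near=> y; rewrite lt_eqF//; near: y; exact: (cvgr_lt (f x)).
    by near=> y; rewrite gt_eqF//; near: y; exact: (cvgr_gt (f x)).
  by move=> /clx[y [[_ /= ->] /=]]; rewrite eqxx.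
have cid' : {within S, continuous (@id R)}.
  by apply: continuous_subspaceT => x; exact: cvg_id.
have [v vS vmin] := compact_EVT_min S0 cS cid'.
have [w wS wmax] := compact_EVT_max S0 cS cid'.
move: vS wS; rewrite !inE => -[/= + fv] [/= + fw].
rewrite !in_itv/= => /andP[av vb] /andP[aw wb].
exists v, w; split => //.
- by rewrite (lt_le_trans a0)// (le_lt_trans vb).
- by rewrite (lt_le_trans a0)// (le_lt_trans wb).
move=> u /andP[u0 ud]; have /andP[fu1 fu2] := fC u (introT andP (conj u0 ud)).
split.
  move=> eu; rewrite leNgt; apply/negP => uv.
  have [ua|au] := ltP u a.
    have : C * u < C * a by rewrite ltr_pM2l.
    lra.
  have [||c] := @IVT _ f a u eps au.
  - exact: cfw.
  - rewrite ge_min le_max (le_trans fa)/=; last by lra.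
    by rewrite (ltW eu) orbT.
  - rewrite in_itv/= => /andP[ac cu] fc.
    have /vmin : c \in S by rewrite inE; split => //=; rewrite in_itv/= ac (le_trans cu)// (le_trans (ltW uv)).
    by rewrite leNgt (le_lt_trans cu uv).
move=> wu; rewrite ltNge; apply/negP => eu.
have [bu|ub] := ltP b u.
  have : b / C < u / C by rewrite ltr_pM2r// invr_gt0.
  lra.
have [||c] := @IVT _ f u b eps ub.
- exact: cfw.
- rewrite ge_min le_max eu/=.
  by rewrite (_ : eps <= f b)%R ?orbT//; lra.
- rewrite in_itv/= => /andP[uc cb] fc.
  have /wmax : c \in S by rewrite inE; split => //=; rewrite in_itv/= cb (le_trans _ uc)// (le_trans _ (ltW wu)).
  by rewrite leNgt (lt_le_trans wu uc).
Unshelve. all: by end_near. Qed.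

Lemma FTC_shift (dl K x y : R) (W B : R -> R) :
  (forall u, 0 < u < dl -> {for u, continuous W}) ->
  (forall u, 0 < u < dl -> is_derive u 1 B (W u)) ->
  0 < x -> x < y -> y < dl ->
  (\int[mu]_(u in `[x, y]) (W u + K)%:E = (B y - B x + K * (y - x))%:E)%E.
Proof.
move=> cW dB x0 xy ydl.
have in0 u : x <= u <= y -> 0 < u < dl.
  by move=> /andP[xu uy]; rewrite (lt_le_trans x0)// (le_lt_trans uy).
pose G : R -> R := B + (K \*: (@id R)).
have dG u : 0 < u < dl -> is_derive u 1 G (W u + K).
  move=> u0; have dBu := dB u u0.
  have := is_deriveD dBu (is_deriveZ K (is_derive_id u 1)).
  by rewrite /GRing.scale/= mulr1.
have cG u : 0 < u < dl -> {for u, continuous G}.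
  by move=> u0; apply: differentiable_continuous; apply/derivable1_diffP; case: (dG u u0).
rewrite (@continuous_FTC2 _ (fun u => W u + K) G)//.
- have GE t : G t = B t + K * t by [].
  by rewrite !GE -EFinB; congr EFin; ring.
- apply: continuous_in_subspaceT => u; rewrite inE/= in_itv/= => /in0 u0.
  by apply: cvgD; [exact: cW|exact: cvg_cst].
- split.
  + move=> u; rewrite in_itv/= => /andP[xu uy].
    by case: (dG u (in0 u _)) => //; rewrite !ltW.
  + apply: cvg_at_right_filter; apply: cG; apply: in0; by rewrite lexx ltW.
  + apply: cvg_at_left_filter; apply: cG; apply: in0; by rewrite lexx ltW.
- move=> u; rewrite in_itv/= => /andP[xu uy].
  have [] := dG u (in0 u _); first by rewrite !ltW.
  by move=> _ <-; rewrite derive1E.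
Qed.

(** The integral is squeezed between those over [v', h] and [v, h]. As f v = f v' = eps, the
    antiderivative at both left ends is E eps up to C. In the constant, one C comes from B h, one
    from B - E, and h C from w - W. *)
Lemma superlevel_integral (dl C h eps : R) (w W B E f : R -> R) :
  0 < C -> 0 < h -> h < dl -> 0 < eps -> eps < h / (2 * C) ->
  measurable_fun `]0, dl[ w ->
  (forall u, 0 < u < dl -> 0 <= w u) ->
  (forall u, 0 < u < dl -> `|w u - W u| <= C) ->
  (forall u, 0 < u < dl -> {for u, continuous W}) ->
  (forall u, 0 < u < dl -> is_derive u 1 B (W u)) ->
  (forall u, 0 < u < dl -> {for u, continuous f}) ->
  (forall u, 0 < u < dl -> u / C <= f u <= C * u) ->
  (forall u, 0 < u < dl -> `|B u - E (f u)| <= C) ->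
  `|B h| <= C ->
  exists I : R,
    (\int[mu]_(u in [set u | (0 < u < h)%R /\ (eps < f u)%R]) (w u)%:E = I%:E)%E /\
    `|I + E eps| <= (2 + h) * C.
Proof.
move=> C0 h0 hdl e0 eh mw w0 wW cW dB cf fC BE Bh.
have eh' : eps * (2 * C) < h by rewrite -ltr_pdivlMr// mulr_gt0.
have [|v [v' [v0 v'0 fv fv' vP]]] := @superlevel_sandwich dl C eps f C0 e0 _ cf fC.
  by rewrite ltr_pdivlMr ?mulr_gt0// (lt_trans eh').
have small x : 0 < x < dl -> f x = eps -> x < h.
  move=> x0 fx; have /andP[+ _] := fC x x0; rewrite fx ler_pdivrMr// => xe.
  by rewrite (le_lt_trans xe)// (lt_trans _ eh')// ltr_pM2l//; lra.
have vh := small v v0 fv; have v'h := small v' v'0 fv'.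
move: v0 v'0 => /andP[v0 _] /andP[v'0 _].
set A := [set u | _].
have sub0 u : 0 < u -> u <= h -> 0 < u < dl by move=> -> uh; rewrite (le_lt_trans uh).
have mA : measurable A.
  have -> : A = `]0, h[%classic `&` ([set u | u \in `]0, dl[] `&` f @^-1` `]eps, +oo[).
    apply/seteqP; split => u /=; rewrite !in_itv/= andbT.
      by move=> [/andP[u0 uh] eu]; rewrite u0 uh/= (lt_trans uh).
    by move=> [u0h [_ eu]]; split.
  apply: measurableI => //.
  have mf : measurable_fun (`]0, dl[%classic : set R) f.
    apply: open_continuous_measurable_fun; first exact: itv_open.
    by move=> u; rewrite inE/= in_itv/=; exact: cf.
  by apply: mf.
have mwE (D : set R) : D `<=` `]0, dl[%classic -> measurable_fun D (EFin \o w).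
  move=> D0; apply/measurable_EFinP; exact: measurable_funS mw.
have Asub : A `<=` `[v, h]%classic.
  move=> u [/andP[u0 uh] eu]; rewrite /= in_itv/= (ltW uh) andbT.
  by have [+ _] := vP u (sub0 _ u0 (ltW uh)); apply.
have subA : `]v', h[%classic `<=` A.
  move=> u; rewrite /= in_itv/= => /andP[vu uh].
  have u0 := lt_trans v'0 vu.
  by split; [rewrite u0 uh|have [_] := vP u (sub0 _ u0 (ltW uh)); apply].
have itv0 x : 0 < x -> `[x, h]%classic `<=` `]0, dl[%classic.
  move=> x0 u; rewrite /= !in_itv/= => /andP[xu uh].
  by rewrite (lt_le_trans x0)//= (le_lt_trans uh).
have mW K : measurable_fun (`]0, dl[%classic : set R) (fun u => W u + K).
  apply: open_continuous_measurable_fun; first exact: itv_open.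
  move=> u; rewrite inE/= in_itv/= => u0; apply: cvgD; [exact: cW|exact: cvg_cst].
have mWE K (D : set R) : measurable D -> D `<=` `]0, dl[%classic -> measurable_fun D (EFin \o (fun u => W u + K)).
  move=> mD D0; apply/measurable_EFinP; exact: measurable_funS (mW K).
have wWle u : 0 < u < dl -> W u - C <= w u <= W u + C.
  by move=> /wW; rewrite ler_distl.
set I := (\int[mu]_(u in A) (w u)%:E)%E.
have Iup : (I <= (B h - B v + C * (h - v))%:E)%E.
  rewrite -(FTC_shift C cW dB v0 vh hdl).
  apply: (@le_trans _ _ (\int[mu]_(u in `[v, h]) (w u)%:E)%E).
    apply: ge0_subset_integral => //; first exact: (mwE _ (itv0 _ v0)).
    by move=> u /(itv0 _ v0); rewrite /= in_itv/= => u0; rewrite lee_fin w0.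
  apply: ge0_le_integral => //.
  - by move=> u /(itv0 _ v0); rewrite /= in_itv/= => u0; rewrite lee_fin w0.
  - exact: (mwE _ (itv0 _ v0)).
  - by apply: mWE => //; exact: itv0.
  - move=> u /(itv0 _ v0); rewrite /= in_itv/= => u0.
    by rewrite lee_fin; have /andP[] := wWle u u0.
(* The lower bound is proved as W + C <= w + 2 C. Both sides are nonnegative because W + C >= w >=
   0, whereas W - C may be negative. *)
have Ilo : ((B h - B v' - C * (h - v'))%:E <= I)%E.
  have cst : (\int[mu]_(u in `[v', h]) (2 * C)%:E = (2 * C * (h - v'))%:E)%E.
    rewrite integral_cst//= lebesgue_measure_itv/= lte_fin v'h.
    by rewrite -EFinB -EFinM.
  rewrite -(@leeD2rE _ ((2 * C * (h - v'))%:E)%E)// -EFinD.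
  have -> : B h - B v' - C * (h - v') + 2 * C * (h - v') = B h - B v' + C * (h - v').
    by ring.
  rewrite -(FTC_shift C cW dB v'0 v'h hdl) -cst.
  apply: (@le_trans _ _ (\int[mu]_(u in `[v', h]) ((w u)%:E + (2 * C)%:E))%E).
    apply: ge0_le_integral => //.
    - move=> u /(itv0 _ v'0); rewrite /= in_itv/= => u0.
      rewrite lee_fin; have /andP[_] := wWle u u0; apply: le_trans; exact: w0.
    - by apply: mWE => //; exact: itv0.
    - apply: emeasurable_funD; [exact: (mwE _ (itv0 _ v'0))|exact: measurable_cst].
    - move=> u /(itv0 _ v'0); rewrite /= in_itv/= => u0.
      by rewrite -EFinD lee_fin; have /andP[+ _] := wWle u u0; lra.
  rewrite ge0_integralD//; first last.
  - by move=> u _; rewrite lee_fin mulr_ge0// ltW.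
  - exact: (mwE _ (itv0 _ v'0)).
  - by move=> u /(itv0 _ v'0); rewrite /= in_itv/= => u0; rewrite lee_fin w0.
  apply: leeD => //.
  have mwo : measurable_fun `]v', h[ (EFin \o w).
    apply: mwE => u; rewrite /= !in_itv/= => /andP[vu uh].
    by rewrite (lt_trans v'0)//= (lt_trans uh).
  rewrite -integral_itv_obnd_cbnd -?integral_itv_bndo_bndc//.
    apply: ge0_subset_integral => //.
      by apply: mwE => u [/andP[u0 uh] _]; rewrite /= in_itv/= u0 (lt_trans uh).
    by move=> u [/andP[u0 uh] _]; rewrite lee_fin w0// sub0// ltW.
  by apply: mwE => u; rewrite /= !in_itv/= => /andP[vu uh]; rewrite (lt_trans v'0)//= (le_lt_trans uh).
have If : I \is a fin_num by rewrite fin_numE -ltNye -ltey (lt_le_trans _ Ilo) ?ltNyr// (le_lt_trans Iup) ?ltry.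
exists (fine I); split; first by rewrite fineK.
move: Iup; rewrite -[in X in X -> _](fineK If) lee_fin => Iup.
move: Ilo; rewrite -[in X in X -> _](fineK If) lee_fin => Ilo.
have := BE v (sub0 _ v0 (ltW vh)); have := BE v' (sub0 _ v'0 (ltW v'h)).
rewrite fv fv' !ler_norml => /andP[H1 H2] /andP[H3 H4].
move: Bh; rewrite ler_norml => /andP[H5 H6].
have Cv : 0 < C * v by rewrite mulr_gt0.
have Cv' : 0 < C * v' by rewrite mulr_gt0.
by apply/andP; split; lra.
Qed.

End Superlevel.

(** * Iterated integrals *)

Section IteratedIntegral.
Context (R : realType).
Notation mu := (@lebesgue_measure R).
Local Open Scope ereal_scope.

(* Joint Borel measurability in (s, v), tested on all measurable maps into the
   product; this avoids equipping row vectors with a sigma-algebra. *)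
Definition measurable2 d (S : measurableType d) k (F : S -> 'rV[R]_k -> \bar R)
  : Prop :=
  forall d' (U : measurableType d') (a : U -> S) (b : U -> 'rV[R]_k),
    measurable_fun [set: U] a ->
    (forall i, measurable_fun [set: U] (fun u => b u 0%R i)) ->
    measurable_fun [set: U] (fun u => F (a u) (b u)).

Definition measurable_rV k (f : 'rV[R]_k -> \bar R) : Prop :=
  forall d (U : measurableType d) (b : U -> 'rV[R]_k),
    (forall i, measurable_fun [set: U] (fun u => b u 0%R i)) ->
    measurable_fun [set: U] (fun u => f (b u)).

Definition cons_rV k (x : R) (v : 'rV[R]_k) : 'rV[R]_(1 + k) :=
  row_mx (x%:M : 'M[R]_1) v.

Lemma cons_rV0 k (x : R) (v : 'rV[R]_k) : cons_rV x v 0%R ord0 = x.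
Proof.
by rewrite /cons_rV mxE; case: splitP => j //=; rewrite ?ord1 ?mxE.
Qed.

Lemma cons_rVS k (x : R) (v : 'rV[R]_k) (j : 'I_k) : cons_rV x v 0%R (lift ord0 j) = v 0%R j.
Proof.
rewrite /cons_rV mxE; case: splitP => i /=; first by rewrite ord1.
by move=> [] /val_inj ->.
Qed.

Lemma measurable_cons_rV d (U : measurableType d) k (x : U -> R) (v : U -> 'rV[R]_k) :
  measurable_fun [set: U] x ->
  (forall i, measurable_fun [set: U] (fun u => v u 0%R i)) ->
  forall i, measurable_fun [set: U] (fun u => cons_rV (x u) (v u) 0%R i).
Proof.
move=> mx mv i; have [j ->|->] := unliftP ord0 i.
  by under eq_fun do rewrite cons_rVS; exact: mv.
by under eq_fun do rewrite cons_rV0; exact: mx.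
Qed.

Notation lebI := (@lebesgue_integral_rV R _).

Lemma lebIS k (f : 'rV[R]_k.+1 -> \bar R) :
  lebI f = \int[mu]_x lebI (fun v => f (cons_rV x v)).
Proof. by []. Qed.

Lemma lebI_ge0 k (f : 'rV[R]_k -> \bar R) : (forall v, 0 <= f v) -> 0 <= lebI f.
Proof.
elim: k f => [|k IH] f f0; first exact: f0.
rewrite lebIS.
by apply: integral_ge0 => x _; exact: IH.
Qed.

Lemma measurable2_cons d (S : measurableType d) k (F : S -> 'rV[R]_k.+1 -> \bar R) :
  measurable2 F ->
  measurable2 (fun (sx : S * R) (v : 'rV[R]_k) => F sx.1 (cons_rV sx.2 v)).
Proof.
move=> mF d' U a b ma mb.
apply: (mF _ U (fun u => (a u).1)).
  by apply: measurableT_comp ma; exact: measurable_fst.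
apply: measurable_cons_rV => //.
by apply: measurableT_comp ma; exact: measurable_snd.
Qed.

(** The induction moves the outer variable into the parameter space, which is why F carries a
    parameter in an arbitrary measurable type. *)
Lemma measurable_lebI k d (S : measurableType d) (F : S -> 'rV[R]_k -> \bar R) :
  measurable2 F -> (forall s v, 0 <= F s v) ->
  measurable_fun [set: S] (fun s => lebI (F s)).
Proof.
elim: k d S F => [|k IH] d S F mF F0 /=.
  apply: (mF _ S id (fun=> 0%R)); first exact: measurable_id.
  by move=> i; exact: measurable_cst.
have := IH _ _ _ (measurable2_cons mF) (fun s v => F0 _ _).
move=> /(@measurable_fun_fubini_tonelli_F _ _ _ _ R mu).
by apply => -[s x] /=; apply: lebI_ge0.
Qed.

Lemma measurable2_slice d (S : measurableType d) k (F : S -> 'rV[R]_k -> \bar R) s :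
  measurable2 F -> measurable_rV (F s).
Proof. by move=> mF d' U b mb; apply: (mF _ U (fun=> s) b). Qed.

Lemma measurable_rV_cons k (f : 'rV[R]_k.+1 -> \bar R) :
  measurable_rV f -> measurable2 (fun (x : R) (v : 'rV[R]_k) => f (cons_rV x v)).
Proof. by move=> mf d' U a b ma mb; apply: mf; exact: measurable_cons_rV. Qed.

Lemma measurable_lebI_cons k (f : 'rV[R]_k.+1 -> \bar R) :
  measurable_rV f -> (forall v, 0 <= f v) ->
  measurable_fun [set: R] (fun x => lebI (fun v => f (cons_rV x v))).
Proof. by move=> /measurable_rV_cons mf f0; exact: measurable_lebI. Qed.

Lemma lebI_le k (f g : 'rV[R]_k -> \bar R) :
  measurable_rV f -> measurable_rV g -> (forall v, 0 <= f v) ->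
  (forall v, f v <= g v) -> lebI f <= lebI g.
Proof.
elim: k f g => [|k IH] f g mf mg f0 fg; first exact: fg.
rewrite !lebIS.
apply: ge0_le_integral => //.
- by move=> x _; exact: lebI_ge0.
- exact: measurable_lebI_cons.
- by apply: measurable_lebI_cons => // v; exact: le_trans (fg v).
- move=> x _; apply: IH => //; exact: (measurable2_slice x (measurable_rV_cons _)).
Qed.

Lemma lebID k (f g : 'rV[R]_k -> \bar R) :
  measurable_rV f -> measurable_rV g -> (forall v, 0 <= f v) ->
  (forall v, 0 <= g v) -> lebI (fun v => f v + g v) = lebI f + lebI g.
Proof.
elim: k f g => [|k IH] f g mf mg f0 g0 //; rewrite !lebIS.
rewrite -ge0_integralD//; first last.
- exact: measurable_lebI_cons.
- by move=> x _; exact: lebI_ge0.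
- exact: measurable_lebI_cons.
- by move=> x _; exact: lebI_ge0.
apply: eq_integral => x _; apply: IH => //; exact: (measurable2_slice x (measurable_rV_cons _)).
Qed.

Lemma lebIZ k (c : R) (f : 'rV[R]_k -> \bar R) : (0 <= c)%R ->
  measurable_rV f -> (forall v, 0 <= f v) ->
  lebI (fun v => c%:E * f v) = c%:E * lebI f.
Proof.
move=> c0; elim: k f => [|k IH] f mf f0 //; rewrite !lebIS.
rewrite -ge0_integralZl//; first last.
- by move=> x _; exact: lebI_ge0.
- exact: measurable_lebI_cons.
apply: eq_integral => x _; apply: IH => //; exact: (measurable2_slice x (measurable_rV_cons _)).
Qed.

Lemma lebI_Fubini k (F : R -> 'rV[R]_k -> \bar R) :
  measurable2 F -> (forall x v, 0 <= F x v) ->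
  \int[mu]_x lebI (F x) = lebI (fun v => \int[mu]_x F x v).
Proof.
elim: k F => [|k IH] F mF F0 //; rewrite [RHS]lebIS.
under eq_integral do rewrite lebIS.
rewrite (@sfinite_Fubini _ _ _ _ _ mu mu (fun xy => lebI (fun v => F xy.1 (cons_rV xy.2 v)))).
- apply: eq_integral => y _; rewrite IH// => d' U a b ma mb.
  by apply: mF => //; apply: measurable_cons_rV.
- by move=> xy; exact: lebI_ge0.
- by apply: measurable_lebI => //; exact: measurable2_cons.
Qed.

Definition insert_rV k (i : 'I_k.+1) (t : R) (v : 'rV[R]_k) : 'rV[R]_k.+1 :=
  \row_j oapp (fun l => v 0%R l) t (unlift i j).

Lemma insert_rV_eq k (i : 'I_k.+1) (t : R) (v : 'rV[R]_k) : insert_rV i t v 0%R i = t.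
Proof. by rewrite /insert_rV mxE unlift_none. Qed.

Lemma insert_rV_lift k (i : 'I_k.+1) (t : R) (v : 'rV[R]_k) (l : 'I_k) :
  insert_rV i t v 0%R (lift i l) = v 0%R l.
Proof. by rewrite /insert_rV mxE liftK. Qed.

Lemma insert_rV0 k (t : R) (v : 'rV[R]_k) : insert_rV ord0 t v = cons_rV t v.
Proof.
apply/rowP => j; have [l ->|->] := unliftP ord0 j.
  by rewrite insert_rV_lift cons_rVS.
by rewrite insert_rV_eq cons_rV0.
Qed.

Lemma insert_rVS k (i : 'I_k.+1) (x t : R) (v : 'rV[R]_k) :
  insert_rV (lift ord0 i) t (cons_rV x v) = cons_rV x (insert_rV i t v).
Proof.
apply/rowP => j; have [l ->|->] := unliftP ord0 j.
  rewrite cons_rVS; have [l' ->|->] := unliftP i l.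
    rewrite (_ : lift ord0 (lift i l') = lift (lift ord0 i) (lift ord0 l')); last first.
      by apply: val_inj; rewrite /= /bump !leq0n !add1n ltnS addnS.
    by rewrite !insert_rV_lift cons_rVS.
  by rewrite !insert_rV_eq.
rewrite cons_rV0 (_ : ord0 = lift (lift ord0 i) ord0); last exact: val_inj.
by rewrite insert_rV_lift cons_rV0.
Qed.

(** Makes the i-th coordinate the innermost variable of integration, so that it can run along a
    transversal line. *)
Lemma lebI_insert k (i : 'I_k.+1) (f : 'rV[R]_k.+1 -> \bar R) :
  measurable_rV f -> (forall v, 0 <= f v) ->
  lebI f = lebI (fun v => \int[mu]_t f (insert_rV i t v)).
Proof.
elim: k i f => [|k IH] i f mf f0.
  rewrite lebIS lebI_Fubini//; last exact: measurable_rV_cons.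
  by rewrite /=; apply: eq_integral => t _; rewrite ord1 insert_rV0.
have [j ->|->] := unliftP ord0 i; last first.
  rewrite lebIS lebI_Fubini//; last exact: measurable_rV_cons.
  congr lebesgue_integral_rV; apply/funext => v.
  by apply: eq_integral => t _; rewrite insert_rV0.
rewrite !lebIS; apply: eq_integral => x _.
rewrite (IH j)//; last exact: (measurable2_slice x (measurable_rV_cons _)).
congr lebesgue_integral_rV; apply/funext => v.
by apply: eq_integral => t _; rewrite insert_rVS.
Qed.

Lemma measurable_insert d (U : measurableType d) k (i : 'I_k.+1) (x : U -> R) (v : U -> 'rV[R]_k) :
  measurable_fun [set: U] x ->
  (forall l, measurable_fun [set: U] (fun u => v u 0%R l)) ->
  forall l, measurable_fun [set: U] (fun u => insert_rV i (x u) (v u) 0%R l).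
Proof.
move=> mx mv l; have [j ->|->] := unliftP i l.
  by under eq_fun do rewrite insert_rV_lift; exact: mv.
by under eq_fun do rewrite insert_rV_eq; exact: mx.
Qed.

Lemma measurable_lebI_insert k (i : 'I_k.+1) (f : 'rV[R]_k.+1 -> \bar R) :
  measurable_rV f -> (forall v, 0 <= f v) ->
  measurable_rV (fun v => \int[mu]_t f (insert_rV i t v)).
Proof.
move=> mf f0 d U b mb.
apply: (@measurable_fun_fubini_tonelli_F _ _ _ _ R mu
  (fun ut => f (insert_rV i ut.2 (b ut.1)))) => //.
apply: mf; apply: measurable_insert; first exact: measurable_snd.
by move=> l; apply: (measurableT_comp (mb l)); exact: measurable_fst.
Qed.

Definition box k (p : 'rV[R]_k) (d : R) : set 'rV[R]_k :=
  [set v | forall i, (`|v 0%R i - p 0%R i| <= d)%R].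

Lemma lebI_box k (p : 'rV[R]_k) (d : R) : (0 <= d)%R ->
  lebI (fun v => (\1_(box p d) v)%:E) = ((2 * d) ^+ k)%:E.
Proof.
move=> d0; elim: k p => [|k IH] p.
  by rewrite /= indicE mem_set// => -[].
rewrite lebIS; pose q : 'rV[R]_k := \row_j p 0%R (lift ord0 j).
transitivity (\int[mu]_x (((2 * d) ^+ k)%:E * (\1_(`[p 0%R ord0 - d, p 0%R ord0 + d]%classic : set R) x)%:E)).
  apply: eq_integral => x _; rewrite -(IH q).
  have boxE v : box p d (cons_rV x v) <-> (p 0%R ord0 - d <= x <= p 0%R ord0 + d)%R /\ box q d v.
    split=> [H|[H1 H2] i].
      split; first by have := H ord0; rewrite cons_rV0 ler_distl.
      by move=> i; rewrite mxE; have := H (lift ord0 i); rewrite cons_rVS.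
    have [j ->|->] := unliftP ord0 i.
      by rewrite cons_rVS; have := H2 j; rewrite mxE.
    by rewrite cons_rV0 ler_distl.
  have [xI|xI] := boolP (p 0%R ord0 - d <= x <= p 0%R ord0 + d)%R.
    rewrite [in RHS]indicE (mem_set (_ : `[_, _]%classic x)) ?mule1//.
    congr lebesgue_integral_rV; apply/funext => v; rewrite !indicE.
    congr ((nat_of_bool _)%:R%:E); apply/idP/idP; rewrite !inE => h.
      by have [_] := (boxE v).1 h.
    by apply/boxE.
  have xI' : ~ (`[(p 0%R ord0 - d)%R, (p 0%R ord0 + d)%R]%classic x) by rewrite /= in_itv; exact/negP.
  rewrite [in RHS]indicE (memNset xI') mule0.
  have -> : (fun v => (\1_(box p d) (cons_rV x v))%:E) = (fun v => 0%:E * 0) :> ('rV[R]_k -> \bar R).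
    apply/funext => v; rewrite mul0e indicE memNset// => /boxE[h _].
    by move: xI; rewrite h.
  rewrite lebIZ ?mul0e// => dd U b _; exact: measurable_cst.
rewrite ge0_integralZl//; last by rewrite lee_fin exprn_ge0// mulr_ge0.
  rewrite integral_indic//= setIT lebesgue_measure_itv/= lte_fin.
  case: ltP => h.
    by rewrite -EFinD -EFinM; congr EFin; rewrite exprS; ring.
  have -> : d = 0%R by lra.
  by rewrite mulr0 exprS mul0r mule0.
by apply/measurable_EFinP; exact: measurable_indic.
Qed.

End IteratedIntegral.

(** * Borel sets of row vectors, tested on measurable maps *)

Section BorelOpen.
Context (R : realType).

Definition borel_rV k (A : set 'rV[R]_k) : Prop :=
  forall d (U : measurableType d) (b : U -> 'rV[R]_k),
    (forall i, measurable_fun [set: U] (fun u => b u 0 i)) ->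
    measurable [set u | A (b u)].

(** A is the countable union of the rational boxes [V p q] contained in it, and membership in a box
    is a finite conjunction of coordinate conditions. *)
Lemma borel_open k (A : set 'rV[R]_k) : open A -> borel_rV A.
Proof.
move=> oA d U b mb.
pose V (p : 'rV[rat]_k) (q : rat) : set 'rV[R]_k :=
  [set v | forall i, ratr (p 0 i) - ratr q < v 0 i < ratr (p 0 i) + ratr q].
pose J : set ('rV[rat]_k * rat) := [set pq | V pq.1 pq.2 `<=` A].
have -> : [set u | A (b u)] = \bigcup_(pq : 'rV[rat]_k * rat)
    [set u | J pq /\ V pq.1 pq.2 (b u)].
  apply/seteqP; split => u /=; last by move=> [[p q] _ [/= pqA]]; exact: pqA.
  move=> Abu; have : nbhs (b u) A by exact: open_nbhs_nbhs.
  move=> /nbhs_ballP[e /= e0 eA].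
  have [q /andP[q0 qe]] : exists q : rat, 0 < (ratr q : R) < e / 2.
    have [|q] := @rat_in_itvoo R 0 (e / 2); first by rewrite divr_gt0.
    by rewrite in_itv/=; exists q.
  have /choice[p pP] : forall i : 'I_k, exists p : rat,
      b u 0 i - ratr q < ratr p < b u 0 i + ratr q.
    move=> i; have [|p] := @rat_in_itvoo R (b u 0 i - ratr q) (b u 0 i + ratr q).
      by lra.
    by rewrite in_itv/=; exists p.
  exists (\row_i p i, q) => //; split => /=.
    move=> v vV; apply: eA; split => // i j; rewrite ord1 -ball_normE/= ltr_norml.
    have := vV j; have := pP j; rewrite mxE => /andP[? ?] /andP[? ?].
    by apply/andP; split; lra.
  move=> i; rewrite mxE; have /andP[? ?] := pP i.
  by apply/andP; split; lra.
apply: countable_bigcupT_measurable; first exact: countableP.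
move=> [p q]; have [pqJ|pqJ] := pselect (J (p, q)); last first.
  by rewrite (_ : [set _ | _] = set0)// -subset0 => u [].
rewrite (_ : [set _ | _] = \bigcap_(i in [set: 'I_k])
    [set u | ratr (p 0 i) - ratr q < b u 0 i < ratr (p 0 i) + ratr q]); last first.
  by apply/seteqP; split => u /=; [move=> [_ h] i _; exact: h|move=> h; split => // i; exact: h].
apply: fin_bigcap_measurable => //.
move=> i _; rewrite -[X in measurable X]setTI.
have := mb i measurableT `]ratr (p 0 i) - ratr q, ratr (p 0 i) + ratr q[%classic (measurable_itv _).
by congr (measurable (_ `&` _)).
Qed.

Lemma borel_setD k (A B : set 'rV[R]_k) : borel_rV A -> borel_rV B -> borel_rV (A `\` B).
Proof.
move=> mA mB d U b mb.
have := measurableD (mA d U b mb) (mB d U b mb).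
by congr (measurable _); apply/seteqP; split.
Qed.

Lemma measurable_continuous_indic k (O A : set 'rV[R]_k) (f : 'rV[R]_k -> R) :
  open O -> A `<=` O -> borel_rV A ->
  (forall z, O z -> {for z, continuous f}) ->
  measurable_rV (fun z => (f z * \1_A z)%:E).
Proof.
move=> oO AO bA cf d U b mb; apply/measurable_EFinP.
move=> _; apply: (measurability _ (RGenOInfty.measurableE R)) => //.
move=> /= _ [_ [a ->] <-]; rewrite setTI.
pose O' := O `&` [set z | a < f z].
have oO' : open O'.
  move=> z [Oz az]; apply: filterI; first exact: oO.
  exact: (cvgr_gt (f z) (cf z Oz)).
have mA := bA d U b mb; have mO' := borel_open oO' mb.
(* Off A the product is 0, so the set where it exceeds a contains the complement of A exactly when a
   < 0. *)
have [a0|a0] := ltP a 0.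
  have := measurableU _ _ (measurableI _ _ mA mO') (measurableC mA).
  congr (measurable _); apply/seteqP; split => u /=; rewrite in_itv/= andbT indicE.
    by move=> [[Au [_ au]]|nAu]; [rewrite mem_set// mulr1|rewrite memNset// mulr0].
  have [Au|nAu] := pselect (A (b u)); last by right.
  by rewrite mem_set// mulr1 => au; left; split => //; split => //; exact: AO.
have := measurableI _ _ mA mO'.
congr (measurable _); apply/seteqP; split => u /=; rewrite in_itv/= andbT indicE.
  by move=> [Au [_ au]]; rewrite mem_set// mulr1.
have [Au|nAu] := pselect (A (b u)); last first.
  by rewrite memNset// mulr0 ltNge a0.
by rewrite mem_set// mulr1 => au; split => //; split => //; exact: AO.
Qed.

End BorelOpen.

Section AffineSubstitution.
Context (R : realType).
Notation mu := (@lebesgue_measure R).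

(** The map u |-> t0 - s u preserves Lebesgue measure: its pushforward has the right value on the
    intervals ]a, b], which determines it. *)
Lemma ge0_integral_affine (t0 s : R) (F : R -> \bar R) : s = 1 \/ s = -1 ->
  measurable_fun [set: R] F -> (forall t, 0 <= F t)%E ->
  (\int[mu]_t F t = \int[mu]_u F (t0 - s * u)%R)%E.
Proof.
move=> s1 mF F0.
pose phi : R -> measurableTypeR R := fun u => t0 - s * u.
have mphi : measurable_fun [set: R] phi.
  apply: continuous_measurable_fun => u.
  by apply: cvgB; [exact: cvg_cst|apply: cvgM; [exact: cvg_cst|exact: cvg_id]].
transitivity (\int[pushforward mu phi]_t F t)%E; last first.
  by rewrite ge0_integral_pushforward//= preimage_setT.
apply: eq_measure_integral => //= A mA _.
apply: lebesgue_measure_unique => //= _ [[a b]] _ <- /=.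
rewrite /pushforward/=.
case: s1 => s1; rewrite s1 in phi mphi *.
  have -> : phi @^-1` `]a, b] = `[t0 - b, t0 - a[%classic.
    apply/seteqP; split => u; rewrite /= !in_itv/= /phi => /andP[? ?]; apply/andP; split; lra.
  rewrite !lebesgue_measure_itv/= !lte_fin.
  have -> : (t0 - b < t0 - a) = (a < b) by apply/idP/idP; lra.
  by case: ifP => // _; rewrite -!EFinB; congr EFin; ring.
have -> : phi @^-1` `]a, b] = `]a - t0, b - t0]%classic.
  apply/seteqP; split => u; rewrite /= !in_itv/= /phi => /andP[? ?]; apply/andP; split; lra.
rewrite !lebesgue_measure_itv/= !lte_fin.
have -> : (a - t0 < b - t0) = (a < b) by apply/idP/idP; lra.
by case: ifP => // _; rewrite -!EFinB; congr EFin; ring.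
Qed.

End AffineSubstitution.

(** * Transversal lines *)

Section TaylorLines.
Context (R : realType).

(** The expansion of g is integrated term by term. The remainder is controlled by the mean value
    theorem, so no integrability of g is asked for. *)
Lemma expands_integrate (Z : Type) (F : set_system Z) {FF : Filter F} N
    (f g : Z * R -> R) (C d : R) :
  0 < d -> (\forall z \near F, `|f (z, 0)| <= C) ->
  (\forall z \near F, forall u, 0 <= u < d ->
     is_derive u 1 (fun t => f (z, t)) (g (z, u))) ->
  expands F N g -> expands F N.+1 f.
Proof.
move=> d0 fC dfg /expandsP[D gD]; apply/expandsP.
exists (maxr (maxr C D) (maxr 1 d^-1)); near=> z.
set M := maxr _ _.
have [c [cD cg]] : taylor_bound N D (fun u => g (z, u)) by near: z.
have f0 : `|f (z, 0)| <= C by near: z.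
have df : forall u, 0 <= u < d -> is_derive u 1 (fun t => f (z, t)) (g (z, u)) by near: z.
have D0 : 0 <= D by rewrite (le_trans _ (cD 0%N)).
have DM : D <= M by rewrite !le_max lexx orbT.
exists (fun k => if k is k'.+1 then c k' / k'.+1%:R else f (z, 0)); split.
  case=> [|k]; first by rewrite !le_max f0.
  rewrite normrM normfV (le_trans _ DM)// ler_pdivrMr ?normr_gt0 ?pnatr_eq0//.
  rewrite (le_trans (cD k))// ler_peMr// ger0_norm// ler1n//.
move=> u u0 uM.
have ud : u < d by apply: (lt_of_mul_lt1 d0 _ u0 uM); rewrite !le_max lexx !orbT.
pose Q : R -> R := \sum_(k < N) (fun t : R => c k / k.+1%:R * t ^+ k.+1).
pose h t := f (z, t) - (f (z, 0) + Q t).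
have dQ (t : R) : is_derive t 1 Q (\sum_(k < N) c k * t ^+ k).
  apply: is_derive_sum => k.
  have := is_deriveZ (c k / k.+1%:R) (is_deriveX k.+1 (is_derive_id t (1 : R))).
  rewrite /GRing.scale/= mulr1 mulrA divfK ?pnatr_eq0//.
  by rewrite (_ : _ \*: _ = fun t : R => c k / k.+1%:R * t ^+ k.+1)//; apply/funext => x; rewrite /= exprfctE.
have dh t : 0 <= t < d -> is_derive t 1 h (g (z, t) - \sum_(k < N) c k * t ^+ k).
  move=> t0; have dft := df t t0.
  have := is_deriveB dft (is_deriveD (is_derive_cst (f (z, 0)) t 1) (dQ t)).
  by rewrite add0r.
have [x||x] := @MVT R h (fun t => g (z, t) - \sum_(k < N) c k * t ^+ k) 0 u u0.
- rewrite in_itv/= => /andP[x0 xu]; apply: dh; by rewrite ltW//= (lt_trans xu).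
- apply: derivable_within_continuous => x; rewrite in_itv/= => /andP[x0 xu].
  by have [] := dh x; rewrite ?x0 ?(le_lt_trans xu).
rewrite in_itv/= => /andP[x0 xu] hE.
have h0 : h 0 = 0.
  rewrite /h /Q fct_sumE big1 ?addr0 ?subrr// => k _.
  by rewrite expr0n/= mulr0.
have -> : f (z, u) - \sum_(k < N.+1) (if k : nat is k'.+1 then c k' / k'.+1%:R else f (z, 0)) * u ^+ k
  = h u - h 0.
  rewrite h0 subr0 /h big_ord_recl/= expr0 mulr1; congr (_ - (_ + _)).
  by rewrite /Q fct_sumE.
rewrite hE subr0 normrM (gtr0_norm u0) exprSr mulrA ler_pM2r//.
rewrite (le_trans (cg x x0 _))//.
  rewrite (le_lt_trans _ uM)// (le_trans (ler_wpM2r D0 (ltW xu)))//.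
  by rewrite ler_wpM2l// ltW.
rewrite ler_pM// ?exprn_ge0 ?(ltW x0)//.
by rewrite lerXn2r ?nnegrE ?(ltW x0) ?(ltW u0) ?(ltW xu).
Unshelve. all: by end_near. Qed.

(* For 0 < s * partial i r z the line enters {r < 0} as u grows from 0. *)
Definition line k (i : 'I_k) (s : R) (x : 'rV[R]_k * R) : 'rV[R]_k :=
  x.1 - (s * x.2) *: delta_mx 0 i.

Lemma line_near k (i : 'I_k) (s : R) (z0 : 'rV[R]_k) (F : set_system 'rV[R]_k)
    {FF : Filter F} (P : 'rV[R]_k -> Prop) :
  F --> z0 -> (\forall y \near z0, P y) -> \forall x \near small R F, P (line i s x).
Proof.
move=> Fz0 Pz0.
suff : line i s x @[x --> small R F] --> z0 by exact.
have c1 : x.1 @[x --> small R F] --> z0.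
  by apply: cvg_trans Fz0; exact: cvg_fst.
have c2 : x.2 @[x --> small R F] --> (0 : R).
  by apply: (@cvg_trans _ (0 : R)^'+); [exact: cvg_snd|exact: cvg_within].
have c3 : s * x.2 @[x --> small R F] --> s * 0 by apply: cvgM => //; exact: cvg_cst.
have := cvgB c1 (cvgZ c3 (cvg_cst (delta_mx 0 i : 'rV[R]_k))).
by rewrite mulr0 scale0r subr0; exact.
Qed.

Lemma line_derive k (i : 'I_k) (s u : R) (z : 'rV[R]_k) (H : 'rV[R]_k -> R) :
  derivable H (line i s (z, u)) (delta_mx 0 i) ->
  is_derive u 1 (fun t => H (line i s (z, t))) (- s * partial i H (line i s (z, u))).
Proof.
move=> dH.
pose phi (t : R) := H (z + t *: delta_mx 0 i).
have dphi : is_derive (- (s * u)) 1 phi (partial i H (line i s (z, u))).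
  have E (h : R) : h *: delta_mx 0 i + line i s (z, u) = z + (h *: 1 + - (s * u)) *: delta_mx 0 i.
    by rewrite /line /= scalerDl scaleNr /GRing.scale/= mulr1 addrCA.
  have E0 : line i s (z, u) = z + - (s * u) *: delta_mx 0 i.
    by rewrite /line /= scaleNr.
  have FE : (fun h : R => h^-1 *: ((phi \o shift (- (s * u))) (h *: 1) - phi (- (s * u))))
    = (fun h : R => h^-1 *: ((H \o shift (line i s (z, u))) (h *: delta_mx 0 i) - H (line i s (z, u)))).
    by apply/funext => h /=; rewrite E E0.
  apply: DeriveDef; first by rewrite /derivable FE.
  by rewrite /partial /derive FE.
have dl : is_derive u 1 (fun t : R => - (s * t)) (- s).
  have := is_deriveN (is_deriveZ s (is_derive_id u (1 : R))).
  by rewrite /GRing.scale/= mulr1.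
have := @is_derive1_comp _ phi (fun t : R => - (s * t)) u _ _ dphi dl.
rewrite /GRing.scale/= mulrC.
by congr is_derive; apply/funext => t; rewrite /= /phi /line/= scaleNr.
Qed.

(** Induction on N for all iterated partials at once: along a line the u-derivative is - s times the
    partial in direction i, and an expansion of order N of that integrates to one of order N + 1. *)
Lemma smooth_expands k (i : 'I_k) (s : R) (G : 'rV[R]_k -> R) (z0 : 'rV[R]_k) N :
  smooth_at G z0 -> expands (nbhs z0) N (fun x => G (line i s x)).
Proof.
move=> sG; suff : forall l : seq 'I_k, expands (nbhs z0) N (fun x => iter_partial l G (line i s x)).
  by move/(_ [::]).
have cG l : {for z0, continuous (iter_partial l G)}.
  by have /(_ l)[] := nbhs_singleton sG.
have bG l : \forall z \near z0, `|iter_partial l G z| <= `|iter_partial l G z0| + 1.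
  by apply: (cvgr_norm_le (iter_partial l G z0) (cG l)); rewrite ltrDl.
elim: N => [|N IH] l.
  exists (`|iter_partial l G z0| + 1).
  exact: (@line_near k i s z0 (nbhs z0) (nbhs_filter z0) _ (fun _ h => h) (bG l)).
have [d d0 H] : exists2 d : R, 0 < d & \forall z \near z0, forall u, 0 <= u < d ->
    forall j, derivable (iter_partial l G) (line i s (z, u)) (delta_mx 0 j).
  have H0 : \forall y \near z0, forall j, derivable (iter_partial l G) y (delta_mx 0 j).
    by near=> y; move: l; near: y; apply: filterS sG => y + l => /(_ l)[].
  have /smallP[d d0 H] := @line_near k i s z0 (nbhs z0) (nbhs_filter z0) _ (fun _ h => h) H0.
  exists d => //; near=> z => u /andP[u0 ud]; have [u00|u00] := ltP 0 u.
    have : forall u, 0 < u < d -> forall j, derivable (iter_partial l G) (line i s (z, u)) (delta_mx 0 j) by near: z.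
    by apply; rewrite u00.
  have -> : u = 0 by apply/eqP; rewrite eq_le u00.
  by rewrite /line /= mulr0 scale0r subr0; near: z.
apply: (@expands_integrate _ _ _ N _ (fun x => - s * iter_partial (i :: l) G (line i s x)) (`|iter_partial l G z0| + 1) d) => //.
- near=> z; rewrite /line/= mulr0 scale0r subr0; near: z; exact: bG.
- near=> z => u u0; apply: line_derive.
  have Hz : forall u, 0 <= u < d ->
    forall j, derivable (iter_partial l G) (line i s (z, u)) (delta_mx 0 j) by near: z.
  exact: Hz.
- apply: expandsM; first exact: expands_real.
  exact: IH.
Unshelve. all: by end_near. Qed.

End TaylorLines.

(** * The determinant of Fefferman's metric *)

Section DirectionalChain.
Context (R : realType).

Lemma is_derive_line (V : normedModType R) (F : V -> R) (x v : V) (d : R) :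
  is_derive x v F d <-> is_derive (0 : R) 1 (fun t => F (t *: v + x)) d.
Proof.
have FE : (fun h : R => h^-1 *: (((fun t => F (t *: v + x)) \o shift 0) (h *: 1) - F (0 *: v + x)))
    = (fun h : R => h^-1 *: ((F \o shift x) (h *: v) - F x)).
  by apply/funext => h /=; rewrite scale0r add0r addr0 /GRing.scale/= mulr1.
split=> -[dF eF]; apply: DeriveDef.
- by rewrite /derivable FE.
- by rewrite -eF /derive FE.
- by move: dF; rewrite /derivable FE.
- by rewrite -eF /derive FE.
Qed.

Lemma is_derive_comp1 (V : normedModType R) (f : R -> R) (h : V -> R) (x v : V) (a b : R) :
  is_derive (h x) 1 f a -> is_derive x v h b -> is_derive x v (fun y => f (h y)) (a * b).
Proof.
move=> fa /is_derive_line hb; apply/is_derive_line.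
apply: (@is_derive1_comp _ f (fun t : R => h (t *: v + x))) => //.
by rewrite scale0r add0r.
Qed.

End DirectionalChain.

Section Wirtinger.
Context (R : realType) (m : nat).
Implicit Types (f rho : model R m -> R) (z : model R m).

Lemma complexP (x y : R[i]) :
  complex.Re x = complex.Re y -> complex.Im x = complex.Im y -> x = y.
Proof. by case: x y => [a b] [c d] /= -> ->. Qed.

Lemma ReM (x y : R[i]) : complex.Re (x * y) =
  complex.Re x * complex.Re y - complex.Im x * complex.Im y.
Proof. by case: x y => [a b] [c d]. Qed.

Lemma ImM (x y : R[i]) : complex.Im (x * y) =
  complex.Re x * complex.Im y + complex.Im x * complex.Re y.
Proof. by case: x y => [a b] [c d] /=; rewrite addrC. Qed.

Lemma ReD (x y : R[i]) : complex.Re (x + y) = complex.Re x + complex.Re y.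
Proof. by case: x y => [a b] [c d]. Qed.

Lemma ImD (x y : R[i]) : complex.Im (x + y) = complex.Im x + complex.Im y.
Proof. by case: x y => [a b] [c d]. Qed.

Lemma ReN (x : R[i]) : complex.Re (- x) = - complex.Re x.
Proof. by case: x. Qed.

Lemma ImN (x : R[i]) : complex.Im (- x) = - complex.Im x.
Proof. by case: x. Qed.

Lemma half_complex : (2 : R[i])^-1 = (2^-1 : R)%:C%C.
Proof. by rewrite (_ : 2 = (2 : R)%:C%C) ?fmorphV// rmorph_nat. Qed.

Definition compE := (ReM, ImM, ReD, ImD, ReN, ImN).

Lemma half_addi (a b c d : R) :
  ((a +i* b) + 'i * (c +i* d))%C / 2 = (((a - d) / 2) +i* ((b + c) / 2))%C.
Proof. by rewrite half_complex; apply: complexP; rewrite !compE /=; field. Qed.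

Lemma half_subi (a b c d : R) :
  ((a +i* b) - 'i * (c +i* d))%C / 2 = (((a + d) / 2) +i* ((b - c) / 2))%C.
Proof. by rewrite half_complex; apply: complexP; rewrite !compE /=; field. Qed.

Lemma half_subi_half (a b c d : R) :
  (((a / 2) +i* (b / 2)) - 'i * ((c / 2) +i* (d / 2)))%C / 2 =
  (((a + d) / 4) +i* ((b - c) / 4))%C.
Proof. by rewrite half_subi; congr (_ +i* _)%C; field. Qed.

(** The quotient rule for the complex Hessian of log (- rho) in real terms: t is rho, a, b, c, d are
    its second partials, x1 and x3 its first partials in the real and imaginary parts of z_j, x2 and
    x4 those of z_k. *)
Lemma potential_identity (a b c d x1 x2 x3 x4 t : R) : t != 0 ->
  (- ((((a / t - x2 * x1 / t ^+ 2) + (b / t - x4 * x3 / t ^+ 2)) / 4) +i*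
      (((c / t - x4 * x1 / t ^+ 2) - (d / t - x2 * x3 / t ^+ 2)) / 4)) =
   - ((((a + b) / 4) +i* ((c - d) / 4)) / t%:C
      - ((x1 / 2) +i* (- (x3 / 2))) * ((x2 / 2) +i* (x4 / 2)) / t%:C ^+ 2))%C.
Proof.
move=> t0; rewrite -rmorphXn -!fmorphV /=.
by apply: complexP; rewrite !compE /=; field.
Qed.

Lemma partial_cst0 k (i : 'I_k) (c : R) x : partial i (fun=> c) x = 0.
Proof. exact: derive_cst. Qed.

Lemma dzbarE f z (k : 'I_m) : dzbar k (cfun f) z =
  ((partial (lshift m k) f z / 2) +i* (partial (rshift m k) f z / 2))%C.
Proof.
rewrite /dzbar /cpartial (_ : (fun y => complex.Re (cfun f y)) = f)//.
rewrite (_ : (fun y => complex.Im (cfun f y)) = fun=> 0)// !partial_cst0.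
by rewrite half_addi subr0 add0r.
Qed.

Lemma dzE f z (k : 'I_m) : dz k (cfun f) z =
  ((partial (lshift m k) f z / 2) +i* (- (partial (rshift m k) f z / 2)))%C.
Proof.
rewrite /dz /cpartial (_ : (fun y => complex.Re (cfun f y)) = f)//.
rewrite (_ : (fun y => complex.Im (cfun f y)) = fun=> 0)// !partial_cst0.
by rewrite half_subi addr0 sub0r mulNr.
Qed.

Lemma partial_half k (i : 'I_k) (g : 'rV[R]_k -> R) x :
  derivable g x (delta_mx 0 i) -> partial i (fun y => g y / 2) x = partial i g x / 2.
Proof.
move=> dg; rewrite /partial.
have -> : (fun y => g y / 2) = (2^-1 \*: g) by apply/funext => y /=; rewrite /GRing.scale/= mulrC.
by rewrite deriveZ// /GRing.scale/= mulrC.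
Qed.

Lemma dz_dzbarE f z (j k : 'I_m) :
  (forall a b : 'I_(m + m), derivable (partial a f) z (delta_mx 0 b)) ->
  dz j (dzbar k (cfun f)) z =
  (((partial (lshift m j) (partial (lshift m k) f) z
     + partial (rshift m j) (partial (rshift m k) f) z) / 4) +i*
   ((partial (lshift m j) (partial (rshift m k) f) z
     - partial (rshift m j) (partial (lshift m k) f) z) / 4))%C.
Proof.
move=> df; rewrite {1}/dz /cpartial.
have -> : (fun y => complex.Re (dzbar k (cfun f) y)) = (fun y => partial (lshift m k) f y / 2).
  by apply/funext => y; rewrite dzbarE.
have -> : (fun y => complex.Im (dzbar k (cfun f) y)) = (fun y => partial (rshift m k) f y / 2).
  by apply/funext => y; rewrite dzbarE.
rewrite (partial_half (df (lshift m k) (lshift m j))).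
rewrite (partial_half (df (lshift m k) (rshift m j))).
rewrite (partial_half (df (rshift m k) (lshift m j))).
rewrite (partial_half (df (rshift m k) (rshift m j))).
exact: half_subi_half.
Qed.

Lemma partial_ln k (a : 'I_k) (rho : 'rV[R]_k -> R) x : rho x < 0 ->
  derivable rho x (delta_mx 0 a) ->
  partial a (fun y => ln (- rho y)) x = partial a rho x / rho x.
Proof.
move=> r0 dr; have dr' : is_derive x (delta_mx 0 a) (fun y => - rho y) (- partial a rho x).
  by apply: is_deriveN; apply: DeriveDef.
have nr0 : 0 < - rho x by rewrite oppr_gt0.
have [_ h] := @is_derive_comp1 _ _ (@ln R) (fun y => - rho y) _ _ _ _ (is_derive1_ln nr0) dr'.
transitivity ((- rho x)^-1 * (- partial a rho x)); first exact: h.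
by rewrite invrN mulrNN mulrC.
Qed.

(* In the paper's notation: (log(-rho))_{jk} = rho_{jk}/rho - rho_j rho_k/rho^2. *)
Lemma dz_dzbar_ln rho z (j k : 'I_m) : rho z < 0 -> smooth_at rho z ->
  - dz j (dzbar k (cfun (fun y => ln (- rho y)))) z =
  - (dz j (dzbar k (cfun rho)) z / (rho z)%:C%C
     - dz j (cfun rho) z * dzbar k (cfun rho) z / (rho z)%:C%C ^+ 2).
Proof.
move=> r0 sr.
have sz := nbhs_singleton sr.
have dr a : derivable rho z (delta_mx 0 a) by have [_ ] := sz [::]; apply.
have drr a b : derivable (partial a rho) z (delta_mx 0 b) by have [_ ] := sz [:: a]; apply.
have cr : {for z, continuous rho} by have [] := sz [::].
have rn0 : rho z != 0 by rewrite lt_eqF.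
have near_ln a : \forall y \near z, partial a rho y / rho y = partial a (fun y => ln (- rho y)) y.
  have rneg : \forall y \near z, rho y < 0 by apply: (cvgr_lt (rho z) cr).
  near=> y; rewrite partial_ln//; first by near: y.
  have : forall s : seq 'I_(m + m), {for y, continuous (iter_partial s rho)} /\
    forall i, derivable (iter_partial s rho) y (delta_mx 0 i) by near: y.
  by move=> /(_ [::])[_]; apply.
have dq a b : is_derive z (delta_mx 0 b) (fun y => partial a rho y / rho y)
   (partial b (partial a rho) z / rho z - partial a rho z * partial b rho z / rho z ^+ 2).
  have d1 : is_derive z (delta_mx 0 b) (partial a rho) (partial b (partial a rho) z).
    by apply: DeriveDef.
  have d2 : is_derive z (delta_mx 0 b) (fun y => (rho y)^-1) (- rho z ^- 2 *: partial b rho z).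
    by apply: DeriveDef; [exact: derivableV|rewrite deriveV].
  have := is_deriveM d1 d2; rewrite /GRing.scale/= => d3.
  by apply: is_derive_eq; field; rewrite rn0.
have dln a b : is_derive z (delta_mx 0 b) (partial a (fun y => ln (- rho y)))
   (partial b (partial a rho) z / rho z - partial a rho z * partial b rho z / rho z ^+ 2).
  exact: near_eq_is_derive (near_ln a) (dq a b).
have pln a b : partial b (partial a (fun y => ln (- rho y))) z =
   partial b (partial a rho) z / rho z - partial a rho z * partial b rho z / rho z ^+ 2.
  by have [_ <-] := dln a b.
rewrite dz_dzbarE; last by move=> a b; have [] := dln a b.
rewrite (dz_dzbarE j k drr) (dzE rho) (dzbarE rho).
apply: etrans (potential_identity _ _ _ _ _ _ _ _ rn0).
by congr (- ((_ / 4) +i* (_ / 4))%C); [congr (_ + _)|congr (_ - _)]; exact: pln.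
Unshelve. all: by end_near. Qed.

End Wirtinger.

(** * Bordered determinants and perturbation of determinants *)

Section Determinants.

(** Block elimination with pivot r; the second factor is the Schur complement. *)
Lemma det_bordered (F : fieldType) m (r : F) (u : 'rV[F]_m) (v : 'cV[F]_m) (H : 'M[F]_m) :
  r != 0 -> \det (block_mx r%:M u v H) = r * \det (H - r^-1 *: (v *m u)).
Proof.
move=> r0.
have -> : block_mx r%:M u v H = block_mx 1%:M 0 (r^-1 *: v) 1%:M
    *m block_mx r%:M u 0 (H - r^-1 *: (v *m u)).
  rewrite mulmx_block !mul1mx !mul0mx !addr0.
  by rewrite mul_mx_scalar scalerA divff// scale1r -scalemxAl addrC subrK.
by rewrite det_mulmx det_lblock det_ublock !det1 !mul1r det_scalar1.
Qed.

(** Induction through a_i A - b_i B = (a_i - b_i) A + b_i (A - B), for which the size of A has to be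
    carried along. *)
Lemma prod_lipschitz (C : numDomainType) (I : Type) (l : seq I) (a b : I -> C) (M d : C) :
  1 <= M -> 0 <= d -> (forall i, `|a i| <= M) -> (forall i, `|b i| <= M) ->
  (forall i, `|a i - b i| <= d) ->
  `|\prod_(i <- l) a i| <= M ^+ size l /\
  `|\prod_(i <- l) a i - \prod_(i <- l) b i| <= (size l)%:R * M ^+ size l * d.
Proof.
move=> M1 d0 aM bM abd; have M0 : 0 <= M by rewrite (le_trans ler01).
elim: l => [|i l [IH1 IH2]].
  by rewrite !big_nil subrr normr0 normr1 mul0r mul0r lexx.
rewrite !big_cons normrM exprS; split; first by rewrite ler_pM.
set A := \prod_(j <- l) a j; set B := \prod_(j <- l) b j.
have -> : a i * A - b i * B = (a i - b i) * A + b i * (A - B) by ring.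
rewrite (le_trans (ler_normD _ _))// !normrM /= -natr1.
have -> : ((size l)%:R + 1) * (M * M ^+ size l) * d =
   d * (M * M ^+ size l) + M * ((size l)%:R * M ^+ size l * d) by ring.
rewrite lerD ?ler_pM// (le_trans IH1)// ler_peMl// exprn_ge0//.
Qed.

Lemma det_lipschitz (C : numDomainType) m (M : C) : 1 <= M ->
  exists2 L : C, 0 <= L & forall (A B : 'M[C]_m) (d : C), 0 <= d ->
    (forall j k, `|A j k| <= M) -> (forall j k, `|B j k| <= M) ->
    (forall j k, `|A j k - B j k| <= d) -> `|\det A - \det B| <= L * d.
Proof.
move=> M1; have M0 : 0 <= M by rewrite (le_trans ler01).
exists (\sum_(s : 'S_m) (m%:R * M ^+ m)).
  by apply: sumr_ge0 => s _; rewrite mulr_ge0// exprn_ge0.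
move=> A B d d0 AM BM ABd; rewrite /determinant -sumrB.
rewrite (le_trans (ler_norm_sum _ _ _))// mulr_suml ler_sum// => s _.
rewrite -mulrBr normrM normrX normrN1 expr1n mul1r.
have sz : size (index_enum 'I_m) = m by rewrite -[RHS]card_ord cardT enumT.
have [_] := @prod_lipschitz C _ (index_enum 'I_m) (fun i => A i (s i)) (fun i => B i (s i)) M d
  M1 d0 (fun i => AM _ _) (fun i => BM _ _) (fun i => ABd _ _).
by rewrite sz.
Qed.

End Determinants.

Section FeffermanDeterminant.
Context (R : realType) (m : nat).

Definition potential_metric (rho : model R m -> R) (z : model R m) : 'M[R[i]]_m :=
  \matrix_(j, k) (- dz j (dzbar k (cfun (fun y => ln (- rho y)))) z).

(** The Schur complement of rho in Fefferman's matrix is - rho times the metric with potential - log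
    (- rho). This turns the Monge-Ampere equation for rho into a formula for the volume density. *)
Lemma det_potential_metric (rho : model R m -> R) z : rho z < 0 -> smooth_at rho z ->
  \det (potential_metric rho z) =
  (- ((- rho z)^-1 ^+ m.+1)%:C%C) * \det (fefferman_matrix rho z).
Proof.
move=> r0 sr; rewrite /fefferman_matrix.
have c0 : (rho z)%:C%C != 0 :> R[i] by rewrite fmorph_eq0 lt_eqF.
rewrite det_bordered//.
set H := \matrix_(j, k) _; set u := \row_k _; set v := \col_j _.
have -> : potential_metric rho z = - (rho z)%:C%C^-1 *: (H - (rho z)%:C%C^-1 *: (v *m u)).
  apply/matrixP => j k; rewrite [LHS]mxE dz_dzbar_ln// !mxE big_ord1 !mxE.
  rewrite mulNr mulrBr; congr (- (_ - _)); first by rewrite mulrC.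
  by rewrite [RHS]mulrA -invfM -expr2 mulrC.
rewrite detZ mulrA; congr (_ * _).
rewrite rmorphXn fmorphV rmorphN/= invrN exprSr.
by rewrite /cfun mulrN opprK -mulrA mulVf ?mulr1.
Qed.

(** The error rho^(m+1) cancels the factor (- rho)^(-m-1) and leaves O(1). With m = n + 1 this is
    where the order O(rho^(n+2)) in Fefferman's equation enters. *)
Lemma det_potential_near (rho : model R m -> R) z (K : R) : rho z < 0 -> smooth_at rho z ->
  `|\det (fefferman_matrix rho z) - (- 1)| <= (K * `|rho z| ^+ m.+1)%:C%C ->
  `|\det (potential_metric rho z) - ((- rho z)^-1 ^+ m.+1)%:C%C| <= K%:C%C.
Proof.
move=> r0 sr; rewrite det_potential_metric// opprK => HK.
set D := \det _ in HK *; set c := ((- rho z)^-1 ^+ m.+1).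
have c0 : 0 <= c by rewrite exprn_ge0// invr_ge0 oppr_ge0 ltW.
have -> : - c%:C%C * D - c%:C%C = - (c%:C%C * (D + 1)) by ring.
rewrite normrN normrM.
have -> : `|c%:C%C| = c%:C%C :> R[i] by rewrite ger0_norm// ler0c.
have -> : K%:C%C = c%:C%C * (K * `|rho z| ^+ m.+1)%:C%C :> R[i].
  rewrite -rmorphM/=; congr (_%:C%C); rewrite mulrCA ltr0_norm// -exprMn mulVf ?expr1n ?mulr1//.
  by rewrite oppr_eq0 lt_eqF.
by rewrite ler_wpM2l// ler0c.
Qed.

End FeffermanDeterminant.

(** * Boundary charts *)

Section Lines.
Context (R : realType) (k : nat).
Implicit Types (G r : 'rV[R]_k -> R) (F : set_system 'rV[R]_k).

Lemma line_near0 (i : 'I_k) (s : R) (z0 : 'rV[R]_k) F {FF : Filter F} (P : 'rV[R]_k -> Prop) :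
  F --> z0 -> (\forall y \near z0, P y) ->
  exists2 d : R, 0 < d & \forall z \near F, forall u, 0 <= u < d -> P (line i s (z, u)).
Proof.
move=> Fz0 Pz0; have /smallP[d d0 H] := @line_near R k i s z0 F FF _ Fz0 Pz0.
have Fz : \forall z \near F, P z by exact: Fz0.
exists d => //; near=> z => u /andP[u0 ud]; have [u00|u00] := ltP 0 u.
  have : forall u, 0 < u < d -> P (line i s (z, u)) by near: z.
  by apply; rewrite u00.
have -> : u = 0 by apply/eqP; rewrite eq_le u00.
by rewrite /line /= mulr0 scale0r subr0; near: z.
Unshelve. all: by end_near. Qed.

(** The slope is frozen at z0. By continuity of the partial derivative it varies little near z0, so
    the mean value theorem gives the error eta u uniformly in z. *)
Lemma lin_near (i : 'I_k) (s : R) G (z0 : 'rV[R]_k) F {FF : Filter F} (eta : R) :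
  F --> z0 -> smooth_at G z0 -> 0 < eta ->
  exists2 d : R, 0 < d & \forall z \near F, forall u, 0 <= u < d ->
    `|G (line i s (z, u)) - G z + s * u * partial i G z0| <= eta * u.
Proof.
move=> Fz0 sG eta0.
have cG : {for z0, continuous (partial i G)} by have /(_ [:: i])[] := nbhs_singleton sG.
have s1 : 0 < `|s| + 1 by rewrite ltr_wpDl.
have H0 : \forall y \near z0, derivable G y (delta_mx 0 i) /\
    `|partial i G z0 - partial i G y| <= eta / (`|s| + 1).
  near=> y; split.
    have : forall s : seq 'I_k, {for y, continuous (iter_partial s G)} /\
      forall i, derivable (iter_partial s G) y (delta_mx 0 i) by near: y.
    by move=> /(_ [::])[_]; apply.
  near: y; move/cvgrPdist_le : cG; apply.
  by rewrite divr_gt0.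
have [d d0 Hd] := @line_near0 i s z0 F FF _ Fz0 H0.
exists d => //; near=> z => u /andP[u0 ud].
have Hz : forall u, 0 <= u < d -> derivable G (line i s (z, u)) (delta_mx 0 i) /\
    `|partial i G z0 - partial i G (line i s (z, u))| <= eta / (`|s| + 1) by near: z.
have l0 : line i s (z, 0) = z by rewrite /line/= mulr0 scale0r subr0.
have [u00|u00] := ltP 0 u; last first.
  have -> : u = 0 by apply/eqP; rewrite eq_le u00.
  by rewrite l0 subrr mulr0 mul0r addr0 normr0 mulr0.
have [x||x] := @MVT R (fun t => G (line i s (z, t)))
    (fun t => - s * partial i G (line i s (z, t))) 0 u u00.
- rewrite in_itv/= => /andP[x0 xu]; apply: line_derive.
  by have [] := Hz x; rewrite ?(ltW x0) ?(lt_trans xu).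
- apply: derivable_within_continuous => x; rewrite in_itv/= => /andP[x0 xu].
  have [|dx _] := Hz x; first by rewrite x0 (le_lt_trans xu).
  by have [] := line_derive dx.
rewrite in_itv/= => /andP[x0 xu]; rewrite l0 subr0 => ->.
have [|_ pG] := Hz x; first by rewrite (ltW x0) (lt_trans xu).
have -> : - s * partial i G (line i s (z, x)) * u + s * u * partial i G z0 =
  s * (partial i G z0 - partial i G (line i s (z, x))) * u by ring.
rewrite normrM (gtr0_norm u00) ler_pM2r// normrM.
apply: le_trans (ler_wpM2l (normr_ge0 s) pG) _.
by rewrite mulrCA ler_piMr ?(ltW eta0)// ler_pdivrMr// mul1r lerDl.
Unshelve. all: by end_near. Qed.

Lemma defining_line (i : 'I_k) (s : R) G (z0 : 'rV[R]_k) F {FF : Filter F} :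
  F --> z0 -> smooth_at G z0 -> 0 < s * partial i G z0 ->
  (\forall z \near F, G z = 0) ->
  exists2 C : R, 0 < C &
    \forall x \near small R F, x.2 / C <= - G (line i s x) <= C * x.2.
Proof.
move=> Fz0 sG; move gE : (s * partial i G z0) => g g0 GF.
have [d d0 Hd] := lin_near i s Fz0 sG (divr_gt0 g0 (ltr0n _ 2)).
(* The linearisation error is at most (g / 2) u, so - G lies between g u / 2 and 3 g u / 2. *)
exists (maxr (2 * g) (2 / g)).
  by rewrite lt_max mulr_gt0.
apply/smallP; exists d => //; near=> z => u /andP[u0 ud] /=.
have Gz : G z = 0 by near: z.
have : forall u, 0 <= u < d ->
    `|G (line i s (z, u)) - G z + s * u * partial i G z0| <= g / 2 * u by near: z.
move=> /(_ u); rewrite (ltW u0) ud => /(_ isT); rewrite Gz subr0 ler_norml => /andP[h1 h2].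
have E : s * u * partial i G z0 = g * u by rewrite -gE; ring.
rewrite E in h1 h2.
have gu : 0 < g * u by rewrite mulr_gt0.
apply/andP; split.
  have : u / maxr (2 * g) (2 / g) <= u * (g / 2).
    rewrite ler_pM2l// -[g / 2]invrK lef_pV2 ?posrE ?lt_max ?mulr_gt0 ?invr_gt0 ?divr_gt0//.
    by rewrite invfM invrK le_max [_^-1 * _]mulrC lexx orbT.
  lra.
have : 2 * g * u <= maxr (2 * g) (2 / g) * u by rewrite ler_pM2r// le_max lexx.
lra.
Unshelve. all: by end_near. Qed.

(* If s d_i G <= 0, moving in the direction - s e_i + t (d_j G) e_j with t small
   would decrease r and increase G. *)
Lemma normal_sign (i : 'I_k) (s : R) r G (z0 : 'rV[R]_k) :
  smooth_at r z0 -> smooth_at G z0 -> r z0 = 0 -> G z0 = 0 ->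
  (\forall z \near z0, r z < 0 -> G z <= 0) ->
  (exists j, partial j G z0 <> 0) ->
  0 < s * partial i r z0 -> 0 < s * partial i G z0.
Proof.
move=> sr sG r0 G0 rG [j jG] ri0; rewrite ltNge; apply/negP => gi0.
set ri := s * _ in ri0; set gi := s * _ in gi0.
set gj := partial j G z0 in jG; set rj := partial j r z0.
have gj2 : 0 < gj ^+ 2 by rewrite exprn_even_gt0//=; apply/eqP.
have den : 0 < 2 * (`|gj * rj| + 1) by rewrite mulr_gt0// ltr_wpDl.
(* The tilt t changes r by at most half of the gain ri. The eighths in eta below absorb the two
   linearisation errors made for each of r and G and keep both strict signs. *)
pose t := ri / (2 * (`|gj * rj| + 1)).
have t0 : 0 < t by rewrite divr_gt0.
have trj : t * `|gj * rj| <= ri / 2.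
  rewrite /t mulrAC ler_pdivrMr//.
  have -> : ri / 2 * (2 * (`|gj * rj| + 1)) = ri * (`|gj * rj| + 1) by field.
  by rewrite ler_pM2l// lerDl.
pose sg := - (t * gj).
pose eta := minr (ri / 8) (t * gj ^+ 2 / 8).
have eta0 : 0 < eta by rewrite lt_min !divr_gt0// mulr_gt0.
have eta1 : eta <= ri / 8 by rewrite ge_min lexx.
have eta2 : eta <= t * gj ^+ 2 / 8 by rewrite ge_min lexx orbT.
have ni := @nbhs_filter _ z0.
have [d1 d10 H1] := lin_near i s (@cvg_id _ (nbhs z0)) sr eta0.
have [d2 d20 H2] := lin_near i s (@cvg_id _ (nbhs z0)) sG eta0.
have [d3 d30 H3] := lin_near j sg (@cvg_id _ (nbhs z0)) sr eta0.
have [d4 d40 H4] := lin_near j sg (@cvg_id _ (nbhs z0)) sG eta0.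
have [d5 d50 H5] := line_near0 j sg (@cvg_id _ (nbhs z0)) H1.
have [d6 d60 H6] := line_near0 j sg (@cvg_id _ (nbhs z0)) H2.
have [d7 d70 H7] := line_near0 i s (@cvg_id _ (nbhs z0)) rG.
have [d8 d80 H8] := line_near0 j sg (@cvg_id _ (nbhs z0)) H7.
pose d := minr (minr (minr d1 d2) (minr d3 d4)) (minr (minr d5 d6) (minr d7 d8)).
have d0 : 0 < d by rewrite !lt_min d10 d20 d30 d40 d50 d60 d70 d80.
pose u := d / 2.
have u0 : 0 < u by rewrite divr_gt0.
have : u < d by rewrite ltr_pdivrMr// ltr_pMr// ltr1n.
rewrite !lt_min => /andP[/andP[/andP[u1 u2] /andP[u3 u4]] /andP[/andP[u5 u6] /andP[u7 u8]]].
have u0' := ltW u0.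
set y := line j sg (z0, u).
have := nbhs_singleton H5 u; rewrite u0' u5 => /(_ isT u); rewrite u0' u1 => /(_ isT).
have := nbhs_singleton H6 u; rewrite u0' u6 => /(_ isT u); rewrite u0' u2 => /(_ isT).
have := nbhs_singleton H3 u; rewrite u0' u3 => /(_ isT).
have := nbhs_singleton H4 u; rewrite u0' u4 => /(_ isT).
have := nbhs_singleton H8 u; rewrite u0' u8 => /(_ isT u); rewrite u0' u7 => /(_ isT).
rewrite -/y r0 G0 !subr0 !ler_norml -/gj -/rj.
have -> : s * u * partial i r z0 = ri * u by rewrite /ri; ring.
have -> : s * u * partial i G z0 = gi * u by rewrite /gi; ring.
have -> : sg * u * gj = - (t * gj ^+ 2) * u by rewrite /sg; ring.
have -> : sg * u * rj = - (t * (gj * rj)) * u by rewrite /sg; ring.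
move=> rGy /andP[h1 h2] /andP[h3 h4] /andP[h5 h6] /andP[h7 h8].
have e1 : eta * u <= ri / 8 * u by rewrite ler_pM2r.
have e2 : eta * u <= t * gj ^+ 2 / 8 * u by rewrite ler_pM2r.
have riu : 0 < ri * u by rewrite mulr_gt0.
have giu : gi * u <= 0 by rewrite pmulr_lle0.
have tgu : 0 < t * gj ^+ 2 * u := mulr_gt0 (mulr_gt0 t0 gj2) u0.
have tru : t * (gj * rj) * u <= ri / 2 * u.
  rewrite ler_pM2r//; apply: le_trans trj; rewrite ler_pM2l//; exact: ler_norm.
have : r (line i s (y, u)) < 0 by lra.
move=> /rGy; lra.
Qed.

End Lines.

Definition bdry_nbhs (R : realType) (m : nat) (T : topologicalType)
    (X : complex_manifold R m T) (e : chart X) (p : T) : set_system (model R m) :=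
  within [set z | chartr e z = 0] (nbhs (coord e p)).

#[global] Instance bdry_nbhs_filter (R : realType) (m : nat) (T : topologicalType)
  (X : complex_manifold R m T) (e : chart X) (p : T) : Filter (bdry_nbhs e p).
Proof. exact: within_filter. Qed.

#[global] Instance nbhs_bdry_nbhs_filter (R : realType) (m : nat) (T : topologicalType)
  (X : complex_manifold R m T) (e : chart X) (p : T) : Filter (nbhs (bdry_nbhs e p)) | 0.
Proof. exact: bdry_nbhs_filter. Qed.

Section Charts.
Context (R : realType) (m : nat) (T : topologicalType) (X : complex_manifold R m T).
Implicit Types (e : chart X) (p q : T).

Lemma bdry_nbhs_cvg e p : bdry_nbhs e p --> coord e p.
Proof. exact: cvg_within. Qed.

Lemma chart_image e z : chartW e z -> chartr e z <= 0 ->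
  dom e (coordV e z) /\ coord e (coordV e z) = z.
Proof.
move=> Wz rz; have : [set z | chartW e z /\ chartr e z <= 0] z by split.
by rewrite -coord_image => -[q dq <-]; rewrite coordK.
Qed.

Lemma image_chart e q : dom e q -> chartW e (coord e q) /\ chartr e (coord e q) <= 0.
Proof.
move=> dq; have : (coord e @` dom e) (coord e q) by exists q.
by rewrite coord_image.
Qed.

Lemma chartW_near e p : dom e p -> \forall z \near coord e p, chartW e z.
Proof. by move=> /image_chart[Wp _]; apply: open_nbhs_nbhs; split => //; exact: chartW_open. Qed.

Lemma chartV_near e p (Q : T -> Prop) : dom e p -> (\forall q \near p, Q q) ->
  \forall z \near coord e p, chartW e z -> chartr e z <= 0 -> Q (coordV e z).
Proof.
move=> dp Qp; have := @coordV_continuous _ _ _ X e.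
move=> /subspace_continuousP /(_ (coord e p)).
have : (coord e @` dom e) (coord e p) by exists p.
move=> h /(_ h) H.
have {}H : coordV e z @[z --> within (coord e @` dom e) (nbhs (coord e p))] --> coordV e (coord e p).
  exact: H.
rewrite coordK// in H; have := H _ Qp; rewrite coord_image => {}H.
near=> z => Wz rz; suff : [set z | chartW e z /\ chartr e z <= 0] z -> Q (coordV e z) by apply.
by near: z; exact: H.
Unshelve. all: by end_near. Qed.

Lemma chart_cvg e p : dom e p -> coord e q @[q --> p] --> coord e p.
Proof.
move=> dp; have := @coord_continuous _ _ _ X e.
by rewrite continuous_open_subspace; [apply; rewrite inE|exact: dom_open].
Qed.

Lemma insideE e z : chartW e z -> chartr e z <= 0 ->
  inside X (coordV e z) <-> chartr e z < 0.
Proof.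
move=> Wz rz; have [dz cz] := chart_image Wz rz.
rewrite /inside/= lt_neqAle rz andbT; split=> [nb|/eqP nr].
  by apply/eqP => r0; apply: nb; apply/(bdryE dz); rewrite cz.
by move/(bdryE dz); rewrite cz.
Qed.

Lemma chartr_smooth_at e p : dom e p -> smooth_at (chartr e) (coord e p).
Proof. by move=> /image_chart[Wp _]; exact: chartr_smooth. Qed.

Section Transversal.
Context (e : chart X) (p : T) (i : 'I_(m + m)) (s : R).
Hypotheses (bp : bdry X p) (dp : dom e p)
  (tr : 0 < s * partial i (chartr e) (coord e p)).
Notation small_bdry := (small R (bdry_nbhs e p)).

Lemma bdry_nbhs_r0 : \forall z \near bdry_nbhs e p, chartr e z = 0.
Proof. by rewrite near_withinE; near=> z. Unshelve. all: by end_near. Qed.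

Lemma chartr_line : exists2 C : R, 0 < C &
  \forall x \near small_bdry, x.2 / C <= - chartr e (line i s x) <= C * x.2.
Proof.
apply: (@defining_line _ _ i s _ (coord e p)) => //.
- exact: bdry_nbhs_cvg.
- exact: chartr_smooth_at.
- exact: bdry_nbhs_r0.
Qed.

Definition interior_chart_point z := [/\ chartW e z, chartr e z < 0,
  inside X (coordV e z), dom e (coordV e z) & coord e (coordV e z) = z].

Lemma line_interior : \forall x \near small_bdry, interior_chart_point (line i s x).
Proof.
have [C C0 rC] := chartr_line.
have HW := @line_near R _ i s _ _ (bdry_nbhs_filter e p) _ (@bdry_nbhs_cvg e p) (chartW_near dp).
near=> x.
have Wx : chartW e (line i s x) by near: x.
have rx : chartr e (line i s x) < 0.
  have /andP[h _] : x.2 / C <= - chartr e (line i s x) <= C * x.2 by near: x.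
  have x0 : 0 < x.2 by near: x; exact: small_gt0.
  have : 0 < x.2 / C by rewrite divr_gt0.
  lra.
have [dx cx] := chart_image Wx (ltW rx).
by split => //; apply/insideE => //; exact: ltW.
Unshelve. all: by end_near. Qed.

Lemma line_pull (Q : T -> Prop) : (\forall q \near p, Q q) ->
  \forall x \near small_bdry, Q (coordV e (line i s x)).
Proof.
move=> Qp; have H := @line_near R _ i s _ _ (bdry_nbhs_filter e p) _ (@bdry_nbhs_cvg e p) (chartV_near dp Qp).
near=> x.
have : chartW e (line i s x) -> chartr e (line i s x) <= 0 -> Q (coordV e (line i s x)) by near: x.
have [Wx rx _ _ _] : interior_chart_point (line i s x) by near: x; exact: line_interior.
by apply => //; exact: ltW.
Unshelve. all: by end_near. Qed.

Lemma smooth_rep_expands (phi : T -> R) G N : smooth_rep (coord e) p phi G ->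
  expands (bdry_nbhs e p) N (fun x => phi (coordV e (line i s x))).
Proof.
move=> [sG phiE].
have GE : expands (bdry_nbhs e p) N (fun x => G (line i s x)).
  have /expandsP[C HC] := smooth_expands i s N sG.
  apply/expandsP; exists C; exact: bdry_nbhs_cvg.
apply: eq_expands GE; near=> x.
have [_ _ _ _ cx] : interior_chart_point (line i s x) by near: x; exact: line_interior.
have -> : phi (coordV e (line i s x)) = G (coord e (coordV e (line i s x))).
  by near: x; exact: (line_pull phiE).
by rewrite cx.
Unshelve. all: by end_near. Qed.

(** [normal_sign] carries transversality over from [chartr] to rho, since rho < 0 on the inner side;
    the first-order estimate then applies to rho itself. *)
Lemma defining_rho_line (rho : model R m -> R) : smooth_at rho (coord e p) ->
  (\forall q \near p, (inside X q -> rho (coord e q) < 0) /\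
                         (bdry X q -> rho (coord e q) = 0)) ->
  (exists j, partial j rho (coord e p) <> 0) ->
  exists2 C : R, 0 < C &
    \forall x \near small_bdry, x.2 / C <= - rho (line i s x) <= C * x.2.
Proof.
move=> srho rhon rhoj.
have rp : chartr e (coord e p) = 0 by apply/(bdryE dp).
have Hn := chartV_near dp rhon.
have HW := chartW_near dp.
apply: (@defining_line _ _ i s _ (coord e p)) => //.
- exact: bdry_nbhs_cvg.
- apply: (@normal_sign _ _ i s (chartr e) _ _ (chartr_smooth_at dp) srho rp _ _ rhoj tr).
  + by have [_] := nbhs_singleton rhon; apply.
  + near=> z => rz.
    have Wz : chartW e z by near: z.
    have [dz cz] := chart_image Wz (ltW rz).
    have : chartW e z -> chartr e z <= 0 ->
      (inside X (coordV e z) -> rho (coord e (coordV e z)) < 0) /\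
      (bdry X (coordV e z) -> rho (coord e (coordV e z)) = 0) by near: z.
    move=> /(_ Wz (ltW rz))[+ _]; rewrite cz => /(_ _)/ltW; apply.
    by apply/insideE => //; exact: ltW.
- rewrite near_withinE; near=> z => rz.
  have rz0 : chartr e z <= 0 by rewrite rz.
  have Wz : chartW e z by near: z.
  have [dz cz] := chart_image Wz rz0.
  have : chartW e z -> chartr e z <= 0 ->
      (inside X (coordV e z) -> rho (coord e (coordV e z)) < 0) /\
      (bdry X (coordV e z) -> rho (coord e (coordV e z)) = 0) by near: z.
  move=> /(_ Wz rz0)[_]; rewrite cz; apply.
  by apply/(bdryE dz); rewrite cz.
Unshelve. all: by end_near. Qed.

Lemma defining_function_line (phi : T -> R) : defining_function X phi ->
  exists2 C : R, 0 < C &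
    \forall x \near small_bdry, x.2 / C <= - phi (coordV e (line i s x)) <= C * x.2.
Proof.
move=> [phiG phin phi0 dphi]; have [G GP] := phiG e p dp.
have [sG phiE] := GP.
have [|C C0 HC] := @defining_rho_line G sG _ (dphi e p G bp dp GP).
  near=> q; have qE : phi q = G (coord e q) by near: q.
  by rewrite -qE; split; [exact: phin|exact: phi0].
exists C => //; near=> x.
have [_ _ _ _ cx] : interior_chart_point (line i s x) by near: x; exact: line_interior.
have -> : phi (coordV e (line i s x)) = G (coord e (coordV e (line i s x))).
  by near: x; exact: (line_pull phiE).
by rewrite cx; near: x.
Unshelve. all: by end_near. Qed.

End Transversal.

End Charts.

(** * The volume density on transversal lines *)

Section Density.
Context (R : realType).

Lemma normC_le (a b : R) : `|(a +i* b)%C| <= (`|a| + `|b|)%:C%C :> R[i].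
Proof.
rewrite normc_def lecR /= -[leRHS]ger0_norm ?addr_ge0// -sqrtr_sqr.
rewrite ler_wsqrtr// sqrrD !real_normK ?num_real// lerD2r lerDl.
by rewrite mulrn_wge0// mulr_ge0.
Qed.

Lemma normC_real (a : R) : `|a%:C%C| = `|a|%:C%C :> R[i].
Proof. by rewrite normc_def /= expr0n/= addr0 sqrtr_sqr. Qed.

Context (m : nat).

Lemma smooth_at_near k (G : 'rV[R]_k -> R) z0 : smooth_at G z0 ->
  \forall z \near z0, smooth_at G z.
Proof. by move=> sG; exact: (near_join sG). Qed.

Lemma fin_ub (I : finType) (f : I -> R) : exists2 B : R, 0 < B & forall i, f i < B.
Proof.
have F0 : 0 <= \sum_i `|f i| by exact: sumr_ge0.
exists (\sum_i `|f i| + 1) => [|i]; first by rewrite ltr_wpDl.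
rewrite (le_lt_trans (ler_norm _))// (bigD1 i)//= -addrA ltrDl ltr_wpDl//.
exact: sumr_ge0.
Qed.

Lemma div_le (x : R[i]) (B t : R) : `|x| <= B%:C%C -> `|x / t%:C%C| <= (B / `|t|)%:C%C.
Proof.
move=> xB; rewrite normrM normfV normC_real rmorphM/= fmorphV/=.
by rewrite ler_wpM2r// invr_ge0 ler0c.
Qed.

Lemma div2_le (x y : R[i]) (B t : R) : `|x| <= B%:C%C -> `|y| <= B%:C%C ->
  `|x * y / t%:C%C ^+ 2| <= (B ^+ 2 / `|t| ^+ 2)%:C%C.
Proof.
move=> xB yB; rewrite -[t%:C%C ^+ 2]rmorphXn/= -[in leRHS]normrX.
apply: div_le; rewrite normrM expr2 rmorphM/=.
by rewrite ler_pM.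
Qed.

Lemma half_le (a b B : R) : `|a| <= B -> `|b| <= B -> `|a / 2| + `|b / 2| <= B.
Proof. by move=> ha hb; rewrite !normrM [`|2^-1|]ger0_norm//; lra. Qed.

Lemma quarter_le (a b c d B : R) : `|a| <= B -> `|b| <= B -> `|c| <= B -> `|d| <= B ->
  `|(a + b) / 4| + `|(c - d) / 4| <= B.
Proof.
move=> ha hb hc hd; rewrite !normrM [`|4^-1|]ger0_norm//.
have := ler_normD a b; have := ler_normB c d; lra.
Qed.

(** A crude size of order rho^(-2) for the metric, from bounds on the first and second partials of
    rho; [det_perturbation] asks for no more. *)
Lemma potential_metric_bound (rho : model R m -> R) (z0 : model R m) :
  smooth_at rho z0 -> exists2 B : R, 0 < B & \forall z \near z0, rho z < 0 ->
   forall j k, `|potential_metric rho z j k| <=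
     (B / `|rho z| + B ^+ 2 / `|rho z| ^+ 2)%:C%C.
Proof.
move=> srho.
have [B B0 B12] := fin_ub (fun o : 'I_(m + m) + 'I_(m + m) * 'I_(m + m) =>
  match o with
  | inl a => `|partial a rho z0|
  | inr ab => `|partial ab.1 (partial ab.2 rho) z0|
  end).
have B1 a : `|partial a rho z0| < B by exact: (B12 (inl a)).
have B2 a b : `|partial a (partial b rho) z0| < B by exact: (B12 (inr (a, b))).
have near1 a : \forall z \near z0, `|partial a rho z| <= B.
  have /(_ [:: a])[c1 _] := nbhs_singleton srho.
  apply: (cvgr_norm_le (partial a rho z0) c1).
  exact: B1.
have near2 a b : \forall z \near z0, `|partial a (partial b rho) z| <= B.
  have /(_ [:: a; b])[c1 _] := nbhs_singleton srho.
  apply: (cvgr_norm_le (partial a (partial b rho) z0) c1).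
  exact: B2.
have near1' : \forall z \near z0, forall a, `|partial a rho z| <= B.
  exact: (@filter_forall _ _ (fun a z => `|partial a rho z| <= B) _ _ near1).
have near2' : \forall z \near z0, forall a b, `|partial a (partial b rho) z| <= B.
  have near2a a : \forall z \near z0, forall b, `|partial a (partial b rho) z| <= B.
    exact: (@filter_forall _ _ (fun b z => `|partial a (partial b rho) z| <= B) _ _ (near2 a)).
  exact: (@filter_forall _ _ (fun a z => forall b, `|partial a (partial b rho) z| <= B) _ _ near2a).
have sn := smooth_at_near srho.
exists B => //; near=> z => rz j k.
have h1 : forall a, `|partial a rho z| <= B by near: z.
have h2 : forall a b, `|partial a (partial b rho) z| <= B by near: z.
have sz : smooth_at rho z by near: z.
have drr a b : derivable (partial a rho) z (delta_mx 0 b).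
  by have /(_ [:: a])[_] := nbhs_singleton sz; apply.
rewrite mxE dz_dzbar_ln// normrN.
have H1 : `|dz j (dzbar k (cfun rho)) z| <= B%:C%C.
  rewrite (dz_dzbarE j k drr) (le_trans (normC_le _ _))// lecR.
  exact: quarter_le.
have H2 : `|dz j (cfun rho) z| <= B%:C%C.
  rewrite (dzE rho) (le_trans (normC_le _ _))// lecR normrN.
  exact: half_le.
have H3 : `|dzbar k (cfun rho) z| <= B%:C%C.
  rewrite (dzbarE rho) (le_trans (normC_le _ _))// lecR.
  exact: half_le.
rewrite (le_trans (ler_normB _ _))// rmorphD/= lerD//; first exact: div_le.
exact: div2_le.
Unshelve. all: by end_near. Qed.

(* If A and B agree to order u^(2m) and have entries of size u^(-2), then their
   determinants differ by O(1). *)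
Lemma det_perturbation (M K : R) : exists C : R,
  forall (A B : 'M[R[i]]_m) (u : R), 0 < u < 1 ->
    (forall j k, `|A j k| <= (M / u ^+ 2)%:C%C) ->
    (forall j k, `|A j k - B j k| <= (K * u ^+ (2 * m))%:C%C) ->
    `|\det A - \det B| <= C%:C%C.
Proof.
pose M' : R := `|M| + `|K| + 1.
have M'1 : 1 <= (M'%:C%C : R[i]).
  by rewrite -[1]/(1%:C%C) lecR lerDr addr_ge0.
have [L L0 HL] := det_lipschitz m M'1.
exists (complex.Re L * `|K|) => A B u /andP[u0 u1] HA HAB.
have u2 : 0 < u ^+ 2 by rewrite exprn_gt0.
have um : 0 < u ^+ (2 * m) by rewrite exprn_gt0.
have uu : u ^+ (2 * m) <= 1 by rewrite exprn_ile1// ltW.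
have u22 : u ^+ 2 <= 1 by rewrite exprn_ile1// ltW.
(* Multiplication by u^2 makes the entries bounded. It multiplies the determinants by u^(2m), which
   the order of agreement u^(2m) pays for. *)
pose c : R[i] := (u ^+ 2)%:C%C.
have c0 : `|c| = (u ^+ 2)%:C%C by rewrite normC_real gtr0_norm.
have d0 : 0 <= (`|K| * u ^+ (2 * m))%:C%C :> R[i] by rewrite ler0c mulr_ge0// ltW.
have h1 : K * u ^+ (2 * m) <= `|K| * u ^+ (2 * m) by rewrite ler_pM2r// ler_norm.
have h2 : `|K| * u ^+ (2 * m) <= `|K| by rewrite ler_piMr.
have cA j k : `|(c *: A) j k| <= `|M|%:C%C.
  rewrite mxE normrM c0 (le_trans (ler_wpM2l _ (HA j k)))// ?ler0c ?(ltW u2)//.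
  rewrite -rmorphM lecR/= mulrCA divff ?gt_eqF// mulr1; exact: ler_norm.
have cAB j k : `|(c *: A) j k - (c *: B) j k| <= (`|K| * u ^+ (2 * m))%:C%C.
  have -> : (c *: A) j k - (c *: B) j k = c * (A j k - B j k) by rewrite !mxE; ring.
  rewrite normrM c0 (le_trans (ler_wpM2l _ (HAB j k)))// ?ler0c ?(ltW u2)//.
  rewrite -rmorphM lecR/= (le_trans (ler_wpM2l (ltW u2) h1))//.
  by rewrite ler_piMl// mulr_ge0// ltW.
have cAM j k : `|(c *: A) j k| <= M'%:C%C.
  by rewrite (le_trans (cA j k))// lecR /M' -addrA lerDl addr_ge0.
have cB j k : `|(c *: B) j k| <= M'%:C%C.
  have -> : (c *: B) j k = (c *: A) j k - ((c *: A) j k - (c *: B) j k) by ring.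
  rewrite (le_trans (ler_normB _ _))// (le_trans (lerD (cA j k) (cAB j k)))//.
  by rewrite -rmorphD lecR/= /M' -addrA lerD2l (le_trans h2)// lerDl.
have := HL _ _ _ d0 cAM cB cAB.
rewrite !detZ -mulrBr normrM normrX c0 -rmorphXn -exprM.
have -> : L = (complex.Re L)%:C%C by rewrite RRe_real// ger0_real.
have -> : (complex.Re L)%:C%C * (`|K| * u ^+ (2 * m))%:C%C =
    (u ^+ (2 * m))%:C%C * (complex.Re L * `|K|)%:C%C :> R[i].
  by rewrite -[LHS]rmorphM -[RHS]rmorphM; congr (_%:C%C); ring.
by rewrite ler_pM2l// ltcR.
Qed.

End Density.

Section DensityLine.
Context (R : realType).

Lemma expands_div (Z : Type) (F : set_system Z) {FF : Filter F} N (f : Z * R -> R) (C : R) :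
  expands F N.+1 f -> (\forall x \near small R F, `|f x| <= C * x.2) ->
  expands F N (fun x => f x / x.2).
Proof.
move=> fN fC; have [a [g [_ gN fE]]] := fN.
have [D gD] : exists D : R, \forall x \near small R F, `|g x| <= D.
  exact: (@expands_le _ _ _ _ N 0 g).
have /smallP[d d0 H] : \forall x \near small R F,
    [/\ `|f x| <= C * x.2, f x = a x.1 + x.2 * g x & `|g x| <= D].
  by near=> x; split; near: x.
(* f = O(u) forces the zeroth coefficient to vanish: |a z| <= u (|C| + |D| + 1) for arbitrarily
   small u. *)
have a0 : \forall z \near F, a z = 0.
  near=> z; have Hz : forall u, 0 < u < d ->
    [/\ `|f (z, u)| <= C * u, f (z, u) = a z + u * g (z, u) & `|g (z, u)| <= D] by near: z.
  apply/eqP; rewrite -normr_le0; apply/ler_addgt0Pr => eps eps0; rewrite add0r.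
  have CD : 0 < `|C| + `|D| + 1 by rewrite ltr_wpDl// addr_ge0.
  pose u := minr (d / 2) (eps / (`|C| + `|D| + 1)).
  have u0 : 0 < u by rewrite lt_min !divr_gt0.
  have ud : u < d by rewrite gt_min ltr_pdivrMr// ltr_pMr// ltr1n.
  have [|H1 H2 H3] := Hz u; first by rewrite u0.
  have -> : a z = f (z, u) - u * g (z, u) by rewrite H2 addrK.
  apply: (@le_trans _ _ (u * (`|C| + `|D| + 1))).
    rewrite (le_trans (ler_normB _ _))// normrM (gtr0_norm u0).
    have : u * `|g (z, u)| <= u * `|D| by rewrite ler_pM2l// (le_trans H3)// ler_norm.
    have : C * u <= `|C| * u by rewrite ler_pM2r// ler_norm.
    lra.
  by rewrite -ler_pdivlMr// ge_min lexx orbT.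
apply: eq_expands gN; near=> x.
have x0 : 0 < x.2 by near: x; exact: small_gt0.
have -> : f x = a x.1 + x.2 * g x by near: x.
have -> : a x.1 = 0 by near: x; exact: (@small_fst R Z F (fun z => a z = 0) a0).
by rewrite add0r mulrC mulKf// gt_eqF.
Unshelve. all: by end_near. Qed.

Context (T : topologicalType).

(** Along a line - rho = u a with a bounded below, so (- rho)^(-m-1) = b / u^(m+1) with b =
    a^(-m-1). Passing from [gplus] to g changes the determinant by O(1), as the two metrics agree to
    order 2m. *)
Lemma density_line_aux m (X : complex_manifold R m T) (gplus g : herm_field X)
    (e : chart X) (p : T) (i : 'I_(m + m)) (s : R) (N : nat) (rho : model R m -> R)
    (K K2 : R) :
  bdry X p -> dom e p -> 0 < s * partial i (chartr e) (coord e p) ->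
  local_defining_function e p rho ->
  (\forall q \near p, `|\det (fefferman_matrix rho (coord e q)) - (- 1)|
          <= (K * `|rho (coord e q)| ^+ m.+1)%:C%C) ->
  (\forall q \near p, inside X q -> forall j k,
        gplus e (coord e q) j k =
        - dz j (dzbar k (cfun (fun z => ln (- rho z)))) (coord e q)) ->
  (\forall q \near p, inside X q -> forall j k,
    `|g e (coord e q) j k - gplus e (coord e q) j k|
      <= (K2 * `|chartr e (coord e q)| ^+ (2 * m))%:C%C) ->
  exists (b : model R m * R -> R) (C : R), expands (bdry_nbhs e p) N b /\
    \forall x \near small R (bdry_nbhs e p),
     `|complex.Re (\det (g e (line i s x))) - b x / x.2 ^+ m.+1| <= C /\
     0 <= complex.Re (\det (g e (line i s x))).
Proof.
move=> bp dp tr [srho rhon rhoj] HK Hg HK2.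
have [C1 C10 H1] := defining_rho_line bp dp tr srho rhon rhoj.
have [C2 C20 H2] := chartr_line dp tr.
have HK' := line_pull dp tr HK.
have Hg' := line_pull dp tr Hg.
have HK2' := line_pull dp tr HK2.
have Hi := line_interior dp tr.
have Hsm := @line_near R _ i s _ _ (bdry_nbhs_filter e p) _ (@bdry_nbhs_cvg _ _ _ X e p) (smooth_at_near srho).
have [B B0 HB] := potential_metric_bound srho.
have HB' := @line_near R _ i s _ _ (bdry_nbhs_filter e p) _ (@bdry_nbhs_cvg _ _ _ X e p) HB.
clear HK Hg HK2 HB.
(* M uses 1 / |rho| <= C1 / u and u < 1; K3 uses |r| <= C2 u in the agreement of g with [gplus]. *)
pose M := B * C1 + B ^+ 2 * C1 ^+ 2.
pose K3 := `|K2| * C2 ^+ (2 * m).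
have [D HD] := @det_perturbation R m M K3.
pose a (x : model R m * R) := - rho (line i s x) / x.2.
have rho_small : \forall x \near small R (bdry_nbhs e p),
    0 < x.2 /\ x.2 / C1 <= - rho (line i s x) <= C1 * x.2.
  exact: filterI (@small_gt0 _ _ _ _) H1.
have aexp : expands (bdry_nbhs e p) N a.
  apply: (@expands_div _ _ _ _ _ C1).
    apply: expandsN.
    have /expandsP[C HC] := smooth_expands i s N.+1 srho.
    by apply/expandsP; exists C; exact: bdry_nbhs_cvg.
  apply: filterS rho_small => x [x0 /andP[h1 h2]].
  by rewrite ger0_norm// (le_trans _ h1)// divr_ge0// ltW.
have age : \forall x \near small R (bdry_nbhs e p), C1^-1 <= a x.
  apply: filterS rho_small => x [x0 /andP[h1 h2]].
  by rewrite /a ler_pdivlMr// mulrC.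
exists (fun x => (a x)^-1 ^+ m.+1), (D + K); split.
  by apply: expandsXn; apply: (@expandsV _ _ _ _ _ _ C1^-1) => //; rewrite invr_gt0.
have Hx1 : \forall x \near small R (bdry_nbhs e p), x.2 < 1 by exact: small_lt.
(* Y yields the sign of the density: for u < 1 / (C1 Y) one has 1 / (- rho) >= Y, and Y^(m+1) >= Y
   >= D + K, so the leading term dominates the error. *)
pose Y := `|D| + `|K| + 1.
have Y1 : 1 <= Y by rewrite lerDr addr_ge0.
have Y0 : 0 < Y by rewrite (lt_le_trans _ Y1).
have HxY : \forall x \near small R (bdry_nbhs e p), x.2 < (C1 * Y)^-1.
  by apply: small_lt; rewrite invr_gt0 mulr_gt0.
near=> x.
have xY : x.2 < (C1 * Y)^-1 by near: x.
have [x0 /andP[r1 r2]] : 0 < x.2 /\ x.2 / C1 <= - rho (line i s x) <= C1 * x.2 by near: x.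
have x1 : x.2 < 1 by near: x.
have /andP[_ cr2] : x.2 / C2 <= - chartr e (line i s x) <= C2 * x.2 by near: x.
have [_ cr0 ins _ cx] : interior_chart_point e (line i s x) by near: x.
have sx : smooth_at rho (line i s x) by near: x.
have KK : `|\det (fefferman_matrix rho (coord e (coordV e (line i s x)))) - (- 1)|
          <= (K * `|rho (coord e (coordV e (line i s x)))| ^+ m.+1)%:C%C by near: x.
have GG : inside X (coordV e (line i s x)) -> forall j k,
   gplus e (coord e (coordV e (line i s x))) j k =
   - dz j (dzbar k (cfun (fun z => ln (- rho z)))) (coord e (coordV e (line i s x))).
  by near: x.
have KK2 : inside X (coordV e (line i s x)) -> forall j k,
   `|g e (coord e (coordV e (line i s x))) j k - gplus e (coord e (coordV e (line i s x))) j k|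
      <= (K2 * `|chartr e (coord e (coordV e (line i s x)))| ^+ (2 * m))%:C%C.
  by near: x.
have BB : rho (line i s x) < 0 -> forall j k, `|potential_metric rho (line i s x) j k| <=
     (B / `|rho (line i s x)| + B ^+ 2 / `|rho (line i s x)| ^+ 2)%:C%C by near: x.
have xC1 : 0 < x.2 / C1 by rewrite divr_gt0.
have rneg : rho (line i s x) < 0 by lra.
move: KK GG KK2; rewrite cx => KK /(_ ins) GG /(_ ins) KK2.
have GE : gplus e (line i s x) = potential_metric rho (line i s x).
  by apply/matrixP => j k; rewrite GG mxE.
have D1 := det_potential_near rneg sx KK.
have D2 : `|\det (gplus e (line i s x)) - \det (g e (line i s x))| <= D%:C%C.
  apply: (HD _ _ x.2); first by rewrite x0.
    move=> j k; rewrite GE (le_trans (BB rneg j k))// lecR.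
    have ir : `|rho (line i s x)|^-1 <= C1 / x.2.
      by rewrite ltr0_norm// -[C1 / _]invrK invfM invrK mulrC lef_pV2 ?posrE ?oppr_gt0.
    have ir0 : 0 <= `|rho (line i s x)|^-1 by rewrite invr_ge0.
    rewrite /M mulrDl lerD//.
      rewrite -mulrA ler_pM2l// (le_trans ir)// ler_pM2l// lef_pV2 ?posrE ?exprn_gt0//.
      by rewrite expr2 ler_piMl// ltW.
    rewrite -mulrA ler_pM2l ?exprn_gt0// -!exprVn -exprMn lerXn2r// nnegrE//.
    by rewrite divr_ge0// ltW.
  move=> j k; rewrite distrC (le_trans (KK2 j k))// lecR.
  rewrite /K3 -mulrA -exprMn (le_trans (ler_wpM2r _ (ler_norm K2)))// ?exprn_ge0//.
  rewrite ler_wpM2l// lerXn2r ?nnegrE ?mulr_ge0 ?(ltW C20) ?(ltW x0)//.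
  by rewrite ltr0_norm.
have -> : (a x)^-1 ^+ m.+1 / x.2 ^+ m.+1 = (- rho (line i s x))^-1 ^+ m.+1.
  by rewrite -[_ / _]mulrC -exprVn -exprMn -invfM /a [x.2 * _]mulrC divfK ?gt_eqF.
set c := (- rho _)^-1 ^+ m.+1 in D1 *.
have : `|\det (g e (line i s x)) - c%:C%C| <= (D + K)%:C%C.
  have -> : \det (g e (line i s x)) - c%:C%C =
    (\det (potential_metric rho (line i s x)) - c%:C%C)
    - (\det (gplus e (line i s x)) - \det (g e (line i s x))) by rewrite GE; ring.
  rewrite (le_trans (ler_normB _ _))// rmorphD/= addrC lerD//.
move=> detc.
have {}detc : `|complex.Re (\det (g e (line i s x))) - c| <= D + K; last first.
  split => //; move: detc; rewrite ler_norml => /andP[+ _]; rewrite lerBrDl.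
  apply: le_trans; rewrite subr_ge0.
  apply: (@le_trans _ _ Y); first by rewrite /Y -addrA lerD ?ler_norm// (le_trans (ler_norm _))// lerDl.
  apply: (@le_trans _ _ (Y ^+ m.+1)); first by rewrite -[leLHS]expr1 ler_weXn2l.
  rewrite lerXn2r ?nnegrE ?(ltW Y0) ?invr_ge0 ?oppr_ge0 ?(ltW rneg)//.
  rewrite -[Y]invrK lef_pV2 ?posrE ?invr_gt0 ?oppr_gt0// (le_trans r2)//.
  by rewrite mulrC -ler_pdivlMr// -invfM mulrC ltW.
move: detc; rewrite -lecR; apply: le_trans.
have -> : complex.Re (\det (g e (line i s x))) - c = complex.Re (\det (g e (line i s x)) - c%:C%C).
  by rewrite ReD ReN.
exact: normc_ge_Re.
Unshelve. all: by end_near. Qed.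

Lemma density_line n (X : complex_manifold R n.+1 T) (gplus g : herm_field X)
    (e : chart X) (p : T) (i : 'I_(n.+1 + n.+1)) (s : R) (N : nat) :
  fefferman_metric gplus -> same_boundary_expansion g gplus ->
  bdry X p -> dom e p -> 0 < s * partial i (chartr e) (coord e p) ->
  exists (b : model R n.+1 * R -> R) (C : R), expands (bdry_nbhs e p) N b /\
    \forall x \near small R (bdry_nbhs e p),
     `|complex.Re (\det (g e (line i s x))) - b x / x.2 ^+ n.+2| <= C /\
     0 <= complex.Re (\det (g e (line i s x))).
Proof.
move=> [_ Hf] Hs bp dp tr.
have [rho [ldf [K HK] Hg]] := Hf e p bp dp.
have [K2 HK2] := Hs e p (2 * n.+1)%N bp dp.
exact: (density_line_aux N bp dp tr ldf HK Hg HK2).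
Qed.

End DensityLine.

(** * Uniformity on compact parts of the boundary *)

Lemma line_continuous (R : realType) k (i : 'I_k) (s : R) z (u : R) :
  {for u, continuous (fun t => line i s (z, t))}.
Proof.
rewrite /line /=.
have c3 : (s * t)%R @[t --> u] --> s * u by exact: (cvgM (cvg_cst s) cvg_id).
exact: (cvgB (cvg_cst z) (cvgZ c3 (cvg_cst (delta_mx 0 i : 'rV[R]_k)))).
Qed.

Section CompactBoundary.
Context (R : realType) (m : nat) (T : topologicalType) (X : complex_manifold R m T).
Implicit Types (e : chart X) (phi : T -> R).

Definition transversal e (p : T) (i : 'I_(m + m)) (s : R) : Prop :=
  [/\ bdry X p, dom e p & 0 < s * partial i (chartr e) (coord e p)].

(** A finite-order substitute for smoothness up to the boundary, asked only along transversal
    coordinate lines and stable under products with cutoffs of finite regularity. *)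
Definition expandable N phi : Prop := forall e p i s, transversal e p i s ->
  expands (bdry_nbhs e p) N (fun x => phi (coordV e (line i s x))).

(** The form in which d phi <> 0 is used; two such bounds with constants C1 and C2 survive convex
    combination with the larger constant. *)
Definition comparable_bdry phi : Prop := forall e p i s, transversal e p i s ->
  exists2 C : R, 0 < C & \forall x \near small R (bdry_nbhs e p),
    x.2 / C <= - phi (coordV e (line i s x)) <= C * x.2.

Definition chart_interior e : set (model R m) := [set z | chartW e z /\ chartr e z < 0].

Lemma chartr_continuous e z : chartW e z -> {for z, continuous (chartr e)}.
Proof. by move=> /chartr_smooth sr; have [] := nbhs_singleton sr [::]. Qed.

Lemma open_chart_interior e : open (chart_interior e).
Proof.
move=> z [Wz rz]; apply: filterI.
  by apply: open_nbhs_nbhs; split => //; exact: chartW_open.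
by apply: (cvgr_lt (chartr e z) (chartr_continuous Wz)).
Qed.

Lemma coordV_continuous_at e z : chart_interior e z -> {for z, continuous (coordV e)}.
Proof.
move=> Oz; have := @coordV_continuous _ _ _ X e.
move=> /subspace_continuousP /(_ z) H.
have zI : (coord e @` dom e) z by rewrite coord_image; case: Oz => Wz /ltW.
have {}H : coordV e y @[y --> within (coord e @` dom e) (nbhs z)] --> coordV e z.
  exact: H.
rewrite coord_image in H; move=> A /H HA.
have {}HA : \forall y \near z, chartW e y /\ chartr e y <= 0 -> A (coordV e y) by exact: HA.
have Hi : \forall y \near z, chart_interior e y by exact: open_chart_interior.
suff : \forall y \near z, A (coordV e y) by [].
near=> y; have [Wy ry] : chart_interior e y by near: y.
have : chartW e y /\ chartr e y <= 0 -> A (coordV e y) by near: y.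
by apply; split => //; exact: ltW.
Unshelve. all: by end_near. Qed.

Context (e : chart X) (i : 'I_(m + m)) (s : R) (K : set (model R m)).
Hypotheses (cK : compact K)
  (KP : forall z, K z -> [/\ chartW e z, chartr e z = 0 & 0 < s * partial i (chartr e) z]).

Lemma K_transversal z : K z -> transversal e (coordV e z) i s /\ coord e (coordV e z) = z.
Proof.
move=> /KP[Wz rz tz]; have rz0 : chartr e z <= 0 by rewrite rz.
have [dz cz] := chart_image Wz rz0.
by split => //; split; rewrite ?cz//; apply/(bdryE dz); rewrite cz.
Qed.

Lemma within_bdry z (P : set (model R m)) : K z ->
  bdry_nbhs e (coordV e z) P -> within K (nbhs z) P.
Proof.
move=> Kz; have [_ cz] := K_transversal Kz.
rewrite /bdry_nbhs cz /within/= => HP; near=> y => Ky.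
have : chartr e y = 0 -> P y by near: y.
by apply; have [] := KP Ky.
Unshelve. all: by end_near. Qed.

Lemma small_mono (F G : set_system (model R m)) (P : model R m * R -> Prop) :
  (forall Q : set (model R m), F Q -> G Q) ->
  (\forall x \near small R F, P x) -> \forall x \near small R G, P x.
Proof. by move=> FG [[A B] /= [FA hB] AB]; exists (A, B) => //; split => //; exact: FG. Qed.

Lemma expandable_compact N phi : expandable N phi ->
  expands (globally K) N (fun x => phi (coordV e (line i s x))).
Proof.
move=> phiN; apply: expands_compact => // z Kz.
have [tz _] := K_transversal Kz.
have /expandsP[C HC] := phiN _ _ _ _ tz.
by apply/expandsP; exists C; exact: within_bdry.
Qed.

Lemma comparable_compact phi : comparable_bdry phi ->
  exists2 C : R, 0 < C & \forall x \near small R (globally K),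
    x.2 / C <= - phi (coordV e (line i s x)) <= C * x.2.
Proof.
move=> phiC.
(* The guards [0 < C] and [0 < x.2] make the two-sided estimate monotone in C. *)
have [|z Kz|C HC] := @small_compact R _ K (fun C x => 0 < C /\
    (0 < x.2 -> x.2 / C <= - phi (coordV e (line i s x)) <= C * x.2)) _ cK.
- move=> C D x CD [C0 H]; split; first exact: lt_le_trans CD.
  move=> x0; have /andP[h1 h2] := H x0; apply/andP; split.
    apply: le_trans h1; rewrite ler_pM2l// lef_pV2 ?posrE//; exact: lt_le_trans CD.
  by apply: (le_trans h2); rewrite ler_pM2r.
- have [tz _] := K_transversal Kz.
  have [C C0 HC] := phiC _ _ _ _ tz; exists C.
  apply: (small_mono (fun Q h => within_bdry Kz h)).
  by apply: filterS HC => x H; split.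
have [K0|K0] := pselect (K !=set0); last first.
  exists 1 => //; apply/smallP; exists 1 => // z Kz; exfalso; apply: K0; by exists z.
have /smallP[d d0 Hd] := HC.
have [z0 Kz0] := K0.
have hd : 0 < d / 2 < d by rewrite divr_gt0//= ltr_pdivrMr// ltr_pMr// ltr1n.
have [C0 _] := Hd z0 Kz0 (d / 2) hd.
exists C => //; apply/smallP; exists d => // z Kz u ud.
by have [_] := Hd z Kz u ud; apply; case/andP: ud.
Qed.

Lemma interior_compact :
  \forall x \near small R (globally K), interior_chart_point e (line i s x).
Proof.
have [|z Kz|C HC] := @small_compact R _ K (fun C x => interior_chart_point e (line i s x)) _ cK.
- by [].
- have [[bz dz tz] _] := K_transversal Kz.
  exists 0; apply: (small_mono (fun Q h => within_bdry Kz h)); exact: line_interior.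
exact: HC.
Qed.

(** Joins the expansions near the points of K into one family of coefficients. [taylor_bound] states
    them for one z at a time, so [compact_near] gives a common constant; the family is then chosen
    pointwise and is only known to be bounded. *)
Lemma density_compact (w : model R m -> R) (N : nat) :
  (forall p, transversal e p i s -> exists (b : model R m * R -> R) (C : R),
    expands (bdry_nbhs e p) N b /\
    \forall x \near small R (bdry_nbhs e p),
     `|w (line i s x) - b x / x.2 ^+ N| <= C /\ 0 <= w (line i s x)) ->
  exists (b : model R m -> nat -> R) (C : R), (forall z, K z -> forall k, `|b z k| <= C) /\
    \forall x \near small R (globally K),
      `|w (line i s x) - \sum_(k < N) b x.1 k * x.2 ^+ k / x.2 ^+ N| <= C /\
      0 <= w (line i s x).
Proof.
move=> Hw.
pose Q (C : R) z (c : nat -> R) := (forall k, `|c k| <= C) /\ forall u, 0 < u -> u * C < 1 ->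
   `|w (line i s (z, u)) - \sum_(k < N) c k * u ^+ k / u ^+ N| <= C /\
   0 <= w (line i s (z, u)).
have [|z Kz|C HC] := @compact_near R _ K (fun C z => 0 < C /\ exists c, Q C z c) _ cK.
- move=> C D z CD [C0 [c [cC cw]]]; split; first exact: lt_le_trans CD.
  exists c; split=> [k|u u0 uD]; first exact: le_trans CD.
  have [|h1 h2] := cw u u0; first by rewrite (le_lt_trans _ uD)// ler_wpM2l// ltW.
  by split => //; exact: le_trans CD.
- have [tz _] := K_transversal Kz.
  have [b [C [/expandsP[D HD] /smallP[d d0 Hd]]]] := Hw _ tz.
  exists (maxr (`|C| + `|D| + 1) d^-1); apply: (within_bdry Kz).
  near=> y; split; first by rewrite lt_max ltr_wpDl// addr_ge0.
  have [c [cD cb]] : taylor_bound N D (fun u => b (y, u)) by near: y.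
  have Hy : forall u, 0 < u < d -> `|w (line i s (y, u)) - b (y, u) / u ^+ N| <= C /\
     0 <= w (line i s (y, u)) by near: y.
  have D1 : D <= `|C| + `|D| + 1.
    by rewrite (le_trans (ler_norm D))// -addrA addrCA lerDl addr_ge0.
  exists c; split=> [k|u u0 uC].
    by rewrite (le_trans (cD k))// le_max D1.
  have [|h1 h2] := Hy u.
    by rewrite u0 (lt_of_mul_lt1 d0 _ u0 uC)// le_max lexx orbT.
  split => //.
  have uN : 0 < u ^+ N by rewrite exprn_gt0.
  have uD : u * D < 1.
    by rewrite (le_lt_trans _ uC)// ler_pM2l// (le_trans D1)// le_max lexx.
  have cbu := cb u u0 uD.
  have -> : w (line i s (y, u)) - \sum_(k < N) c k * u ^+ k / u ^+ N =
    (w (line i s (y, u)) - b (y, u) / u ^+ N)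
     + (b (y, u) - \sum_(k < N) c k * u ^+ k) / u ^+ N.
    by rewrite -mulr_suml mulrBl; ring.
  rewrite (le_trans (ler_normD _ _))// normrM normfV (gtr0_norm uN).
  have h3 : `|b (y, u) - \sum_(k < N) c k * u ^+ k| / u ^+ N <= D.
    by rewrite ler_pdivrMr.
  rewrite le_max; apply/orP; left; rewrite -[leLHS]addr0 lerD// lerD//.
    by rewrite (le_trans h1)// ler_norm.
  by rewrite (le_trans h3)// ler_norm.
have [K0|K0] := pselect (K !=set0); last first.
  exists (fun _ _ => 0), 0; split=> [z Kz|]; first by exfalso; apply: K0; exists z.
  by apply/smallP; exists 1 => // z Kz; exfalso; apply: K0; exists z.
have [z0 /HC[C0 _]] := K0.
pose c z := xget (fun=> 0) [set c : nat -> R | Q C z c].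
have cQ z : K z -> Q C z (c z).
  move=> /HC[_ ex]; exact: (@xgetPex _ (fun=> 0) [set c : nat -> R | Q C z c] ex).
exists c, C; split; first by move=> z /cQ[].
apply/smallP; exists C^-1; first by rewrite invr_gt0.
move=> z /cQ[_ H] u /andP[u0 uC]; apply: H => //.
by rewrite -ltr_pdivlMr// mul1r.
Unshelve. all: by end_near. Qed.

End CompactBoundary.

Section SuperlevelUniform.
Context (R : realType) (m : nat) (T : topologicalType) (X : complex_manifold R m T).
Notation mu := (@lebesgue_measure R).

Lemma laurent_sum_continuous (r M : nat) (c : nat -> R) (u : R) : 0 < u ->
  {for u, continuous (fun t : R => \sum_(k < r) c k * t ^+ k / t ^+ M.+1)}.
Proof.
move=> u0; elim: r => [|r IH].
  have -> : (fun t : R => \sum_(k < 0) c k * t ^+ k / t ^+ M.+1) = fun=> 0.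
    by apply/funext => t; rewrite big_ord0.
  exact: cvg_cst.
have -> : (fun t : R => \sum_(k < r.+1) c k * t ^+ k / t ^+ M.+1) =
    (fun t => \sum_(k < r) c k * t ^+ k / t ^+ M.+1 + c r * t ^+ r / t ^+ M.+1).
  by apply/funext => t; rewrite big_ord_recr.
apply: cvgD; first exact: IH.
apply: cvgM; first by apply: cvgM; [exact: cvg_cst|exact: exprn_continuous].
by apply: cvgV; [rewrite expf_neq0// gt_eqF|exact: exprn_continuous].
Qed.

Lemma laurent_prim_bound (N : nat) (h C : R) : exists D : R, forall c : nat -> R,
  (forall k, `|c k| <= C) -> `|laurent_prim N c h| <= D.
Proof.
exists (\sum_(k < N) C * `|(N - k)%:R^-1 * h^-1 ^+ (N - k)| + C * `|ln h|) => c cC.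
rewrite /laurent_prim (le_trans (ler_normD _ _))// lerD//; last first.
  by rewrite normrM ler_wpM2r.
rewrite (le_trans (ler_norm_sum _ _ _))// ler_sum// => k _.
by rewrite mulNr normrN -mulrA normrM ler_wpM2r.
Qed.

Context (e : chart X) (i : 'I_(m + m)) (s : R) (K : set (model R m)).
Hypotheses (cK : compact K)
  (KP : forall z, K z -> [/\ chartW e z, chartr e z = 0 & 0 < s * partial i (chartr e) z]).
Context (w : model R m -> R) (N : nat) (b : model R m -> nat -> R) (Cb : R).
Hypotheses (cw : forall z, chart_interior e z -> {for z, continuous w})
  (bC : forall z, K z -> forall k, `|b z k| <= Cb)
  (wb : \forall x \near small R (globally K),
      `|w (line i s x) - \sum_(k < N.+1) b x.1 k * x.2 ^+ k / x.2 ^+ N.+1| <= Cb /\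
      0 <= w (line i s x)).

(** [superlevel_integral] on all lines over K with common constants. The coefficient [b z N] of ln
    eps comes from the density w alone; [phi] influences only d and the bounds. *)
Lemma superlevel_uniform (phi : T -> R) : expandable X N.+1 phi -> comparable_bdry X phi ->
  continuous phi ->
  exists2 h0 : R, 0 < h0 & forall h, 0 < h < h0 -> exists (C e0 : R), 0 < e0 /\
    forall z, K z -> exists d : nat -> R, forall eps, 0 < eps < e0 -> exists I : R,
      (\int[mu]_(u in [set u | (0 < u < h)%R /\ (eps < - phi (coordV e (line i s (z, u))))%R])
         (w (line i s (z, u)))%:E = I%:E)%E /\
      `|I + (\sum_(j < N) d j / eps ^+ j.+1 + b z N * ln eps)| <= C.
Proof.
move=> phiN phic cphi.
have [C1 C10 H1] := comparable_compact cK KP phic.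
have phiexp := expandable_compact cK KP phiN.
pose a (x : model R m * R) := - phi (coordV e (line i s x)) / x.2.
have aexp : expands (globally K) N a.
  apply: (@expands_div _ _ _ _ _ _ C1); first exact: expandsN.
  near=> x; have x0 : 0 < x.2 by near: x; exact: small_gt0.
  have /andP[h1 h2] : x.2 / C1 <= - phi (coordV e (line i s x)) <= C1 * x.2 by near: x.
  by rewrite ger0_norm// (le_trans _ h1)// divr_ge0// ltW.
have age : \forall x \near small R (globally K), C1^-1 <= a x.
  near=> x; have x0 : 0 < x.2 by near: x; exact: small_gt0.
  have /andP[h1 h2] : x.2 / C1 <= - phi (coordV e (line i s x)) <= C1 * x.2 by near: x.
  by rewrite /a ler_pdivlMr// mulrC.
have bK : \forall z \near globally K, forall k, `|b z k| <= Cb by exact: bC.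
have C1i : 0 < C1^-1 by rewrite invr_gt0.
have [d [C2 H2]] := laurent_prim_expands C1i age aexp bK.
have Hi := interior_compact cK KP.
have /smallP[dl dl0 Hdl] : \forall x \near small R (globally K),
  [/\ x.2 / C1 <= - phi (coordV e (line i s x)) <= C1 * x.2,
     `|laurent_prim N (b x.1) x.2
      - (\sum_(j < N) d j x.1 / (x.2 * a x) ^+ j.+1 + b x.1 N * ln (x.2 * a x))| <= C2,
     chart_interior e (line i s x),
     `|w (line i s x) - \sum_(k < N.+1) b x.1 k * x.2 ^+ k / x.2 ^+ N.+1| <= Cb &
      0 <= w (line i s x)].
  near=> x.
  have [wx1 wx2] : `|w (line i s x) - \sum_(k < N.+1) b x.1 k * x.2 ^+ k / x.2 ^+ N.+1| <= Cb /\
      0 <= w (line i s x) by near: x.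
  have [Wx rx _ _ _] : interior_chart_point e (line i s x) by near: x.
  by split => //; near: x.
exists dl => // h /andP[h0 hdl].
have [D HD] := laurent_prim_bound N h Cb.
pose C := maxr (maxr C1 C2) (maxr Cb D).
have C0 : 0 < C by rewrite !lt_max C10.
exists ((2 + h) * C), (h / (2 * C)); split; first by rewrite divr_gt0// mulr_gt0.
move=> z Kz; exists (fun j => d j z) => eps /andP[eps0 epsh].
have Hz := Hdl z Kz.
have Hint u : 0 < u < dl -> chart_interior e (line i s (z, u)) by move=> /Hz[].
have cwl u : 0 < u < dl -> {for u, continuous (fun t => w (line i s (z, t)))}.
  move=> u0; apply: (@continuous_comp _ _ _ (fun t => line i s (z, t)) w).
    exact: line_continuous.
  by apply: cw; exact: Hint.
apply: (@superlevel_integral R dl C h eps (fun u => w (line i s (z, u)))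
  (fun u => \sum_(k < N.+1) b z k * u ^+ k / u ^+ N.+1) (laurent_prim N (b z))
  (fun t => \sum_(j < N) d j z / t ^+ j.+1 + b z N * ln t)
  (fun u => - phi (coordV e (line i s (z, u))))) => //.
- apply: open_continuous_measurable_fun; first exact: itv_open.
  by move=> u; rewrite inE/= in_itv/=; exact: cwl.
- by move=> u /Hz[].
- move=> u /Hz[_ _ _ h1 _]; rewrite (le_trans h1)//.
  by rewrite /C !le_max lexx !orbT.
- by move=> u /andP[u0 _]; exact: laurent_sum_continuous.
- by move=> u /andP[u0 _]; exact: is_derive_laurent_prim.
- move=> u u0; apply: cvgN.
  apply: (@continuous_comp _ _ _ (fun t => coordV e (line i s (z, t))) phi); last exact: cphi.
  apply: (@continuous_comp _ _ _ (fun t => line i s (z, t)) (coordV e)).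
    exact: line_continuous.
  by apply: coordV_continuous_at; exact: Hint.
- move=> u u0d; have [/andP[h1 h2] _ _ _ _] := Hz u u0d; case/andP: u0d => u0 ud.
  apply/andP; split.
    rewrite (le_trans _ h1)// ler_pM2l// lef_pV2 ?posrE// /C !le_max lexx//.
  by rewrite (le_trans h2)// ler_pM2r// /C !le_max lexx.
- move=> u u0d; have [_ h1 _ _ _] := Hz u u0d; case/andP: u0d => u0 ud.
  have -> : - phi (coordV e (line i s (z, u))) = u * a (z, u).
    by rewrite /a /= mulrC divfK// gt_eqF.
  by rewrite (le_trans h1)// /C !le_max lexx !orbT.
- by rewrite (le_trans (HD _ (bC Kz)))// /C !le_max lexx !orbT.
Unshelve. all: by end_near. Qed.

End SuperlevelUniform.

(** * The change of volume in one chart *)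

Section CrossingBox.
Context (R : realType).

Lemma compact_preimage (V : topologicalType) (B : set V) (f : V -> R) (A : set R) :
  hausdorff_space V -> compact B -> closed A ->
  (forall x, B x -> {for x, continuous f}) -> compact (B `&` f @^-1` A).
Proof.
move=> hV cB cA cf; apply: (@subclosed_compact _ _ B) => //.
move=> x clx; have Bx : B x.
  by apply: (compact_closed hV cB) => N /clx[y [[By _] Ny]]; exists y.
split => //; apply: cA => N Nfx.
have /clx[y [[_ Ay] Ny]] : nbhs x (f @^-1` N) by exact: cf.
by exists (f y).
Qed.

Lemma box_compact k (p : 'rV[R]_k) (d : R) : compact (box p d).
Proof.
have -> : box p d = [set v | forall i, `[p 0 i - d, p 0 i + d]%classic (v ord0 i)].
  by apply/seteqP; split => v H i; have := H i; rewrite /= in_itv/= -ler_distl.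
exact: (@rV_compact R k (fun i => `[p 0 i - d, p 0 i + d]%classic) (fun i => @segment_compact R _ _)).
Qed.

Lemma nbhs_box k (z : 'rV[R]_k) (P : set 'rV[R]_k) : nbhs z P ->
  exists2 d : R, 0 < d & box z d `<=` P.
Proof.
move=> /nbhs_ballP[d /= d0 dP]; exists (d / 2); first by rewrite divr_gt0.
move=> y yb; apply: dP; split => // i j; rewrite ord1 -ball_normE/= distrC.
by rewrite (le_lt_trans (yb j))// ltr_pdivrMr// ltr_pMr// ltr1n.
Qed.

Lemma lineE k (i : 'I_k) (s u : R) (y : 'rV[R]_k) j :
  line i s (y, u) 0 j = y 0 j - s * u * (j == i)%:R.
Proof. by rewrite /line !mxE eqxx. Qed.

Lemma insert_line k (i : 'I_k.+1) (s t0 u : R) (v : 'rV[R]_k) :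
  insert_rV i (t0 - s * u) v = line i s (insert_rV i t0 v, u).
Proof.
apply/rowP => j; rewrite lineE; have [l ->|->] := unliftP i j.
  by rewrite !insert_rV_lift eq_sym (negbTE (neq_lift i l)) mulr0 subr0.
by rewrite !insert_rV_eq eqxx mulr1.
Qed.

Lemma insert_line0 k (i : 'I_k.+1) (t : R) (v : 'rV[R]_k) :
  insert_rV i t v = line i (-1) (insert_rV i 0 v, t).
Proof. by rewrite -insert_line mulN1r opprK add0r. Qed.

Lemma box_insert k (i : 'I_k.+1) (t : R) (v : 'rV[R]_k) (p : 'rV[R]_k.+1) d :
  box p d (insert_rV i t v) <->
  `|t - p 0 i| <= d /\ forall l, `|v 0 l - p 0 (lift i l)| <= d.
Proof.
split=> [H|[H1 H2] j].
  split; first by have := H i; rewrite insert_rV_eq.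
  by move=> l; have := H (lift i l); rewrite insert_rV_lift.
by have [l ->|->] := unliftP i j; rewrite ?insert_rV_lift ?insert_rV_eq.
Qed.

(** s (t0 - t) is the depth u below the boundary in the parametrisation by [line]: inside the box r
    falls at least at rate c with the depth, and it is nonnegative on the other side. *)
Definition crosses_at k (i : 'I_k.+1) (s : R) (r : 'rV[R]_k.+1 -> R)
    (z0 : 'rV[R]_k.+1) (d c : R) (v : 'rV[R]_k) (t0 : R) : Prop :=
  forall t, box z0 d (insert_rV i t v) ->
    (0 <= s * (t0 - t) -> r (insert_rV i t v) <= - (c * (s * (t0 - t)))) /\
    (s * (t0 - t) <= 0 -> 0 <= r (insert_rV i t v)).

(* The crossing point of a line that meets the box may lie outside the box. *)
Lemma crossing_box k (i : 'I_k.+1) (s : R) (r : 'rV[R]_k.+1 -> R)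
    (W : set 'rV[R]_k.+1) (z0 : 'rV[R]_k.+1) :
  s = 1 \/ s = -1 -> open W -> (forall z, W z -> smooth_at r z) ->
  W z0 -> r z0 = 0 -> 0 < s * partial i r z0 ->
  exists (d c : R) (K : set 'rV[R]_k.+1), [/\ 0 < d /\ 0 < c, box z0 d `<=` W,
    compact K, (forall z, K z -> [/\ W z, r z = 0 & 0 < s * partial i r z]) &
    forall v, (exists t, box z0 d (insert_rV i t v)) ->
      exists t0, K (insert_rV i t0 v) /\ crosses_at i s r z0 d c v t0].
Proof.
move=> s1 oW sW Wz0 r0 tr; set c := s * partial i r z0 / 2.
have c0 : 0 < c by rewrite divr_gt0.
have s2 : s * s = 1 by case: s1 => ->; ring.
have ns : `|s| = 1 by case: s1 => ->; rewrite ?normrN normr1.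
have Hnear : \forall z \near z0, W z /\ c < s * partial i r z.
  have cp : {for z0, continuous (fun z => s * partial i r z)}.
    have /(_ [:: i])[cp _] := nbhs_singleton (sW z0 Wz0).
    exact: (cvgM (cvg_cst s) cp).
  near=> z; split; near: z.
    exact: open_nbhs_nbhs.
  apply: (cvgr_gt (s * partial i r z0) cp).
  by rewrite /c ltr_pdivrMr// ltr_pMr// ltr1n.
have [d1 d10 Hd1] := nbhs_box Hnear.
have cr z : W z -> {for z, continuous r} by move=> /sW/nbhs_singleton/(_ [::])[].
have mono v t t' : box z0 d1 (insert_rV i t v) -> box z0 d1 (insert_rV i t' v) ->
    r (insert_rV i t' v) = 0 ->
    (0 <= s * (t' - t) -> r (insert_rV i t v) <= - (c * (s * (t' - t)))) /\
    (s * (t' - t) <= 0 -> - (c * (s * (t' - t))) <= r (insert_rV i t v)).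
  move=> /box_insert[bt bv] /box_insert[bt' _] rt'.
  have inb x : minr t t' <= x <= maxr t t' -> box z0 d1 (insert_rV i x v).
    move=> /andP[x1 x2]; apply/box_insert; split => //.
    move: bt bt' x1 x2; rewrite !ler_distl ge_min le_max.
    move=> /andP[? ?] /andP[? ?] /orP[?|?] /orP[?|?]; apply/andP; split; lra.
  have dr x : minr t t' <= x <= maxr t t' ->
      is_derive x 1 (fun t => r (insert_rV i t v)) (partial i r (insert_rV i x v)).
    move=> /inb/Hd1[Wx _].
    have dd : derivable r (line i (-1) (insert_rV i 0 v, x)) (delta_mx 0 i).
      by rewrite -insert_line0; have [_ ] := nbhs_singleton (sW _ Wx) [::]; apply.
    have := line_derive dd; rewrite opprK mul1r -insert_line0.
    by congr is_derive; apply/funext => t1; rewrite -insert_line0.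
  have [ptt'|[x xI xE]] : t = t' \/ exists2 x, minr t t' <= x <= maxr t t' &
     r (insert_rV i t v) = partial i r (insert_rV i x v) * (t - t').
    have MM a b : a < b -> minr t t' = a -> maxr t t' = b -> exists2 x, minr t t' <= x <= maxr t t' &
        r (insert_rV i b v) - r (insert_rV i a v) = partial i r (insert_rV i x v) * (b - a).
      move=> ab ma mb.
      have [x||x xab ->] := @MVT R (fun t => r (insert_rV i t v))
         (fun x => partial i r (insert_rV i x v)) a b ab.
      - by rewrite in_itv/= => /andP[ax xb]; apply: dr; rewrite ma mb !ltW.
      - apply: derivable_within_continuous => x; rewrite in_itv/= => /andP[ax xb].
        by have [] := dr x; rewrite ?ma ?mb ?ax.
      - move: xab; rewrite in_itv/= => /andP[ax xb].
        by exists x => //; rewrite ma mb !ltW.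
    have [->|/lt_total/orP[tt'|tt']] := eqVneq t t'; first by left.
    - right; have [||x xI] := MM t t' tt'.
      + by rewrite min_l ?ltW.
      + by rewrite max_r ?ltW.
      + rewrite rt' sub0r => E; exists x; first exact: xI.
        by rewrite -[LHS]opprK E; ring.
    - right; have [||x xI] := MM t' t tt'.
      + by rewrite min_r ?ltW.
      + by rewrite max_l ?ltW.
      + by rewrite rt' subr0 => E; exists x; [exact: xI|exact: E].
  - by rewrite ptt' rt' subrr mulr0 mulr0 oppr0.
  have [_ px] := Hd1 _ (inb x xI).
  have -> : r (insert_rV i t v) = - ((s * partial i r (insert_rV i x v)) * (s * (t' - t))).
    by rewrite xE -[in LHS](mul1r (partial _ _ _)) -s2; ring.
  split=> h; first by rewrite lerN2 ler_wpM2r// ltW.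
  by rewrite lerN2 ler_wnM2r// ltW.
(* On the line through z0, r has opposite strict signs at the parameters z0_i - s tau and z0_i + s
   tau. A small d below preserves both signs on every line that meets the box, and the intermediate
   value theorem gives the crossing. *)
pose tau := d1 / 2.
have tau0 : 0 < tau by rewrite divr_gt0.
have taud : tau <= d1 by rewrite ler_pdivrMr// ler_pMr// ler1n.
pose v0 : 'rV[R]_k := \row_l z0 0 (lift i l).
have z0E : z0 = insert_rV i (z0 0 i) v0.
  apply/rowP => j; have [l ->|->] := unliftP i j.
    by rewrite insert_rV_lift mxE.
  by rewrite insert_rV_eq.
have bz t : `|t - z0 0 i| <= d1 -> box z0 d1 (insert_rV i t v0).
  move=> h; apply/box_insert; split => // l; rewrite mxE subrr normr0; exact: ltW.
have rm : r (insert_rV i (z0 0 i - s * tau) v0) < 0.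
  have [||//|+ _] := mono v0 (z0 0 i - s * tau) (z0 0 i).
  - by apply: bz; rewrite addrAC subrr add0r normrN normrM ns mul1r gtr0_norm.
  - by rewrite -z0E => l; rewrite subrr normr0 ltW.
  - by rewrite -z0E.
  have -> : s * (z0 0 i - (z0 0 i - s * tau)) = tau by rewrite -[RHS]mul1r -s2; ring.
  by move=> /(_ (ltW tau0)) h; rewrite (le_lt_trans h)// oppr_lt0 mulr_gt0.
have rp : 0 < r (insert_rV i (z0 0 i + s * tau) v0).
  have [||//|_ +] := mono v0 (z0 0 i + s * tau) (z0 0 i).
  - by apply: bz; rewrite addrAC subrr add0r normrM ns mul1r gtr0_norm.
  - by rewrite -z0E => l; rewrite subrr normr0 ltW.
  - by rewrite -z0E.
  have -> : s * (z0 0 i - (z0 0 i + s * tau)) = - tau by rewrite -[tau in RHS]mul1r -s2; ring.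
  rewrite oppr_le0 (ltW tau0) mulrN opprK => /(_ isT); apply: lt_le_trans.
  by rewrite mulr_gt0.
have Wm : W (insert_rV i (z0 0 i - s * tau) v0).
  have /bz/Hd1[] // : `|z0 0 i - s * tau - z0 0 i| <= d1.
  by rewrite addrAC subrr add0r normrN normrM ns mul1r gtr0_norm.
have Wp : W (insert_rV i (z0 0 i + s * tau) v0).
  have /bz/Hd1[] // : `|z0 0 i + s * tau - z0 0 i| <= d1.
  by rewrite addrAC subrr add0r normrM ns mul1r gtr0_norm.
have [dm dm0 Hdm] := nbhs_box (cvgr_lt _ (cr _ Wm) _ rm).
have [dp dp0 Hdp] := nbhs_box (cvgr_gt _ (cr _ Wp) _ rp).
pose d := minr tau (minr dm dp).
have d0 : 0 < d by rewrite !lt_min tau0 dm0 dp0.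
have ddm : d <= dm by rewrite !ge_min lexx !orbT.
have ddp : d <= dp by rewrite !ge_min lexx !orbT.
have dd1 : d <= d1 by rewrite (le_trans _ taud)// ge_min lexx.
have boxle z : box z0 d z -> box z0 d1 z by move=> H j; rewrite (le_trans (H j)).
(* The crossing is only known to lie within tau of z0_i, hence in the larger box of radius d1; K is
   cut from that box. *)
exists d, c, (box z0 d1 `&` r @^-1` [set 0]); split => //.
- by move=> z /boxle/Hd1[].
- apply: compact_preimage => //; first exact: box_compact.
  by move=> z /Hd1[/cr].
- move=> z [/Hd1[Wz cz] rz]; split => //; exact: lt_trans cz.
move=> v [t1 /box_insert[_ bv]].
have bv1 x : `|x - z0 0 i| <= d1 -> box z0 d1 (insert_rV i x v).
  by move=> h; apply/box_insert; split => // l; rewrite (le_trans (bv l)).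
have near_v x dd : d <= dd -> box (insert_rV i x v0) dd (insert_rV i x v).
  move=> ddd; apply/box_insert; rewrite insert_rV_eq subrr normr0; split.
    by rewrite (le_trans (ltW d0)).
  by move=> l; rewrite insert_rV_lift mxE (le_trans (bv l)).
have rmv : r (insert_rV i (z0 0 i - s * tau) v) < 0 by apply: Hdm; exact: near_v.
have rpv : 0 < r (insert_rV i (z0 0 i + s * tau) v) by apply: Hdp; exact: near_v.
have ab : z0 0 i - tau <= z0 0 i + tau by lra.
have cf : {within `[z0 0 i - tau, z0 0 i + tau], continuous (fun t => r (insert_rV i t v))}.
  apply: continuous_in_subspaceT => x; rewrite inE/= in_itv/= -ler_distl => xt.
  have [Wx _] := Hd1 _ (bv1 x (le_trans xt taud)).
  apply: (@continuous_comp _ _ _ (fun t => insert_rV i t v) r); last exact: cr.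
  have -> : (fun t => insert_rV i t v) = (fun t => line i (-1) (insert_rV i 0 v, t)).
    by apply/funext => t; rewrite insert_line0.
  have c3 : -1 * t @[t --> x] --> -1 * x by apply: cvgM; [exact: cvg_cst|exact: cvg_id].
  exact: (cvgB (cvg_cst (insert_rV i 0 v)) (cvgZ c3 (cvg_cst (delta_mx 0 i : 'rV[R]_k.+1)))).
have [|t0 t0I rt0] := @IVT R _ _ _ 0 ab cf.
  by case: s1 => s1; move: rmv rpv; rewrite s1 ?mul1r ?mulN1r ?opprK => h1 h2;
    rewrite ge_min le_max (ltW h1) (ltW h2) ?orbT.
move: t0I; rewrite in_itv/= -ler_distl => t0I.
have bt0 := bv1 t0 (le_trans t0I taud).
exists t0; split; first by split.
move=> t /boxle bt; have [h1 h2] := mono v t t0 bt bt0 rt0.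
split=> // h; apply: le_trans (h2 h); rewrite oppr_ge0 mulr_ge0_le0// ltW//.
Unshelve. all: by end_near. Qed.

End CrossingBox.

(** * Signed combinations of integrals and the dyadic operator *)

Section Combination.
Context (R : realType).
Notation mu := (@lebesgue_measure R).
Notation lebI := (@lebesgue_integral_rV R _).

Lemma measurable_rVD k (f g : 'rV[R]_k -> \bar R) : measurable_rV f -> measurable_rV g ->
  measurable_rV (fun v => f v + g v)%E.
Proof. by move=> mf mg d U b mb; apply: emeasurable_funD; [exact: mf|exact: mg]. Qed.

Lemma measurable_rVZ k (c : R) (f : 'rV[R]_k -> \bar R) : measurable_rV f ->
  measurable_rV (fun v => c%:E * f v)%E.
Proof. by move=> mf d U b mb; apply: emeasurable_funM; [exact: measurable_cst|exact: mf]. Qed.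

Lemma measurable_rV_sum k (I : Type) (l : seq I) (f : I -> 'rV[R]_k -> \bar R) :
  (forall j, measurable_rV (f j)) -> measurable_rV (fun v => \sum_(j <- l) f j v)%E.
Proof.
move=> mf; elim: l => [|j l IH] d U b mb.
  by under eq_fun do rewrite big_nil; exact: measurable_cst.
under eq_fun do rewrite big_cons.
by apply: emeasurable_funD; [exact: mf|exact: IH].
Qed.

Lemma lebI_sum k (I : Type) (l : seq I) (f : I -> 'rV[R]_k -> \bar R) :
  (forall j, measurable_rV (f j)) -> (forall j v, 0 <= f j v)%E ->
  lebI (fun v => \sum_(j <- l) f j v)%E = (\sum_(j <- l) lebI (f j))%E.
Proof.
move=> mf f0; elim: l => [|j l IH].
  rewrite big_nil; under eq_fun do rewrite big_nil.
  have -> : (fun _ : 'rV[R]_k => 0%E : \bar R) = (fun v : 'rV[R]_k => 0%:E * cst 0%E v)%E.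
    by apply/funext => v; rewrite mule0.
  by rewrite lebIZ ?mul0e.
rewrite big_cons -IH -lebID//.
- by congr lebesgue_integral_rV; apply/funext => v; rewrite big_cons.
- exact: measurable_rV_sum.
- by move=> v; apply: sume_ge0.
Qed.

(** Monotonicity and additivity are available for nonnegative integrands. So q is split into its
    positive and negative parts, and the bound on each line is integrated in the rearranged form sum
    A <= sum B + C 1_box. *)
Lemma lebI_combination_le k (i : 'I_k.+1) (L : nat) (q : nat -> R)
    (Fp Fm : nat -> 'rV[R]_k.+1 -> \bar R) (p : 'rV[R]_k) (d C : R) :
  0 <= d -> 0 <= C ->
  (forall l, measurable_rV (Fp l)) -> (forall l, measurable_rV (Fm l)) ->
  (forall l v, 0 <= Fp l v)%E -> (forall l v, 0 <= Fm l v)%E ->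
  (forall l, lebI (Fp l) \is a fin_num) -> (forall l, lebI (Fm l) \is a fin_num) ->
  (forall v : 'rV[R]_k, exists xp xm : nat -> R,
    [/\ forall l, (\int[mu]_t Fp l (insert_rV i t v) = (xp l)%:E)%E,
        forall l, (\int[mu]_t Fm l (insert_rV i t v) = (xm l)%:E)%E &
        \sum_(l < L) q l * (xp l - xm l) <= C * \1_(box p d) v]) ->
  \sum_(l < L) q l * (fine (lebI (Fp l)) - fine (lebI (Fm l))) <= C * (2 * d) ^+ k.
Proof.
move=> d0 C0 mp mm p0 m0 fp fm H.
pose hp l v := (\int[mu]_t Fp l (insert_rV i t v))%E.
pose hm l v := (\int[mu]_t Fm l (insert_rV i t v))%E.
have mhp l : measurable_rV (hp l) by apply: measurable_lebI_insert.
have mhm l : measurable_rV (hm l) by apply: measurable_lebI_insert.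
have hp0 l v : (0 <= hp l v)%E by apply: integral_ge0 => t _.
have hm0 l v : (0 <= hm l v)%E by apply: integral_ge0 => t _.
have Ep l : lebI (Fp l) = lebI (hp l) by exact: lebI_insert.
have Em l : lebI (Fm l) = lebI (hm l) by exact: lebI_insert.
pose qp l := maxr (q l) 0; pose qm l := maxr (- q l) 0.
have qp0 l : 0 <= qp l by rewrite le_max lexx orbT.
have qm0 l : 0 <= qm l by rewrite le_max lexx orbT.
have qE l : q l = qp l - qm l.
  by rewrite /qp /qm; case: (leP (q l) 0) => h; case: (leP (- q l) 0) => h'; lra.
pose A (l : 'I_L) v := ((qp l)%:E * hp l v + (qm l)%:E * hm l v)%E.
pose B (l : 'I_L) v := ((qm l)%:E * hp l v + (qp l)%:E * hm l v)%E.
have mA l : measurable_rV (A l) by apply: measurable_rVD; exact: measurable_rVZ.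
have mB l : measurable_rV (B l) by apply: measurable_rVD; exact: measurable_rVZ.
have A0 l v : (0 <= A l v)%E by rewrite adde_ge0// mule_ge0// lee_fin.
have B0 l v : (0 <= B l v)%E by rewrite adde_ge0// mule_ge0// lee_fin.
have mbox : measurable_rV (fun v => (\1_(box p d) v)%:E : \bar R).
  have bb : borel_rV (box p d).
    have cb : closed (box p d) by apply: compact_closed => //; exact: box_compact.
    move=> dd U b mb; have := borel_open (closed_openC cb) mb.
    by move=> /measurableC; congr (measurable _); apply/seteqP; split => u /=; [move=> /contrapT|move=> ? ?].
  move=> dd U b mb; apply/measurable_EFinP.
  exact: (@measurable_indic _ _ _ _ _ (bb dd U b mb)).
have box0 v : (0 <= (\1_(box p d) v)%:E :> \bar R)%E by rewrite lee_fin.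
have lA : lebI (fun v => \sum_(l < L) A l v)%E =
    (\sum_(l < L) (qp l * fine (lebI (Fp l)) + qm l * fine (lebI (Fm l))))%:E.
  rewrite lebI_sum// -sumEFin; apply: eq_bigr => l _.
  rewrite lebID//; try exact: measurable_rVZ; try by move=> v; rewrite mule_ge0// lee_fin.
  by rewrite !lebIZ// -Ep -Em EFinD !EFinM !fineK.
have lB : lebI (fun v => \sum_(l < L) B l v)%E =
    (\sum_(l < L) (qm l * fine (lebI (Fp l)) + qp l * fine (lebI (Fm l))))%:E.
  rewrite lebI_sum// -sumEFin; apply: eq_bigr => l _.
  rewrite lebID//; try exact: measurable_rVZ; try by move=> v; rewrite mule_ge0// lee_fin.
  by rewrite !lebIZ// -Ep -Em EFinD !EFinM !fineK.
have : (lebI (fun v => \sum_(l < L) A l v) <=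
    lebI (fun v => (\sum_(l < L) B l v) + C%:E * (\1_(box p d) v)%:E))%E.
  apply: lebI_le.
  - exact: measurable_rV_sum.
  - by apply: measurable_rVD; [exact: measurable_rV_sum|exact: measurable_rVZ].
  - by move=> v; exact: sume_ge0.
  move=> v; have [xp [xm [Hp Hm Hq]]] := H v.
  under eq_bigr do rewrite /A /hp /hm Hp Hm -!EFinM -EFinD.
  under [in leRHS]eq_bigr do rewrite /B /hp /hm Hp Hm -!EFinM -EFinD.
  rewrite !sumEFin -EFinM -EFinD lee_fin -lerBlDl -sumrB.
  apply: le_trans Hq; rewrite le_eqVlt; apply/orP; left; apply/eqP.
  by apply: eq_bigr => l _; rewrite qE; ring.
rewrite lA lebID//; last 3 first.
- exact: measurable_rVZ.
- by move=> v; exact: sume_ge0.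
- by move=> v; rewrite mule_ge0// lee_fin.
- rewrite lB lebIZ// lebI_box// -EFinM -EFinD lee_fin -lerBlDl -sumrB.
  apply: le_trans; rewrite le_eqVlt; apply/orP; left; apply/eqP.
  by apply: eq_bigr => l _; rewrite qE; ring.
exact: measurable_rV_sum.
Qed.

Lemma lebI_combination k (i : 'I_k.+1) (L : nat) (q : nat -> R)
    (Fp Fm : nat -> 'rV[R]_k.+1 -> \bar R) (p : 'rV[R]_k) (d C : R) :
  0 <= d -> 0 <= C ->
  (forall l, measurable_rV (Fp l)) -> (forall l, measurable_rV (Fm l)) ->
  (forall l v, 0 <= Fp l v)%E -> (forall l v, 0 <= Fm l v)%E ->
  (forall l, lebI (Fp l) \is a fin_num) -> (forall l, lebI (Fm l) \is a fin_num) ->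
  (forall v : 'rV[R]_k, exists xp xm : nat -> R,
    [/\ forall l, (\int[mu]_t Fp l (insert_rV i t v) = (xp l)%:E)%E,
        forall l, (\int[mu]_t Fm l (insert_rV i t v) = (xm l)%:E)%E &
        `|\sum_(l < L) q l * (xp l - xm l)| <= C * \1_(box p d) v]) ->
  `|\sum_(l < L) q l * (fine (lebI (Fp l)) - fine (lebI (Fm l)))| <= C * (2 * d) ^+ k.
Proof.
move=> d0 C0 mp mm p0 m0 fp fm H; rewrite ler_norml; apply/andP; split.
  rewrite lerNl -sumrN /=; under eq_bigr do rewrite -mulrN opprB.
  apply: (lebI_combination_le (i := i) d0 C0 mm mp m0 p0 fm fp) => v.
  have [xp [xm [Hp Hm]]] := H v; rewrite ler_norml => /andP[h _].
  exists xm, xp; split => //; move: h; rewrite lerNl -sumrN; apply: le_trans.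
  rewrite le_eqVlt; apply/orP; left; apply/eqP.
  by apply: eq_bigr => l _; rewrite -mulrN opprB.
apply: (lebI_combination_le (i := i) d0 C0 mp mm p0 m0 fp fm) => v.
have [xp [xm [Hp Hm]]] := H v; rewrite ler_norml => /andP[_ h].
exists xp, xm; split; [exact: Hp|exact: Hm|exact: h].
Qed.

(** The integral over the intersection of S and S' is finite and cancels. *)
Lemma integral_setD_diff (D S S' : set R) (w : R -> R) (I I' : R) :
  measurable D -> measurable S -> measurable S' -> S `<=` D -> S' `<=` D ->
  measurable_fun D w -> (forall u, D u -> 0 <= w u) ->
  (\int[mu]_(u in S) (w u)%:E = I%:E)%E -> (\int[mu]_(u in S') (w u)%:E = I'%:E)%E ->
  exists x x' : R, [/\ (\int[mu]_(u in S `\` S') (w u)%:E = x%:E)%E,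
    (\int[mu]_(u in S' `\` S) (w u)%:E = x'%:E)%E & x - x' = I - I'].
Proof.
move=> mD mS mS' SD SD' mw w0 HI HI'.
have mwE A : A `<=` D -> measurable_fun A (EFin \o w).
  by move=> AD; apply/measurable_EFinP; exact: measurable_funS mw.
have w0E A : A `<=` D -> forall u, A u -> (0 <= (w u)%:E)%E.
  by move=> AD u /AD/w0; rewrite lee_fin.
have split2 (A B : set R) : measurable A -> measurable B -> A `<=` D ->
  (\int[mu]_(u in A) (w u)%:E =
   \int[mu]_(u in A `\` B) (w u)%:E + \int[mu]_(u in A `&` B) (w u)%:E)%E.
  move=> mA mB AD; rewrite -ge0_integral_setU//; first by rewrite setUC setUIDK.
  - exact: measurableD.
  - exact: measurableI.
  - by apply: mwE => u [[/AD]|[/AD]].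
  - by move=> u h; apply: (w0E _ _ u h) => y [[/AD]|[/AD]].
  - by apply/disj_setPS => u [[_ nB] [_ Bu]].
have E1 := split2 S S' mS mS' SD.
have E2 := split2 S' S mS' mS SD'.
rewrite setIC in E2.
have i0 A : A `<=` D -> (0 <= \int[mu]_(u in A) (w u)%:E)%E.
  by move=> AD; apply: integral_ge0 => u; exact: w0E.
have h1 : (0 <= \int[mu]_(u in S `\` S') (w u)%:E)%E by apply: i0 => u [/SD].
have h2 : (0 <= \int[mu]_(u in S' `\` S) (w u)%:E)%E by apply: i0 => u [/SD'].
have h3 : (0 <= \int[mu]_(u in S `&` S') (w u)%:E)%E by apply: i0 => u [/SD].
rewrite HI in E1; rewrite HI' in E2; move: E1 E2 h1 h2 h3.
case: (\int[mu]_(u in S `\` S') (w u)%:E)%E => [x| |]; case: (\int[mu]_(u in S `&` S') (w u)%:E)%E => [y| |] //.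
case: (\int[mu]_(u in S' `\` S) (w u)%:E)%E => [x'| |] //.
rewrite -!EFinD => -[->] -[->] _ _ _; exists x, x'; split => //; ring.
Qed.

(* sum_l q_l f(2^l eps), with q_l the coefficients, vanishes for f = eps^(-j),
   1 <= j <= N. *)
Definition dyadic_poly (N : nat) : {poly R} :=
  \prod_(j < N) ('X - (2^-1 ^+ j.+1)%:P).

Lemma size_dyadic_poly N : size (dyadic_poly N) = N.+1.
Proof.
rewrite /dyadic_poly -(big_map (fun j : 'I_N => 2^-1 ^+ j.+1 : R) xpredT (fun x => 'X - x%:P)).
by rewrite size_prod_XsubC size_map -[RHS]/(N.+1) -[N in RHS]card_ord cardT enumT.
Qed.

Lemma dyadic_sum N (x : R) : \sum_(l < N.+1) (dyadic_poly N)`_l * x ^+ l = (dyadic_poly N).[x].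
Proof. by rewrite horner_coef size_dyadic_poly. Qed.

Lemma dyadic_root N (j : 'I_N) : (dyadic_poly N).[2^-1 ^+ j.+1] = 0.
Proof.
by rewrite /dyadic_poly horner_prod (bigD1 j)//= hornerXsubC subrr mul0r.
Qed.

Lemma dyadic_poly1 N : 0 < (dyadic_poly N).[1].
Proof.
rewrite /dyadic_poly horner_prod prodr_gt0// => j _.
by rewrite hornerXsubC subr_gt0 exprn_ilt1//; lra.
Qed.

Lemma dyadic_kill N (d : nat -> R) (eps : R) : 0 < eps ->
  \sum_(l < N.+1) (dyadic_poly N)`_l * (\sum_(j < N) d j / (2 ^+ l * eps) ^+ j.+1) = 0.
Proof.
move=> e0; under eq_bigr do rewrite mulr_sumr.
rewrite exchange_big/= big1// => j _.
transitivity (d j / eps ^+ j.+1 * (\sum_(l < N.+1) (dyadic_poly N)`_l * (2^-1 ^+ j.+1) ^+ l)).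
  rewrite mulr_sumr; apply: eq_bigr => l _.
  rewrite exprMn invfM -exprM -!exprVn -[(2^-1 ^+ _) ^+ _]exprM mulnC; ring.
by rewrite dyadic_sum dyadic_root mulr0.
Qed.

End Combination.

(** * Change of a superlevel integral inside one box *)

Section LocalStep.
Context (R : realType).
Notation mu := (@lebesgue_measure R).
Notation lebI := (@lebesgue_integral_rV R _).

Lemma insert_rV_surj k (i : 'I_k.+1) (z : 'rV[R]_k.+1) :
  z = insert_rV i (z 0 i) (\row_l z 0 (lift i l)).
Proof.
by apply/rowP => j; case: (unliftP i j) => [l ->|->]; rewrite ?insert_rV_lift ?insert_rV_eq// mxE.
Qed.

Lemma open_superlevel (V : topologicalType) (O : set V) (f : V -> R) (eps : R) :
  open O -> (forall z, O z -> {for z, continuous f}) -> open [set z | O z /\ eps < f z].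
Proof.
move=> oO cf; rewrite openE => z [Oz fz]; near=> y; split.
  by near: y; exact: open_nbhs_nbhs.
by near: y; exact: (cvgr_gt (f z) (cf z Oz)).
Unshelve. all: by end_near. Qed.

Definition superlevel_diff (V : Type) (O : set V) (f f' : V -> R) (eps : R) : set V :=
  [set z | O z /\ eps < f z] `\` [set z | O z /\ eps < f' z].

Context (k : nat) (i : 'I_k.+1) (s : R) (W O : set 'rV[R]_k.+1) (r : 'rV[R]_k.+1 -> R).
Context (z0 : 'rV[R]_k.+1) (d c h : R) (K : set 'rV[R]_k.+1) (w : 'rV[R]_k.+1 -> R).
Hypotheses (s1 : s = 1 \/ s = -1) (oO : open O) (OE : forall z, O z <-> W z /\ r z < 0).
Hypotheses (d0 : 0 < d) (c0 : 0 < c).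
Hypothesis crossing : forall v, (exists t, box z0 d (insert_rV i t v)) ->
  exists t0, K (insert_rV i t0 v) /\ crosses_at i s r z0 d c v t0.
Hypothesis wc : forall z, O z -> {for z, continuous w}.
Hypothesis lineO : forall z, K z -> forall u, 0 < u < h ->
  O (line i s (z, u)) /\ 0 <= w (line i s (z, u)).

Section Slices.
Context (f f' : 'rV[R]_k.+1 -> R) (e1 eps : R).
Hypothesis fE : forall z, O z -> ~ box z0 d z -> f z = f' z.
Hypothesis fpos : forall z, box z0 d z -> O z -> r z <= - (c * h) -> e1 <= f z /\ e1 <= f' z.
Hypothesis epsE : eps < e1.

Lemma superlevel_diff_box z : superlevel_diff O f f' eps z -> box z0 d z.
Proof.
by move=> [[Oz fz] n]; apply: contrapT => nb; apply: n; split => //; rewrite -fE.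
Qed.

(** A point of the difference lies in the box. At depth u <= 0 it would be outside O; at depth u >=
    h one has r <= - c h, where f' >= e1 > eps puts it into the subtracted set. *)
Lemma superlevel_diff_line v t0 u :
  crosses_at i s r z0 d c v t0 ->
  superlevel_diff O f f' eps (line i s (insert_rV i t0 v, u)) -> 0 < u < h.
Proof.
rewrite -insert_line => Ht Sz; have bz := superlevel_diff_box Sz.
case: Sz => -[Oz fz] nz; have [H1 H2] := Ht _ bz.
have E : s * (t0 - (t0 - s * u)) = u by case: s1 => ->; ring.
rewrite E in H1 H2; have [_ rz] := (OE _).1 Oz.
have u0 : 0 < u by rewrite ltNge; apply/negP => /H2; rewrite leNgt rz.
rewrite u0 ltNge; apply/negP => hu; apply: nz; split => //.
have [|_ e1f] := fpos bz Oz; last exact: lt_le_trans e1f.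
by apply: le_trans (H1 (ltW u0)) _; rewrite lerN2 ler_pM2l.
Qed.

(** w is known to be nonnegative only on the transversal lines over K, and these cover the
    difference set. *)
Lemma superlevel_diff_ge0 z : 0 <= w z * \1_(superlevel_diff O f f' eps) z.
Proof.
rewrite indicE; case: (boolP (z \in _)) => [|_]; last by rewrite mulr0.
rewrite inE mulr1 => Sz; move: (Sz); rewrite [z](insert_rV_surj i).
have [|t0 [Kt0 Ht]] := crossing (v := \row_l z 0 (lift i l)).
  by exists (z 0 i); rewrite -insert_rV_surj; exact: superlevel_diff_box.
have -> : z 0 i = t0 - s * (s * (t0 - z 0 i)) by case: s1 => ->; ring.
rewrite insert_line => /(superlevel_diff_line Ht) hu.
by have [] := lineO Kt0 hu.
Qed.
End Slices.

Lemma superlevel_diff_measurable (f f' : 'rV[R]_k.+1 -> R) (eps : R) :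
  (forall z, O z -> {for z, continuous f}) -> (forall z, O z -> {for z, continuous f'}) ->
  measurable_rV (fun z => (w z * \1_(superlevel_diff O f f' eps) z)%:E).
Proof.
move=> cf cf'; apply: (measurable_continuous_indic oO) => //; first by move=> z [[]].
by apply: borel_setD; apply: borel_open; exact: open_superlevel.
Qed.

(** The substitution t = t0 - s u identifies the slice of the difference set with a difference of
    the one-variable superlevel sets whose integrals have been expanded. *)
Lemma superlevel_diff_integral (f f' : 'rV[R]_k.+1 -> R) (e1 eps : R) v t0 :
  (forall z, O z -> {for z, continuous f}) -> (forall z, O z -> {for z, continuous f'}) ->
  (forall z, O z -> ~ box z0 d z -> f z = f' z) ->
  (forall z, box z0 d z -> O z -> r z <= - (c * h) -> e1 <= f z /\ e1 <= f' z) ->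
  eps < e1 -> K (insert_rV i t0 v) ->
  crosses_at i s r z0 d c v t0 ->
  let y := insert_rV i t0 v in
  let S g := [set u : R | 0 < u < h /\ eps < g (line i s (y, u))] in
  (\int[mu]_t (w (insert_rV i t v) * \1_(superlevel_diff O f f' eps) (insert_rV i t v))%:E =
   \int[mu]_(u in S f `\` S f') (w (line i s (y, u)))%:E)%E.
Proof.
move=> cf cf' fE fpos epsE Ky Ht y S.
pose F z := (w z * \1_(superlevel_diff O f f' eps) z)%:E.
have F0 z : (0 <= F z)%E by rewrite lee_fin; exact: (superlevel_diff_ge0 fE fpos epsE).
have mF := superlevel_diff_measurable eps cf cf'.
have mFv : measurable_fun [set: R] (fun t => F (insert_rV i t v)).
  apply: (mF _ _ (fun t => insert_rV i t v)); apply: measurable_insert; first exact: measurable_id.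
  by move=> l; exact: measurable_cst.
rewrite (@ge0_integral_affine _ t0 s (fun t => F (insert_rV i t v)))//.
rewrite [RHS]integral_mkcond; apply: eq_integral => u _.
rewrite insert_line /F patchE indicE -/y.
have -> : (u \in S f `\` S f') = (line i s (y, u) \in superlevel_diff O f f' eps).
  apply/idP/idP; rewrite !inE.
    move=> [[hu fu] nu]; have [Ou _] := lineO Ky hu.
    by split => // -[_ fu']; apply: nu.
  move=> Su; have hu := superlevel_diff_line fE fpos epsE Ht Su.
  by case: Su => -[Ou fu] nu; split => // -[_ fu']; apply: nu.
by case: ifP; rewrite ?mulr1 ?mulr0.
Qed.

(* The logarithmic terms of f and f' cancel because b is the same. The
   coefficients dd need not be measurable in z: dyadic_poly removes them on each
   line, before the integration over the lines. *)
Lemma local_superlevel_difference (f f' : 'rV[R]_k.+1 -> R) (N : nat) (b : 'rV[R]_k.+1 -> R)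
    (C e0 C' e0' e1 : R) :
  (forall z, O z -> {for z, continuous f}) -> (forall z, O z -> {for z, continuous f'}) ->
  (forall z, O z -> ~ box z0 d z -> f z = f' z) ->
  (forall z, box z0 d z -> O z -> r z <= - (c * h) -> e1 <= f z /\ e1 <= f' z) ->
  0 < e0 -> 0 < e0' -> 0 < e1 ->
  (forall z, K z -> exists dd : nat -> R, forall eps, 0 < eps < e0 -> exists I : R,
      (\int[mu]_(u in [set u | (0 < u < h)%R /\ (eps < f (line i s (z, u)))%R])
         (w (line i s (z, u)))%:E = I%:E)%E /\
      `|I + (\sum_(j < N) dd j / eps ^+ j.+1 + b z * ln eps)| <= C) ->
  (forall z, K z -> exists dd : nat -> R, forall eps, 0 < eps < e0' -> exists I : R,
      (\int[mu]_(u in [set u | (0 < u < h)%R /\ (eps < f' (line i s (z, u)))%R])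
         (w (line i s (z, u)))%:E = I%:E)%E /\
      `|I + (\sum_(j < N) dd j / eps ^+ j.+1 + b z * ln eps)| <= C') ->
  exists D e2 : R, 0 < e2 /\ forall eps, 0 < eps < e2 ->
    let F f f' l := lebI (fun z => (w z * \1_(superlevel_diff O f f' (2 ^+ l * eps)) z)%:E) in
    (forall l, (l <= N)%N -> F f f' l \is a fin_num /\ F f' f l \is a fin_num) ->
    `|\sum_(l < N.+1) (dyadic_poly R N)`_l * (fine (F f f' l) - fine (F f' f l))| <= D.
Proof.
move=> cf cf' fE fpos e00 e00' e10 Hs Hs'.
pose q l := (dyadic_poly R N)`_l.
pose A := (\sum_(l < N.+1) `|q l|) * (`|C| + `|C'|).
have A0 : 0 <= A by rewrite mulr_ge0// sumr_ge0.
exists (A * (2 * d) ^+ k), (Num.min (Num.min e0 e0') e1 / 2 ^+ N).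
have p2 (l : nat) : 0 < 2 ^+ l :> R by rewrite exprn_gt0.
split; first by rewrite divr_gt0// !lt_min e00 e00' e10.
move=> eps /andP[eps0]; rewrite ltr_pdivlMr// !lt_min => /andP[/andP[E1 E2] E3] F fin.
(* [lebI_combination] quantifies over all natural l. Capping the exponent at N keeps every level
   below the thresholds and changes nothing in the sum over l <= N. *)
pose ee l := 2 ^+ (minn l N) * eps.
have ee0 l : 0 < ee l by rewrite mulr_gt0.
have eeN l : ee l <= eps * 2 ^+ N.
  by rewrite /ee mulrC ler_pM2l// ler_eXn2l ?geq_minr// ltr1n.
have e1E l : ee l < e1 by exact: le_lt_trans E3.
pose G f f' l z := (w z * \1_(superlevel_diff O f f' (ee l)) z)%:E.
have GE g g' l : (l <= N)%N -> lebI (G g g' l) = F g g' l.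
  by move=> lN; rewrite /G /F /ee (minn_idPl lN).
have fE' z : O z -> ~ box z0 d z -> f' z = f z by move=> Oz nb; rewrite fE.
have fpos' z : box z0 d z -> O z -> r z <= - (c * h) -> e1 <= f' z /\ e1 <= f z.
  by move=> bz Oz rz; have [] := fpos z bz Oz rz.
have finG g g' l : (forall l, (l <= N)%N -> F g g' l \is a fin_num) -> lebI (G g g' l) \is a fin_num.
  move=> Hf; have -> : G g g' l = G g g' (minn l N) by rewrite /G /ee -minnA minnn.
  by rewrite GE ?geq_minr//; apply: Hf; exact: geq_minr.
have -> : \sum_(l < N.+1) (dyadic_poly R N)`_l * (fine (F f f' l) - fine (F f' f l)) =
    \sum_(l < N.+1) q l * (fine (lebI (G f f' l)) - fine (lebI (G f' f l))).
  apply: eq_bigr => l _; have lN : (l <= N)%N by rewrite -ltnS.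
  by rewrite (GE f f' l lN) (GE f' f l lN).
apply: (lebI_combination (i := i) (q := q) (p := \row_l z0 0 (lift i l)) (ltW d0) A0).
- by move=> l; exact: superlevel_diff_measurable.
- by move=> l; exact: superlevel_diff_measurable.
- by move=> l v; rewrite lee_fin; exact: (superlevel_diff_ge0 fE fpos).
- by move=> l v; rewrite lee_fin; exact: (superlevel_diff_ge0 fE' fpos').
- by move=> l; apply: finG => l' /fin[].
- by move=> l; apply: finG => l' /fin[].
move=> v; have [[t bt]|nb] := pselect (exists t, box z0 d (insert_rV i t v)); last first.
  have z g g' l t : (forall z, O z -> ~ box z0 d z -> g z = g' z) -> G g g' l (insert_rV i t v) = 0%E.
    move=> gE; rewrite /G indicE memNset ?mulr0// => /(superlevel_diff_box gE) bt.
    by apply: nb; exists t.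
  exists (fun=> 0), (fun=> 0); split.
  - by move=> l; apply: integral0_eq => t _; exact: z.
  - by move=> l; apply: integral0_eq => t _; exact: z.
  - rewrite big1; last by move=> l _; rewrite subrr mulr0.
    by rewrite normr0; apply: mulr_ge0 => //; rewrite indicE.
have [t0 [Ky Ht]] := crossing (ex_intro _ t bt).
set y := insert_rV i t0 v in Ky.
have [dd Hdd] := Hs y Ky; have [dd' Hdd'] := Hs' y Ky.
pose D := [set u : R | 0 < u < h].
pose S g l := [set u : R | 0 < u < h /\ ee l < g (line i s (y, u))].
have DE : D = `]0, h[%classic by apply/seteqP; split => u /=; rewrite in_itv.
have oD : open D by rewrite DE; exact: interval_open.
have mD : measurable D by rewrite DE; exact: measurable_itv.
have cl (g : 'rV[R]_k.+1 -> R) : (forall z, O z -> {for z, continuous g}) ->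
    forall u, D u -> {for u, continuous (fun u => g (line i s (y, u)))}.
  move=> cg u hu; have [Ou _] := lineO Ky hu.
  have lc : {for u, continuous (fun u => line i s (y, u))} by exact: line_continuous.
  by apply: (continuous_comp lc); exact: cg.
have mS (g : 'rV[R]_k.+1 -> R) l : (forall z, O z -> {for z, continuous g}) -> measurable (S g l).
  by move=> cg; apply: open_measurable; apply: (open_superlevel (O := D)) => //; exact: cl.
have mw : measurable_fun D (fun u => w (line i s (y, u))).
  apply: open_continuous_measurable_fun => // u; rewrite inE => Du; exact: (cl w).
have SD g l : S g l `<=` D by move=> u [].
have w0 u : D u -> 0 <= w (line i s (y, u)) by move=> /(lineO Ky)[].
have X l : exists xx : R * R * R * R, [/\
    (\int[mu]_t G f f' l (insert_rV i t v) = xx.1.1.1%:E)%E,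
    (\int[mu]_t G f' f l (insert_rV i t v) = xx.1.1.2%:E)%E,
    xx.1.1.1 - xx.1.1.2 = xx.1.2 - xx.2,
    `|xx.1.2 + (\sum_(j < N) dd j / ee l ^+ j.+1 + b y * ln (ee l))| <= C &
    `|xx.2 + (\sum_(j < N) dd' j / ee l ^+ j.+1 + b y * ln (ee l))| <= C'].
  have [|I [HI BI]] := Hdd (ee l); first by rewrite ee0 (le_lt_trans (eeN l) E1).
  have [|I' [HI' BI']] := Hdd' (ee l); first by rewrite ee0 (le_lt_trans (eeN l) E2).
  have [x [x' [Hx Hx' E]]] := integral_setD_diff mD (mS f l cf) (mS f' l cf')
    (SD f l) (SD f' l) mw w0 HI HI'.
  exists (x, x', I, I'); split => //=.
    by rewrite -Hx; exact: (superlevel_diff_integral cf cf' fE fpos (e1E l) Ky Ht).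
  by rewrite -Hx'; exact: (superlevel_diff_integral cf' cf fE' fpos' (e1E l) Ky Ht).
move: X => /choice[X HX].
exists (fun l => (X l).1.1.1), (fun l => (X l).1.1.2); split.
- by move=> l; have [] := HX l.
- by move=> l; have [] := HX l.
have -> : \1_(box (\row_l z0 0 (lift i l)) d) v = 1 :> R.
  rewrite indicE mem_set// => l; rewrite mxE.
  by have [_ /(_ l)] := (box_insert i t v z0 d).1 bt.
rewrite mulr1.
have -> : \sum_(l < N.+1) q l * ((X l).1.1.1 - (X l).1.1.2) =
    \sum_(l < N.+1) q l * (((X l).1.2 + (\sum_(j < N) dd j / ee l ^+ j.+1 + b y * ln (ee l))) -
       ((X l).2 + (\sum_(j < N) dd' j / ee l ^+ j.+1 + b y * ln (ee l)))).
  have KK (a : nat -> R) : \sum_(l < N.+1) q l * (\sum_(j < N) a j / ee l ^+ j.+1) = 0.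
    rewrite -[RHS](dyadic_kill N a eps0); apply: eq_bigr => l _.
    by rewrite /ee (minn_idPl _) // -ltnS.
  transitivity (\sum_(l < N.+1) q l * ((X l).1.1.1 - (X l).1.1.2) +
     (\sum_(l < N.+1) q l * (\sum_(j < N) dd j / ee l ^+ j.+1) -
      \sum_(l < N.+1) q l * (\sum_(j < N) dd' j / ee l ^+ j.+1))).
    by rewrite !KK subr0 addr0.
  rewrite -sumrB -big_split /=.
  by apply: eq_bigr => l _; have [_ _ -> _ _] := HX l; ring.
rewrite /A mulr_suml; apply: le_trans (ler_norm_sum _ _ _) _; apply: ler_sum => l _.
rewrite normrM ler_wpM2l//; have [_ _ _ h1 h2] := HX l.
apply: le_trans (ler_normB _ _) _.
by apply: lerD; [apply: le_trans h1 _|apply: le_trans h2 _]; exact: ler_norm.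
Qed.

End LocalStep.

(** * Volume differences within one chart *)

Section LocalVolume.
Context (R : realType).

Lemma compact_pos_bound (V : topologicalType) (B : set V) (f : V -> R) : compact B ->
  (forall x, B x -> {for x, continuous f}) -> (forall x, B x -> 0 < f x) ->
  exists2 e : R, 0 < e & forall x, B x -> e <= f x.
Proof.
move=> cB cf f0.
(* The lower bound is encoded as 1 / max (C, 1), which is positive for every C and decreases in
   C. *)
have [|z Bz|C HC] := compact_near (K := B) (Q := fun C x => (maxr C 1)^-1 <= f x) _ cB.
- move=> C D x CD; apply: le_trans; rewrite lef_pV2 ?posrE ?lt_max ?ltr01 ?orbT//.
  by rewrite ge_max !le_max CD lexx !orbT.
- exists (2 / f z); apply: cvg_within.
  have h : f z / 2 < f z by have := f0 z Bz; lra.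
  apply: filterS (cvgr_gt (f z) (cf z Bz) _ h) => y /ltW; apply: le_trans.
  have -> : f z / 2 = (2 / f z)^-1 by rewrite invf_div.
  by rewrite lef_pV2 ?posrE ?lt_max ?ltr01 ?orbT ?divr_gt0 ?f0// le_max lexx.
by exists (maxr C 1)^-1 => //; rewrite invr_gt0 lt_max ltr01 orbT.
Qed.

Definition ccontinuous_at (V : topologicalType) (x : V) (F : V -> R[i]) : Prop :=
  {for x, continuous (fun y => complex.Re (F y))} /\
  {for x, continuous (fun y => complex.Im (F y))}.

Lemma det_ccontinuous (V : topologicalType) (x : V) m (F : V -> 'M[R[i]]_m) :
  (forall j k, ccontinuous_at x (fun y => F y j k)) -> ccontinuous_at x (fun y => \det (F y)).
Proof.
have cst (a : R[i]) : ccontinuous_at x (fun=> a) by split; exact: cvg_cst.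
have eqc (a b : V -> R) : a =1 b -> {for x, continuous a} -> {for x, continuous b}.
  by move=> /funext ->.
have add (f g : V -> R[i]) : ccontinuous_at x f -> ccontinuous_at x g ->
    ccontinuous_at x (fun y => f y + g y).
  move=> [f1 f2] [g1 g2]; split.
    by apply: eqc (cvgD f1 g1) => y; rewrite ReD.
  by apply: eqc (cvgD f2 g2) => y; rewrite ImD.
have mul (f g : V -> R[i]) : ccontinuous_at x f -> ccontinuous_at x g ->
    ccontinuous_at x (fun y => f y * g y).
  move=> [f1 f2] [g1 g2]; split.
    by apply: eqc (cvgB (cvgM f1 g1) (cvgM f2 g2)) => y; rewrite ReM.
  by apply: eqc (cvgD (cvgM f1 g2) (cvgM f2 g1)) => y; rewrite ImM.
move=> cF; rewrite /determinant.
elim: (index_enum _) => [|s l IH]; first by under eq_fun do rewrite big_nil; exact: cst.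
under eq_fun do rewrite big_cons; refine (add _ _ _ IH); refine (mul _ _ (cst _) _).
elim: (index_enum _) => [|j l' IH']; first by under eq_fun do rewrite big_nil; exact: cst.
by under eq_fun do rewrite big_cons; exact: (mul _ _ (cF _ _) IH').
Qed.

Lemma smooth_at_continuous k (G : 'rV[R]_k -> R) z : smooth_at G z -> {for z, continuous G}.
Proof. by move=> /nbhs_singleton /(_ [::])[]. Qed.

Context (n : nat) (T : ptopologicalType) (X : complex_manifold R n.+1 T).

(** What the volume comparison uses of a defining function, in a form preserved by interpolation
    with cutoffs of finite regularity. Order n + 2 for phi gives order n + 1 for - phi / u, as
    required by the poles up to eps^(-n-1). *)
Record admissible (phi : T -> R) : Prop := Admissible {
  admissible_continuous : continuous phi;
  admissible_expandable : expandable X n.+2 phi;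
  admissible_comparable : comparable_bdry X phi;
  admissible_lt0 : forall p, inside X p -> phi p < 0;
  admissible_eq0 : forall p, bdry X p -> phi p = 0 }.

Definition superlevel (phi : T -> R) (eps : R) : set (borel T) := [set x | phi x < - eps].

Lemma superlevel_measurable phi eps : continuous phi -> measurable (superlevel phi eps).
Proof.
move=> cphi; apply: sub_sigma_algebra; rewrite /superlevel.
have -> : [set x | phi x < - eps] = [set x | setT x /\ eps < - phi x].
  by apply/seteqP; split => x /=; [move=> h; split => //|move=> [_]]; rewrite ltrNr.
apply: (@open_superlevel R T setT (fun x => - phi x)); first exact: openT.
by move=> z _; exact: (cvgN (cphi z)).
Qed.

Context (gplus g : herm_field X) (mu : {measure set (borel T) -> \bar R}).
Hypotheses (gplus_fefferman : fefferman_metric gplus)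
  (g_metric : hermitian_metric (inside X) g)
  (g_gplus : same_boundary_expansion g gplus) (mu_volume : volume_measure g mu).

Lemma det_metric_continuous e z : chart_interior e z ->
  {for z, continuous (fun z => complex.Re (\det (g e z)))}.
Proof.
move=> [Wz rz]; have [dz cz] := chart_image Wz (ltW rz).
have iz : inside X (coordV e z) by apply/insideE => //; exact: ltW.
have [|H _ _] := g_metric.1 e (coordV e z) dz; first exact: iz.
apply: (proj1 (det_ccontinuous _)) => j k; have [H1 H2] := H j k.
rewrite cz in H1 H2.
by split; [exact: (smooth_at_continuous H1)|exact: (smooth_at_continuous H2)].
Qed.

Lemma measure_difference (A B : set (borel T)) : measurable A -> measurable B ->
  mu A \is a fin_num -> mu B \is a fin_num ->
  [/\ mu (A `\` B) \is a fin_num, mu (B `\` A) \is a fin_num &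
   fine (mu A) - fine (mu B) = fine (mu (A `\` B)) - fine (mu (B `\` A))].
Proof.
move=> mA mB fA fB.
have fin (C D : set (borel T)) : measurable C -> measurable D -> C `<=` D ->
    mu D \is a fin_num -> mu C \is a fin_num.
  move=> mC mD CD fD; rewrite ge0_fin_numE//; apply: le_lt_trans (le_measure mu _ _ CD) _.
  - by rewrite inE.
  - by rewrite inE.
  - by rewrite -ge0_fin_numE.
have fAB := fin _ _ (measurableD mA mB) mA (@subDsetl _ _ _) fA.
have fBA := fin _ _ (measurableD mB mA) mB (@subDsetl _ _ _) fB.
have fI := fin _ _ (measurableI _ _ mA mB) mA (@subIsetl _ _ _) fA.
split => //; rewrite (measureDI mu mA mB) (measureDI mu mB mA) [B `&` A]setIC.
by rewrite !fineD//; ring.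
Qed.

(** Where phi and phi' agree there is no difference, so the difference set lies in [dom e], where
    [mu] has a density; the full superlevel sets need not lie in any chart. *)
Lemma superlevel_difference_volume e phi phi' eps : 0 < eps ->
  continuous phi -> continuous phi' -> (forall p, bdry X p -> phi p = 0) ->
  (forall q, phi q <> phi' q -> dom e q) ->
  mu (superlevel phi eps `\` superlevel phi' eps) = lebesgue_integral_rV (fun z =>
     (complex.Re (\det (g e z)) * \1_(superlevel_diff (chart_interior e)
       (fun z => - phi (coordV e z)) (fun z => - phi' (coordV e z)) eps) z)%:E).
Proof.
move=> e0 cphi cphi' phi0 D.
have dq q : (superlevel phi eps `\` superlevel phi' eps) q -> dom e q.
  by move=> [a b]; apply: D => E; apply: b; rewrite /superlevel/= -E.
have iq q : superlevel phi eps q -> inside X q.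
  by move=> a b; move: a; rewrite /superlevel /= phi0// oppr_gt0 ltNge ltW.
rewrite (mu_volume (e := e)); last 2 first.
- by apply: measurableD; exact: superlevel_measurable.
- by move=> q Aq; split; [exact: dq|apply: iq; case: Aq].
congr lebesgue_integral_rV; apply/funext => z; congr (_ * \1__ z)%:E.
apply/seteqP; split => [_ [q Aq <-]|y [[[Wy ry] /= f1] f2]].
  have de := dq q Aq; have [Wq rq] := image_chart de.
  have iiq : inside X q by apply: iq; case: Aq.
  have := insideE Wq rq; rewrite (coordK de) => -[/(_ iiq) r0 _].
  case: Aq => a b; split; first by split; [|rewrite /= (coordK de) ltrNr].
  by move=> [_ /= c]; apply: b; rewrite (coordK de) ltrNr in c.
have [dy cy] := chart_image Wy (ltW ry).
exists (coordV e y) => //; split; first by rewrite /superlevel /= ltrNr.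
by rewrite /superlevel /= ltrNr => c; apply: f2; split.
Qed.

(** The chart and the box depend on p alone and are fixed before phi and phi', because the cutoffs
    that produce phi and phi' are built from them. *)
Lemma local_step p : bdry X p -> exists (e : chart X) (d : R),
  [/\ 0 < d, dom e p, box (coord e p) d `<=` chartW e &
  forall phi phi' e3, admissible phi -> admissible phi' ->
    (forall q, phi q <> phi' q -> dom e q /\ box (coord e p) d (coord e q)) ->
    0 < e3 -> (forall eps, 0 < eps < e3 -> mu (superlevel phi eps) \is a fin_num /\
       mu (superlevel phi' eps) \is a fin_num) ->
    exists D e2 : R, 0 < e2 /\ forall eps, 0 < eps < e2 ->
      `|\sum_(l < n.+2) (dyadic_poly R n.+1)`_l *
        (fine (mu (superlevel phi (2 ^+ l * eps))) -
         fine (mu (superlevel phi' (2 ^+ l * eps))))| <= D].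
Proof.
move=> bp; have [e de] := dom_cover X p.
have [Wp rp] := image_chart de; have r0 := (bdryE de).1 bp.
have [i di] := chartr_regular Wp r0.
pose s : R := if 0 < partial i (chartr e) (coord e p) then 1 else -1.
have s1 : s = 1 \/ s = -1 by rewrite /s; case: ifP; [left|right].
have tr : 0 < s * partial i (chartr e) (coord e p).
  rewrite /s; case: ifP => [h|/negbT]; first by rewrite mul1r.
  by rewrite -leNgt le_eqVlt => /orP[/eqP //|h]; rewrite mulN1r oppr_gt0.
have [d [c [K [[d0 c0] bW cK KP cross]]]] := @crossing_box R (n + n.+1) i s (chartr e)
  (chartW e) (coord e p) s1 (@chartW_open _ _ _ X e) (@chartr_smooth _ _ _ X e) Wp r0 tr.
exists e, d; split => // phi phi' e3 aphi aphi' D e30 fin.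
pose K1 : set (model R n.+1) := K; have cK1 : compact K1 by [].
have KP1 z : K1 z -> [/\ chartW e z, chartr e z = 0 & 0 < s * partial i (chartr e) z] by exact: KP.
pose w (z : model R n.+1) := complex.Re (\det (g e z)).
have [p' tp'|b [Cb [bC wb]]] := density_compact cK1 KP1 (w := w) (N := n.+2).
  have [b' d' t'] := tp'.
  exact: (@density_line R T n X gplus g e p' i s n.+2 gplus_fefferman g_gplus b' d' t').
have cw z : chart_interior e z -> {for z, continuous w} by exact: det_metric_continuous.
have SU phi1 (a : admissible phi1) := superlevel_uniform cK1 KP1 cw bC wb
  (admissible_expandable a) (admissible_comparable a) (admissible_continuous a).
have [h1 h10 H1] := SU _ aphi; have [h2 h20 H2] := SU _ aphi'.
have /smallP[h3 h30 H3] : \forall x \near small R (globally K1),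
    chart_interior e (line i s x) /\ 0 <= w (line i s x).
  apply: filterS2 (interior_compact cK1 KP1) wb => x [Wx rx _ _ _] [_ w0].
  by split.
pose h := Num.min (Num.min h1 h2) h3 / 2.
have hm : 0 < Num.min (Num.min h1 h2) h3 by rewrite !lt_min h10 h20.
have h0 : 0 < h by rewrite divr_gt0.
have : h < Num.min (Num.min h1 h2) h3 by rewrite /h; lra.
rewrite !lt_min => /andP[/andP[hh1 hh2] hh3].
have [C [e0 [e00 HC]]] := H1 h (introT andP (conj h0 hh1)).
have [C' [e0' [e00' HC']]] := H2 h (introT andP (conj h0 hh2)).
have lineO z : K1 z -> forall u, 0 < u < h ->
    chart_interior e (line i s (z, u)) /\ 0 <= w (line i s (z, u)).
  move=> Kz u /andP[u0 uh]; apply: H3 => //; by rewrite u0 (lt_trans uh).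
pose f phi1 (z : model R n.+1) := - phi1 (coordV e z) : R.
have fc phi1 : continuous phi1 -> forall z, chart_interior e z -> {for z, continuous (f phi1)}.
  move=> c1 z iz; apply: (@continuousN _ _ _ (fun z => phi1 (coordV e z)) z).
  by apply: (continuous_comp (coordV_continuous_at iz)); exact: c1.
(* The part of the box at depth r <= - c h is compact and interior, so - phi and - phi' have
   positive lower bounds there; these give the threshold for eps. *)
pose B := box (coord e p) d `&` (chartr e) @^-1` [set y | y <= - (c * h)].
have BO z : B z -> chart_interior e z.
  move=> [/bW Wz /= rz]; split => //; apply: le_lt_trans rz _.
  by rewrite oppr_lt0 mulr_gt0.
have cB : compact B.
  apply: compact_preimage.
  - by [].
  - exact: box_compact.
  - exact: closed_le.
  - by move=> z /bW /chartr_smooth /smooth_at_continuous.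
have fB phi1 : admissible phi1 -> exists2 e1 : R, 0 < e1 & forall z, B z -> e1 <= f phi1 z.
  move=> a; apply: compact_pos_bound => // z /BO iz; first exact: (fc _ (admissible_continuous a)).
  have [Wz rz] := iz; rewrite oppr_gt0; apply: (admissible_lt0 a).
  by apply/insideE => //; exact: ltW.
have [ea ea0 Ha] := fB _ aphi; have [eb eb0 Hb] := fB _ aphi'.
have fE z : chart_interior e z -> ~ box (coord e p) d z -> f phi z = f phi' z.
  move=> [Wz rz] nb; have [_ cz] := chart_image Wz (ltW rz).
  rewrite /f; congr (- _); apply: contrapT => /D[_]; by rewrite cz.
have fpos z : box (coord e p) d z -> chart_interior e z -> chartr e z <= - (c * h) ->
    Num.min ea eb <= f phi z /\ Num.min ea eb <= f phi' z.
  by move=> bz _ rz; split; rewrite ge_min ?Ha ?Hb ?orbT//; split.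
have OE z : chart_interior e z <-> chartW e z /\ chartr e z < 0 by [].
have m0 : 0 < Num.min ea eb by rewrite lt_min ea0.
have [D0 [e2 [e20 HD]]] := @local_superlevel_difference R (n + n.+1) i s (chartW e)
  (chart_interior e) (chartr e) (coord e p) d c h K w s1 (@open_chart_interior _ _ _ X e) OE
  d0 c0 cross cw lineO (f phi) (f phi') n.+1 (fun z => b z n.+1) C e0 C' e0' (Num.min ea eb)
  (fc _ (admissible_continuous aphi)) (fc _ (admissible_continuous aphi')) fE fpos e00 e00' m0
  HC HC'.
exists D0, (Num.min e2 (e3 / 2 ^+ n.+1)).
have p2 (l : nat) : 0 < 2 ^+ l :> R by rewrite exprn_gt0.
split; first by rewrite lt_min e20 divr_gt0.
move=> eps /andP[eps0]; rewrite lt_min => /andP[E2]; rewrite ltr_pdivlMr// => E3.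
have el l : (l <= n.+1)%N -> 0 < 2 ^+ l * eps < e3.
  move=> ln; rewrite mulr_gt0//=; apply: le_lt_trans E3.
  by rewrite mulrC ler_pM2l// ler_eXn2l// ltr1n.
have mS phi1 eps1 : admissible phi1 -> measurable (superlevel phi1 eps1).
  by move=> a; apply: superlevel_measurable; exact: admissible_continuous.
have vol l : (l <= n.+1)%N -> let eps1 := 2 ^+ l * eps in
   [/\ mu (superlevel phi eps1 `\` superlevel phi' eps1) \is a fin_num,
   mu (superlevel phi' eps1 `\` superlevel phi eps1) \is a fin_num &
   fine (mu (superlevel phi eps1)) - fine (mu (superlevel phi' eps1)) =
   fine (mu (superlevel phi eps1 `\` superlevel phi' eps1)) -
   fine (mu (superlevel phi' eps1 `\` superlevel phi eps1))].
  move=> ln /=; have [f1 f2] := fin _ (el l ln).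
  by apply: measure_difference => //; exact: mS.
have volE l := @superlevel_difference_volume e phi phi' (2 ^+ l * eps) (mulr_gt0 (p2 l) eps0)
  (admissible_continuous aphi) (admissible_continuous aphi') (admissible_eq0 aphi)
  (fun q h => (D q h).1).
have D' q : phi' q <> phi q -> dom e q by move=> /nesym/D[].
have volE' l := @superlevel_difference_volume e phi' phi (2 ^+ l * eps) (mulr_gt0 (p2 l) eps0)
  (admissible_continuous aphi') (admissible_continuous aphi) (admissible_eq0 aphi') D'.
have -> : \sum_(l < n.+2) (dyadic_poly R n.+1)`_l *
        (fine (mu (superlevel phi (2 ^+ l * eps))) -
         fine (mu (superlevel phi' (2 ^+ l * eps)))) =
   \sum_(l < n.+2) (dyadic_poly R n.+1)`_l *
        (fine (mu (superlevel phi (2 ^+ l * eps) `\` superlevel phi' (2 ^+ l * eps))) -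
         fine (mu (superlevel phi' (2 ^+ l * eps) `\` superlevel phi (2 ^+ l * eps)))).
  apply: eq_bigr => l _; have ln : (l <= n.+1)%N by rewrite -ltnS.
  by have [_ _ ->] := vol l ln.
have := HD eps (introT andP (conj eps0 E2)) => /=.
under [in X in _ -> X]eq_bigr => l _ do rewrite volE volE'.
apply => l ln; have [] := vol l ln; rewrite volE volE' => v1 v2 _; split; [exact: v1|exact: v2].
Qed.

End LocalVolume.

(** * Cutoff functions and telescoping *)

Section Cutoffs.
Context (R : realType).

(* C^N is enough, since only the first N + 1 Taylor coefficients along transversal
   lines are used. *)
Definition smoothstep (N : nat) (x : R) : R :=
  1 - maxr (1 - maxr x 0 ^+ N.+1) 0 ^+ N.+1.

Lemma smoothstep_eq0 N x : x <= 0 -> smoothstep N x = 0.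
Proof.
by move=> x0; rewrite /smoothstep (max_r x0) expr0n/= subr0 (max_l ler01) expr1n subrr.
Qed.

Lemma smoothstep_eq1 N x : 1 <= x -> smoothstep N x = 1.
Proof.
move=> x1; rewrite /smoothstep (max_l (le_trans ler01 x1)) max_r ?expr0n/= ?subr0//.
by rewrite subr_le0 exprn_ege1.
Qed.

Lemma smoothstep_bound N x : 0 <= smoothstep N x <= 1.
Proof.
have m0 y : 0 <= maxr y 0 :> R by rewrite le_max lexx orbT.
rewrite /smoothstep subr_ge0 lerBlDr lerDl exprn_ge0// andbT.
by rewrite exprn_ile1// ge_max ler01 lerBlDr lerDl exprn_ge0.
Qed.

Lemma maxr0_continuous : continuous (fun x : R => maxr x 0).
Proof.
have -> : (fun x : R => maxr x 0) = (fun x : R => (x + `|x|) / 2).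
  apply/funext => x; case: (leP 0 x) => h; first by rewrite ger0_norm//; field.
  by rewrite ltr0_norm// subrr mul0r.
move=> x; apply: cvgM; last exact: cvg_cst.
by apply: cvgD; [exact: cvg_id|exact: (@norm_continuous R R)].
Qed.

Lemma smoothstep_continuous N : continuous (smoothstep N).
Proof.
have p (f : R -> R) : continuous f -> continuous (fun x => maxr (f x) 0 ^+ N.+1).
  move=> cf x.
  have h1 : maxr (f y) 0 @[y --> x] --> maxr (f x) 0.
    exact: (@continuous_comp _ _ _ f (fun y => maxr y 0) x (cf x) (@maxr0_continuous _)).
  exact: (@continuous_comp _ _ _ (fun y => maxr (f y) 0) (fun y => y ^+ N.+1) x h1
    (@exprn_continuous _ _ _)).
have c1 : continuous (fun x : R => maxr x 0 ^+ N.+1) by apply: p => x; exact: cvg_id.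
have c2 : continuous (fun x : R => 1 - maxr x 0 ^+ N.+1).
  by move=> x; apply: cvgB; [exact: cvg_cst|exact: c1].
by move=> x; apply: cvgB; [exact: cvg_cst|exact: (p _ c2)].
Qed.

Lemma expands_smoothstep (Z : Type) (F : set_system Z) {FF : Filter F} N (f : Z * R -> R) :
  expands F N.+1 f -> expands F N.+1 (fun x => smoothstep N (f x)).
Proof.
by move=> ef; apply: expandsB; [exact: expands_real|apply: expands_pospow;
  apply: expandsB; [exact: expands_real|exact: expands_pospow]].
Qed.

Lemma expands_sum (Z I : Type) (F : set_system Z) {FF : Filter F} N (l : seq I)
    (f : I -> Z * R -> R) : (forall j, expands F N (f j)) ->
  expands F N (fun x => \sum_(j <- l) f j x).
Proof.
move=> ef; elim: l => [|j l IH].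
  have e0 : expands F N (fun _ : Z * R => 0) by exact: expands_real.
  by apply: eq_expands e0; apply: nearW => x; rewrite big_nil.
by apply: eq_expands (expandsD (ef j) IH); apply: nearW => x; rewrite big_cons.
Qed.

Lemma sum_continuous (V : topologicalType) (I : Type) (l : seq I) (f : I -> V -> R) :
  (forall j, continuous (f j)) -> continuous (fun x => \sum_(j <- l) f j x).
Proof.
move=> cf; elim: l => [|j l IH].
  have -> : (fun x => \sum_(j <- [::]) f j x) = cst 0 by apply/funext => x; rewrite big_nil.
  by move=> x; exact: cvg_cst.
have -> : (fun x => \sum_(k <- j :: l) f k x) = (fun x => f j x + \sum_(k <- l) f k x).
  by apply/funext => x; rewrite big_cons.
by move=> x; apply: cvgD; [exact: cf|exact: IH].
Qed.

Lemma affine_continuous (V : topologicalType) (f : V -> R) (a c : R) :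
  continuous f -> continuous (fun x => a * (c - f x)).
Proof.
move=> cf x; apply: cvgM; first exact: cvg_cst.
by apply: cvgB; [exact: cvg_cst|exact: cf].
Qed.

Lemma exists_bump (m : nat) (T : topologicalType) (X : complex_manifold R m T)
    N (e : chart X) p (d : R) : hausdorff_space T ->
  dom e p -> 0 < d -> box (coord e p) d `<=` chartW e ->
  exists psi : T -> R, [/\ continuous psi, expandable X N.+1 psi,
    forall q, 0 <= psi q <= 1,
    forall q, psi q <> 0 -> dom e q /\ box (coord e p) d (coord e q) &
    \forall q \near p, psi q = 1].
Proof.
move=> hT de d0 bW; set z0 := coord e p.
(* b is positive only in the Euclidean ball of radius d, which lies in the box, and b = 2 at z0, so
   psi = 1 in a whole neighbourhood of p. *)
pose b (z : model R m) := 2 / d ^+ 2 * (d ^+ 2 - \sum_l (z 0 l - z0 0 l) ^+ 2).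
pose psi q := if pselect (dom e q) then smoothstep N (b (coord e q)) else 0.
have psiE q : dom e q -> psi q = smoothstep N (b (coord e q)).
  by rewrite /psi; case: pselect.
have d20 : 0 < d ^+ 2 by rewrite exprn_gt0.
have supp q : psi q <> 0 -> dom e q /\ box z0 d (coord e q).
  rewrite /psi; case: pselect => // dq h; split => // l.
  have : 0 < b (coord e q) by rewrite ltNge; apply/negP => /(smoothstep_eq0 N).
  rewrite /b pmulr_rgt0 ?divr_gt0// subr_gt0 => Sd.
  rewrite -(ler_pXn2r (n := 2)) ?nnegrE ?normr_ge0 ?(ltW d0)//.
  rewrite real_normK ?num_real//; apply: le_trans (ltW Sd).
  by rewrite (bigD1 l)//= lerDl sumr_ge0// => j _; exact: sqr_ge0.
(* The support of psi lies in C, which is compact, hence closed because T is Hausdorff, and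
   contained in [dom e]. So psi vanishes near every point outside [dom e], and the extension by 0 is
   continuous. *)
pose C : set T := coordV e @` (box z0 d `&` (chartr e) @^-1` [set y | y <= 0]).
have CD q : C q -> dom e q.
  by move=> [z [/bW Wz rz] <-]; have [] := chart_image Wz rz.
have closedC : closed C.
  apply: compact_closed => //; apply: continuous_compact.
    apply: (continuous_subspaceW _ (@coordV_continuous _ _ _ X e)).
    by move=> z [/bW Wz rz]; rewrite coord_image.
  apply: compact_preimage.
  - by [].
  - exact: box_compact.
  - exact: closed_le.
  - by move=> z /bW /chartr_smooth /smooth_at_continuous.
have out q : ~ dom e q -> \forall y \near q, psi y = 0.
  move=> nq; have nC : (~` C) q by move=> /CD.
  apply: filterS (open_nbhs_nbhs (conj (closed_openC closedC) nC)) => y nCy.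
  apply: contrapT => /supp[dy bz]; apply: nCy.
  have [Wy ry] := image_chart dy; exists (coord e y); first by split.
  by rewrite coordK.
have cb : continuous b.
  have cs : continuous (fun z : model R m => \sum_l (z 0 l - z0 0 l) ^+ 2).
    apply: sum_continuous => l z.
    have c1 : y 0 l - z0 0 l @[y --> z] --> z 0 l - z0 0 l.
      by apply: cvgB; [exact: matrix_normedtype.coord_continuous|exact: cvg_cst].
    exact: (@continuous_comp _ _ _ (fun y : model R m => y 0 l - z0 0 l) (fun y => y ^+ 2) z c1
      (@exprn_continuous _ _ _)).
  exact: affine_continuous.
have cbc q : dom e q -> {for q, continuous (fun y => b (coord e y))}.
  by move=> dq; exact: (@continuous_comp _ _ _ (coord e) b q (chart_cvg dq) (cb _)).
have neardom q : dom e q -> \forall y \near q, dom e y.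
  by move=> dq; apply: open_nbhs_nbhs; split => //; exact: dom_open.
exists psi; split => //.
- move=> q; have [dq|nq] := pselect (dom e q).
    have c1 : {for q, continuous (fun y => smoothstep N (b (coord e y)))}.
      exact: (@continuous_comp _ _ _ (fun y => b (coord e y)) (smoothstep N) q (cbc q dq)
        (@smoothstep_continuous _ _)).
    rewrite /continuous_at (psiE q dq); apply: cvg_trans c1; apply: near_eq_cvg.
    by apply: filterS (neardom q dq) => y dy; rewrite psiE.
  rewrite /continuous_at.
  have -> : psi q = 0 by exact: (nbhs_singleton (out q nq)).
  have c0 : (fun _ : T => 0 : R) @ q --> (0 : R) by exact: cvg_cst.
  apply: cvg_trans c0; apply: near_eq_cvg.
  by apply: filterS (out q nq) => y ->.
- move=> f p' i s [bp' dp' tr'].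
  have [dq|nq] := pselect (dom e p'); last first.
    have e0 : expands (bdry_nbhs f p') N.+1 (fun _ : model R m * R => 0).
      exact: expands_real.
    apply: eq_expands e0; have := line_pull dp' tr' (out p' nq).
    by apply: filterS => x ->.
  (* Expandability is required along the lines of every chart f; the smooth transition map expands
     the coordinates of e along them. *)
  have [tau [rep _]] := transition_holomorphic dp' dq.
  have ec l := smooth_rep_expands dp' tr' N.+1 (rep l).
  have eb : expands (bdry_nbhs f p') N.+1 (fun x => b (coord e (coordV f (line i s x)))).
    apply: expandsM; first exact: expands_real.
    apply: expandsB; first exact: expands_real.
    apply: expands_sum => l; apply: expandsXn; apply: expandsB; last exact: expands_real.
    exact: ec.
  apply: eq_expands (expands_smoothstep eb).
  have := line_pull dp' tr' (neardom p' dq).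
  by apply: filterS => x dx; rewrite psiE.
- move=> q; rewrite /psi; case: pselect => dq /=; first exact: smoothstep_bound.
  by rewrite lexx ler01.
- have b1 : 1 < b (coord e p).
    rewrite /b big1 ?subr0 ?divfK ?gt_eqF ?ltr1n// => l _.
    by rewrite /z0 subrr expr0n.
  near=> q; have dq : dom e q by near: q; exact: neardom.
  rewrite psiE// smoothstep_eq1// ltW//; near: q.
  exact: (cvgr_gt _ (cbc p de) _ b1).
Unshelve. all: by end_near. Qed.

Context (n : nat) (T : ptopologicalType) (X : complex_manifold R n.+1 T).

Lemma defining_function_admissible (phi : T -> R) : defining_function X phi ->
  admissible X phi.
Proof.
move=> dphi; have [sm lt0 eq0 _] := dphi; split => //.
- move=> q; have [e de] := dom_cover X q; have [G [sG GE]] := sm e q de.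
  rewrite /continuous_at (nbhs_singleton GE).
  have c1 : G (coord e y) @[y --> q] --> G (coord e q).
    exact: (@continuous_comp _ _ _ (coord e) G q (chart_cvg de) (smooth_at_continuous sG)).
  apply: cvg_trans c1; apply: near_eq_cvg; by apply: filterS GE => y ->.
- move=> e p i s [bp de tr]; have [G rep] := sm e p de.
  exact: (smooth_rep_expands de tr n.+2 rep).
- by move=> e p i s [bp de tr]; exact: (defining_function_line bp de tr dphi).
Qed.

Lemma admissible_convex (phi1 phi2 chi : T -> R) : admissible X phi1 -> admissible X phi2 ->
  continuous chi -> expandable X n.+2 chi -> (forall q, 0 <= chi q <= 1) ->
  admissible X (fun q => phi1 q + chi q * (phi2 q - phi1 q)).
Proof.
move=> [c1 e1 k1 l1 z1] [c2 e2 k2 l2 z2] cc ec chi01; split.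
- move=> q; apply: cvgD; first exact: c1.
  by apply: cvgM; [exact: cc|apply: cvgB; [exact: c2|exact: c1]].
- move=> e p i s t; apply: expandsD; first exact: e1.
  by apply: expandsM; [exact: ec|apply: expandsB; [exact: e2|exact: e1]].
- move=> e p i s t; have [C1 C10 H1] := k1 e p i s t; have [C2 C20 H2] := k2 e p i s t.
  exists (maxr C1 C2); first by rewrite lt_max C10.
  near=> x; have x0 : 0 < x.2 by near: x; exact: small_gt0.
  have /andP[a1 a2] : x.2 / C1 <= - phi1 (coordV e (line i s x)) <= C1 * x.2 by near: x.
  have /andP[b1 b2] : x.2 / C2 <= - phi2 (coordV e (line i s x)) <= C2 * x.2 by near: x.
  have /andP[t0 t1] := chi01 (coordV e (line i s x)).
  have C0 : 0 < maxr C1 C2 by rewrite lt_max C10.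
  have M1 : x.2 / maxr C1 C2 <= x.2 / C1 by rewrite ler_pM2l// lef_pV2// le_max lexx.
  have M2 : x.2 / maxr C1 C2 <= x.2 / C2 by rewrite ler_pM2l// lef_pV2// le_max lexx orbT.
  have M3 : C1 * x.2 <= maxr C1 C2 * x.2 by rewrite ler_pM2r// le_max lexx.
  have M4 : C2 * x.2 <= maxr C1 C2 * x.2 by rewrite ler_pM2r// le_max lexx orbT.
  move: (chi _) t0 t1 (phi1 _) (phi2 _) a1 a2 b1 b2 => t0 h0 h1 a b a1 a2 b1 b2.
  move: (x.2 / maxr C1 C2) (maxr C1 C2 * x.2) M1 M2 M3 M4 => m M M1 M2 M3 M4.
  have A1 := le_trans M1 a1; have A2 := le_trans a2 M3.
  have B1 := le_trans M2 b1; have B2 := le_trans b2 M4.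
  by apply/andP; split; nra.
- move=> q iq; have := l1 q iq; have := l2 q iq; have /andP[] := chi01 q.
  by move: (chi q) (phi1 q) (phi2 q) => t a b; nra.
- by move=> q bq; rewrite z1// z2// subrr mulr0 addr0.
Unshelve. all: by end_near. Qed.

End Cutoffs.

Section Telescoping.
Context (R : realType) (n : nat) (T : ptopologicalType) (X : complex_manifold R n.+1 T).
Context (mu : {measure set (borel T) -> \bar R}).
Notation q_ l := ((dyadic_poly R n.+1)`_l).

(** Boundedness is asked of the dyadic combination alone: the difference of the volumes may itself
    blow up like powers of 1/eps. The combination is additive, so closeness is transitive and local
    changes can be chained. *)
Definition dyadically_close (phi phi' : T -> R) : Prop :=
  exists D e2 : R, 0 < e2 /\ forall eps, 0 < eps < e2 ->
    `|\sum_(l < n.+2) q_ l * (fine (mu (superlevel phi (2 ^+ l * eps))) -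
         fine (mu (superlevel phi' (2 ^+ l * eps))))| <= D.

Lemma dyadically_close_refl phi : dyadically_close phi phi.
Proof.
exists 0, 1; split; first exact: ltr01.
by move=> eps _; rewrite big1 ?normr0// => l _; rewrite subrr mulr0.
Qed.

Lemma dyadically_close_trans phi1 phi2 phi3 :
  dyadically_close phi1 phi2 -> dyadically_close phi2 phi3 -> dyadically_close phi1 phi3.
Proof.
move=> [D [e [e0 H]]] [D' [e' [e0' H']]]; exists (D + D'), (Num.min e e').
split; first by rewrite lt_min e0.
move=> eps /andP[p0]; rewrite lt_min => /andP[pe pe'].
have h := H eps (introT andP (conj p0 pe)); have h' := H' eps (introT andP (conj p0 pe')).
apply: le_trans (lerD h h'); apply: le_trans (ler_normD _ _).
rewrite -big_split /= le_eqVlt; apply/orP; left; apply/eqP; congr `|_|.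
by apply: eq_bigr => l _; ring.
Qed.

Definition finite_superlevels (e3 : R) (phi : T -> R) : Prop :=
  forall eps, 0 < eps < e3 -> mu (superlevel phi eps) \is a fin_num.

(** If a convex combination is below - eps, one of its terms is, so the superlevel set is covered by
    those of phi1 and phi2. *)
Lemma finite_superlevels_convex e3 phi1 phi2 (chi : T -> R) :
  admissible X phi1 -> admissible X phi2 -> continuous chi -> expandable X n.+2 chi ->
  (forall q, 0 <= chi q <= 1) ->
  finite_superlevels e3 phi1 -> finite_superlevels e3 phi2 ->
  finite_superlevels e3 (fun q => phi1 q + chi q * (phi2 q - phi1 q)).
Proof.
move=> a1 a2 cc ec chi01 f1 f2 eps he.
have m phi : admissible X phi -> measurable (superlevel phi eps).
  by move=> a; apply: superlevel_measurable; exact: admissible_continuous a.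
have a3 := admissible_convex a1 a2 cc ec chi01.
rewrite ge0_fin_numE//.
apply: (@le_lt_trans _ _ (mu (superlevel phi1 eps `|` superlevel phi2 eps))).
  apply: le_measure; rewrite ?inE.
  - exact: m a3.
  - by apply: measurableU; exact: m.
  move=> q /=; rewrite /superlevel /= => h.
  have [|h1] := ltP (phi1 q) (- eps); first by left.
  right; rewrite /= ltNge; apply/negP => h2; have /andP[t0 t1] := chi01 q.
  by move: (chi q) (phi1 q) (phi2 q) t0 t1 h h1 h2 => t a b; nra.
apply: le_lt_trans (measureU2 _ (m _ a1) (m _ a2)) _.
by rewrite lte_add_pinfty// -ge0_fin_numE//; [exact: f1|exact: f2].
Qed.

(** Packages a cutoff with the conclusion of [local_step] for changes inside its support, so that
    charts and boxes can be forgotten from here on. *)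
Definition local_cutoff (psi : T -> R) : Prop := [/\ continuous psi,
  expandable X n.+2 psi, forall q, 0 <= psi q <= 1 &
  forall phi phi' e3, admissible X phi -> admissible X phi' ->
    (forall q, phi q <> phi' q -> psi q <> 0) -> 0 < e3 ->
    finite_superlevels e3 phi -> finite_superlevels e3 phi' -> dyadically_close phi phi'].

(** chi is 1 minus the product of the 1 - psi_j. Adding one factor alters phi1 + chi (phi2 - phi1)
    only where psi_j <> 0 and keeps it admissible, so one application of [local_cutoff] covers
    it. *)
Lemma cutoff_union e3 phi1 phi2 (I : eqType) (psi : I -> T -> R) (l : seq I) :
  admissible X phi1 -> admissible X phi2 -> 0 < e3 ->
  finite_superlevels e3 phi1 -> finite_superlevels e3 phi2 ->
  (forall j, j \in l -> local_cutoff (psi j)) ->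
  exists chi : T -> R, [/\ continuous chi, expandable X n.+2 chi, forall q, 0 <= chi q <= 1,
    forall j q, j \in l -> psi j q = 1 -> chi q = 1 &
    dyadically_close phi1 (fun q => phi1 q + chi q * (phi2 q - phi1 q))].
Proof.
move=> a1 a2 e30 f1 f2; elim: l => [_|j l IH Hl].
  exists (fun=> 0); split => //.
  - by move=> q; exact: cvg_cst.
  - by move=> e p i s _; exact: expands_real.
  - by move=> q; rewrite lexx ler01.
  have -> : (fun q => phi1 q + 0 * (phi2 q - phi1 q)) = phi1.
    by apply/funext => q; rewrite mul0r addr0.
  exact: dyadically_close_refl.
have [|chi [cc ec chi01 chi1 cl]] := IH.
  by move=> k kl; apply: Hl; rewrite inE kl orbT.
have [cp ep psi01 Hp] := Hl j (mem_head _ _).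
pose chi' q := 1 - (1 - psi j q) * (1 - chi q).
have cc' : continuous chi'.
  move=> q; apply: cvgB; first exact: cvg_cst.
  by apply: cvgM; apply: cvgB; [exact: cvg_cst|exact: cp|exact: cvg_cst|exact: cc].
have ec' : expandable X n.+2 chi'.
  move=> e p i s t; apply: expandsB; first exact: expands_real.
  by apply: expandsM; apply: expandsB; [exact: expands_real|exact: ep|exact: expands_real|exact: ec].
have chi01' q : 0 <= chi' q <= 1.
  have /andP[u0 u1] := psi01 q; have /andP[v0 v1] := chi01 q; rewrite /chi'.
  by move: (psi j q) (chi q) u0 u1 v0 v1 => u v u0 u1 v0 v1; apply/andP; split; nra.
exists chi'; split => //.
  move=> k q; rewrite inE => /orP[/eqP ->|kl] h; rewrite /chi'.
    by rewrite h subrr mul0r subr0.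
  by rewrite (chi1 k q kl h) subrr mulr0 subr0.
apply: dyadically_close_trans cl _; apply: (Hp _ _ e3).
- exact: admissible_convex.
- exact: admissible_convex.
- by move=> q h z; apply: h; rewrite /chi' z subr0 mul1r subKr.
- by [].
- exact: finite_superlevels_convex.
- exact: finite_superlevels_convex.
Qed.

Lemma compact_bdry phi : compact [set: T] -> admissible X phi -> compact (bdry X).
Proof.
move=> cT a; have E : bdry X = phi @^-1` [set 0].
  apply/seteqP; split => q /=; first exact: admissible_eq0 a q.
  move=> z; apply: contrapT => /(admissible_lt0 a); by rewrite z ltxx.
apply: (subclosed_compact _ cT) => //; rewrite E; apply: preimage_closed => //.
by move=> q _; exact: (admissible_continuous a).
Qed.

Lemma interior_superlevel phi (V : set T) : compact [set: T] -> admissible X phi ->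
  open V -> bdry X `<=` V -> exists2 e1 : R, 0 < e1 & forall q, ~ V q -> phi q <= - e1.
Proof.
move=> cT a oV bV.
have cV : compact (~` V) by apply: (subclosed_compact _ cT) => //; exact: open_closedC.
have [||e1 e10 H] := @compact_pos_bound R T (~` V) (fun q => - phi q) cV.
- have cphi := admissible_continuous a; move=> q _; exact: (cvgN (cphi q)).
- by move=> q nV; rewrite oppr_gt0; apply: (admissible_lt0 a) => /bV.
by exists e1 => // q nV; rewrite lerNr; exact: H.
Qed.

Lemma admissible_close phi1 phi2 e3 : compact [set: T] ->
  (forall p, bdry X p -> exists2 psi, local_cutoff psi & \forall q \near p, psi q = 1) ->
  admissible X phi1 -> admissible X phi2 -> 0 < e3 ->
  finite_superlevels e3 phi1 -> finite_superlevels e3 phi2 -> dyadically_close phi1 phi2.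
Proof.
move=> cT Hloc a1 a2 e30 f1 f2.
have : forall p, exists psi : T -> R, bdry X p ->
    local_cutoff psi /\ \forall q \near p, psi q = 1.
  move=> p; have [bp|nb] := pselect (bdry X p); last by exists (fun=> 0).
  by have [psi h1 h2] := Hloc p bp; exists psi.
move=> /choice[psi Hpsi].
have cb := compact_bdry cT a1; rewrite compact_cover in cb.
pose f p := [set q | psi p q = 1]°.
have [||D' D'b cov] := cb T (bdry X) f.
- by move=> p _; exact: open_interior.
- by move=> p bp; exists p => //; have [_] := Hpsi p bp.
pose l := finmap.enum_fset D'.
have lb p : p \in l -> bdry X p by move=> pl; have := D'b p pl; rewrite inE.
have [|chi [cc ec chi01 chi1 cl]] := @cutoff_union e3 phi1 phi2 T psi l a1 a2 e30 f1 f2.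
  by move=> p /lb bp; have [] := Hpsi p bp.
apply: dyadically_close_trans cl _.
set phi3 := (fun q => _); have a3 : admissible X phi3 by exact: admissible_convex.
pose V := \bigcup_(p in [set p | p \in l]) f p.
have oV : open V by apply: bigcup_open => p _; exact: open_interior.
have bV : bdry X `<=` V.
  by move=> p bp; have [i il fi] := cov p bp; exists i.
have VE q : V q -> phi3 q = phi2 q.
  move=> [p pl fp]; rewrite /phi3 (chi1 p q pl) ?mul1r 1?addrC ?subrK//.
  exact: (interior_subset fp).
(* On V the functions phi3 and phi2 agree; off V both lie below a fixed negative level. For small
   eps their superlevel sets therefore coincide. *)
have [e1 e10 H1] := interior_superlevel cT a3 oV bV.
have [e2 e20 H2] := interior_superlevel cT a2 oV bV.
have m0 : 0 < Num.min e1 e2 by rewrite lt_min e10.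
have p2 (j : nat) : 0 < 2 ^+ j :> R by rewrite exprn_gt0.
exists 0, (Num.min e1 e2 / 2 ^+ n.+1); split; first by rewrite divr_gt0.
move=> eps /andP[eps0]; rewrite ltr_pdivlMr// => E.
rewrite big1 ?normr0// => j _.
have je : 2 ^+ j * eps < Num.min e1 e2.
  by apply: le_lt_trans E; rewrite mulrC ler_pM2l// ler_eXn2l ?ltr1n// -ltnS.
move: je; rewrite lt_min => /andP[j1 j2].
have -> : superlevel phi3 (2 ^+ j * eps) = superlevel phi2 (2 ^+ j * eps).
  apply/seteqP; split => q; rewrite /superlevel /=; have [Vq|nV] := pselect (V q).
  - by rewrite VE.
  - by move=> _; apply: le_lt_trans (H2 q nV) _; rewrite ltrN2.
  - by rewrite VE.
  - by move=> _; apply: le_lt_trans (H1 q nV) _; rewrite ltrN2.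
by rewrite subrr mulr0.
Qed.

Lemma local_cutoff_exists (gplus g : herm_field X) p : hausdorff_space T ->
  fefferman_metric gplus -> hermitian_metric (inside X) g ->
  same_boundary_expansion g gplus -> volume_measure g mu -> bdry X p ->
  exists2 psi, local_cutoff psi & \forall q \near p, psi q = 1.
Proof.
move=> hT hF hg hs hv bp; have [e [d [d0 de bW H]]] := local_step hF hg hs hv bp.
have [psi [cp ep psi01 supp near1]] := @exists_bump R n.+1 T X n.+1 e p d hT de d0 bW.
exists psi => //; split => // phi phi' e3 a a' D e30 f f'.
apply: (H phi phi' e3 a a') => //; first by move=> q /D; exact: supp.
by move=> eps he; split; [exact: f|exact: f'].
Qed.

Lemma log_coefficient_expansion phi L : log_coefficient n mu phi L ->
  exists (d : nat -> R) (V dl : R), 0 < dl /\ forall eps, 0 < eps < dl ->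
    mu (superlevel phi eps) \is a fin_num /\
    `|fine (mu (superlevel phi eps)) -
      (\sum_(j < n.+1) d j / eps ^+ j.+1 + L * ln eps + V)| <= 1.
Proof.
move=> [fin [c [V /cvgrPdist_le /(_ 1 ltr01) H]]].
have [dl dl0 Hd] := (nbhs_ballP _ _).1 (filterI fin H).
(* Here eps > 0 stands for the negative of the original variable, whence the sign (-1)^(k+1).
   Reversing the order of the sum makes the pole of index k have exponent k + 1, and o(1) is
   weakened to a bound by 1. *)
exists (fun k => c (inord (n - k)) * (-1) ^+ k.+1), V, dl; split => // eps /andP[e0 edl].
have [||f h] := Hd (- eps); [|by rewrite oppr_lt0|].
  by rewrite /ball /= sub0r opprK gtr0_norm.
split; first exact: f.
move: h; rewrite sub0r normrN opprK; congr (`|_ - (_ + _ + _)| <= _).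
rewrite [LHS](reindex_inj rev_ord_inj) /=; apply: eq_bigr => j _.
have jn := ltn_ord j.
have -> : rev_ord j = inord (n - j) by apply: val_inj; rewrite /= inordK ?subSS ?ltnS ?leq_subr.
have -> : (n.+1 - (n.+1 - j.+1))%N = j.+1 by rewrite subKn.
by rewrite (exprNn eps) invfM invr_sign mulrA.
Qed.

Lemma log_coefficient_unique phi1 phi2 L1 L2 : dyadically_close phi1 phi2 ->
  log_coefficient n mu phi1 L1 -> log_coefficient n mu phi2 L2 -> L1 = L2.
Proof.
move=> [D [e2 [e20 H]]] /log_coefficient_expansion[d1 [V1 [r1 [r10 H1]]]].
move=> /log_coefficient_expansion[d2 [V2 [r2 [r20 H2]]]].
pose Q := \sum_(l < n.+2) q_ l.
have Q0 : 0 < Q.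
  have := dyadic_poly1 R n.+1; rewrite -dyadic_sum; congr (0 < _).
  by apply: eq_bigr => l _; rewrite expr1n mulr1.
pose S := \sum_(l < n.+2) q_ l * (l%:R * ln 2).
(* S collects the constants from ln (2^l eps) = l ln 2 + ln eps, and the 2 bounds the errors of the
   two expansions. *)
pose M := D + `|L1 - L2| * `|S| + (\sum_(l < n.+2) `|q_ l|) * (`|V1 - V2| + 2).
have p2 (j : nat) : 0 < 2 ^+ j :> R by rewrite exprn_gt0.
pose m := Num.min (Num.min r1 r2) (e2 * 2 ^+ n.+1) / 2 ^+ n.+1.
have m0 : 0 < m by rewrite divr_gt0// !lt_min r10 r20 mulr_gt0.
have bound eps : 0 < eps < m -> `|(L1 - L2) * Q * ln eps| <= M.
  move=> /andP[eps0]; rewrite ltr_pdivlMr// !lt_min => /andP[/andP[E1 E2] E3].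
  have le l : (l < n.+2)%N -> 2 ^+ l * eps <= eps * 2 ^+ n.+1.
    by move=> ln; rewrite mulrC ler_pM2l// ler_eXn2l ?ltr1n// -ltnS.
  have {}H := H eps (introT andP (conj eps0 _)).
  have {H} : `|\sum_(l < n.+2) q_ l * (fine (mu (superlevel phi1 (2 ^+ l * eps))) -
         fine (mu (superlevel phi2 (2 ^+ l * eps))))| <= D.
    by apply: H; move: E3; rewrite ltr_pM2r.
  pose v1 (l : nat) := fine (mu (superlevel phi1 (2 ^+ l * eps))).
  pose v2 (l : nat) := fine (mu (superlevel phi2 (2 ^+ l * eps))).
  pose t (d : nat -> R) L V (l : nat) := \sum_(j < n.+1) d j / (2 ^+ l * eps) ^+ j.+1 +
    L * ln (2 ^+ l * eps) + V.
  have h1 (l : 'I_n.+2) : `|v1 l - t d1 L1 V1 l| <= 1.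
    by apply: (H1 _ _).2; rewrite mulr_gt0//= (le_lt_trans (le l (ltn_ord l))).
  have h2 (l : 'I_n.+2) : `|v2 l - t d2 L2 V2 l| <= 1.
    by apply: (H2 _ _).2; rewrite mulr_gt0//= (le_lt_trans (le l (ltn_ord l))).
  have lnE (l : nat) : ln (2 ^+ l * eps) = l%:R * ln 2 + ln eps.
    by rewrite lnM ?posrE// lnXn// mulr_natl.
  have E : (L1 - L2) * Q * ln eps = \sum_(l < n.+2) q_ l * (v1 l - v2 l) - (L1 - L2) * S
     - \sum_(l < n.+2) q_ l * ((v1 l - t d1 L1 V1 l) - (v2 l - t d2 L2 V2 l) + (V1 - V2)).
    transitivity ((L1 - L2) * Q * ln eps +
      (\sum_(l < n.+2) q_ l * (\sum_(j < n.+1) d1 j / (2 ^+ l * eps) ^+ j.+1) -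
       \sum_(l < n.+2) q_ l * (\sum_(j < n.+1) d2 j / (2 ^+ l * eps) ^+ j.+1))).
      by rewrite !dyadic_kill// subr0 addr0.
    rewrite /Q /S -!mulrA !(mulr_sumr, mulr_suml) -!sumrB -big_split /=.
    by apply: eq_bigr => l _; rewrite /t lnE; ring.
  move=> hD; rewrite E /M; apply: le_trans (ler_normB _ _) _; apply: lerD.
    apply: le_trans (ler_normB _ _) _; apply: lerD; first exact: hD.
    by rewrite normrM.
  rewrite mulr_suml; apply: le_trans (ler_norm_sum _ _ _) _; apply: ler_sum => l _.
  rewrite normrM ler_wpM2l// addrC; apply: le_trans (ler_normD _ _) _; rewrite lerD2l.
  apply: le_trans (ler_normB _ _) _; have := h1 l; have := h2 l.
  by move: (`|v1 l - _|) (`|v2 l - _|) => a b; lra.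
apply/eqP; rewrite -subr_eq0; apply/negPn/negP => L0.
have a0 : 0 < `|(L1 - L2) * Q| by rewrite normr_gt0 mulf_neq0// gt_eqF.
have M0 : 0 <= M.
  have h : 0 < m / 2 < m by apply/andP; split; lra.
  exact: le_trans (normr_ge0 _) (bound _ h).
(* So small that |(L1 - L2) Q| |ln eps| >= M + 1, against the bound by M. *)
pose eps := Num.min (m / 2) (expR (- ((M + 1) / `|(L1 - L2) * Q|))).
have eps0 : 0 < eps by rewrite lt_min expR_gt0 andbT divr_gt0.
have eps1 : eps < m by rewrite gt_min; apply/orP; left; lra.
have := bound eps (introT andP (conj eps0 eps1)); rewrite normrM.
have : ln eps <= - ((M + 1) / `|(L1 - L2) * Q|).
  by rewrite -[leRHS]expRK ler_ln ?posrE ?expR_gt0// ge_min lexx orbT.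
rewrite lerNr => h1 h2.
have : M + 1 <= `|(L1 - L2) * Q| * `|ln eps|.
  rewrite mulrC -ler_pdivrMr//; apply: le_trans h1 _.
  by rewrite -normrN; exact: ler_norm.
by move=> h3; have := le_trans h3 h2; rewrite -subr_ge0 opprD addNKr oppr_ge0 ler10.
Qed.

End Telescoping.

Theorem proposition4p1 (R : realType) (n : nat) (T : ptopologicalType)
  (X : complex_manifold R n.+1 T)
  (hausdorffX : hausdorff_space T) (compactX : compact [set: T])
  (pseudoconvexM : strictly_pseudoconvex X)
  (gplus g : herm_field X)
  (gplus_fefferman : fefferman_metric gplus)
  (g_metric : hermitian_metric (inside X) g)
  (g_gplus : same_boundary_expansion g gplus)
  (mu : {measure set (borel T) -> \bar R})
  (mu_volume : volume_measure g mu)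
  (theta1 theta2 : boundary_form X)
  (theta1_pseudohermitian : pseudohermitian theta1)
  (theta2_pseudohermitian : pseudohermitian theta2)
  (phi1 phi2 : T -> R)
  (phi1_special : special_defining_function gplus theta1 phi1)
  (phi2_special : special_defining_function gplus theta2 phi2)
  (L1 L2 : R)
  (L1_log : log_coefficient n mu phi1 L1)
  (L2_log : log_coefficient n mu phi2 L2) :
  L1 = L2.
Proof.
have [/defining_function_admissible a1 _ _] := phi1_special.
have [/defining_function_admissible a2 _ _] := phi2_special.
have [d1 [V1 [r1 [r10 H1]]]] := log_coefficient_expansion L1_log.
have [d2 [V2 [r2 [r20 H2]]]] := log_coefficient_expansion L2_log.
apply: log_coefficient_unique L1_log L2_log.
(* The finiteness of the small superlevel volumes is part of the two expansions, valid below r1 and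
   r2. *)
apply: (@admissible_close R n T X mu phi1 phi2 (Num.min r1 r2)) => //.
- move=> p; exact: (local_cutoff_exists hausdorffX gplus_fefferman g_metric g_gplus mu_volume).
- by rewrite lt_min r10.
- by move=> eps /andP[e0]; rewrite lt_min => /andP[h _]; have [] := H1 eps (introT andP (conj e0 h)).
- by move=> eps /andP[e0]; rewrite lt_min => /andP[_ h]; have [] := H2 eps (introT andP (conj e0 h)).
Qed.
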